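(* Let $P$ be a Gorenstein polytope of dimension $3s-1$ and degree $s>0$. Then $P$ is not a lattice pyramid if and only if $P$ is isomorphic to the free join of $s$ copies of $[0,1]^2$.
   Context: Let $M\cong\mathbb{Z}^d$ be a lattice with associated real vector space $M_{\mathbb{R}}$. A lattice polytope is a nonempty polytope in $M_{\mathbb R}$ with vertices in $M$; it is always considered with respect to the lattice of its affine hull. Two lattice polytopes are isomorphic if there is an affine isomorphism of their affine hulls mapping one polytope onto the other and mapping the lattices bijectively onto each other. A lattice polytope $P$ is reflexive if it contains a (relative) interior lattice point $m$ such that for each facet $F$ there is an integral functional $u$ in the dual lattice with $\langle u,f\rangle-\langle u,m\rangle=1$ for all $f\in F$. A lattice polytope $P$ is Gorenstein if $rP$ is reflexive for some positive integer $r$. The codegree of a lattice polytope $P$ is $\operatorname{codeg}P:=\min\{r\ge1:\operatorname{relint}(rP)\cap M\ne\varnothing\}$ and its degree is $\deg P:=\dim P+1-\operatorname{codeg}P$. (For Gorenstein $P$, the codegree is the $r$ with $rP$ reflexive.) Given lattice polytopes $P_1,P_2$, full-dimensional with respect to lattices $M_1,M_2$, their free join is $P_1\circ_{\mathbb Z}P_2:=\operatorname{conv}(P_1\times\{0\}\times\{0\},\{0\}\times P_2\times\{1\})\subset (M_1)_{\mathbb R}\oplus (M_2)_{\mathbb R}\oplus\mathbb R$, with respect to the lattice $M_1\oplus M_2\oplus\mathbb Z$; free joins of several polytopes are obtained by iterating (the free join of one copy is the polytope itself). A lattice polytope is a lattice pyramid if it is a lattice point or is isomorphic to the free join of a lattice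 polytope with a lattice point. *)

(* Defs.v *)
From mathcomp Require Import all_boot all_order all_algebra.
From mathcomp Require Import all_classical all_reals all_analysis.
Import Order.TTheory GRing.Theory Num.Theory.
Import numFieldNormedType.Exports.

Set Implicit Arguments.
Unset Strict Implicit.
Unset Printing Implicit Defensive.

Local Open Scope classical_set_scope.
Local Open Scope ring_scope.

(* The lattice M of rank n is Z^n inside M_R = 'rV[R]_n; elements of the dual
   space are column vectors. *)

Definition integral_points (R : realType) (n : nat) : set 'rV[R]_n :=
  [set x | forall i, x 0 i \is a Num.int].
Arguments integral_points : clear implicits.

Definition pairing (R : realType) (n : nat) (u : 'cV[R]_n) (x : 'rV[R]_n) : R :=
  (x *m u) 0 0.

Definition affine_hull (R : realType) (n : nat) (A : set 'rV[R]_n) :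
    set 'rV[R]_n :=
  [set x | exists (k : nat) (p : 'I_k -> 'rV[R]_n) (a : 'I_k -> R),
     [/\ forall i, A (p i), \sum_i a i = 1 & x = \sum_i a i *: p i]].

Definition convex_hull (R : realType) (n : nat) (A : set 'rV[R]_n) :
    set 'rV[R]_n :=
  [set x | exists (k : nat) (p : 'I_k -> 'rV[R]_n) (a : 'I_k -> R),
     [/\ forall i, A (p i), forall i, 0 <= a i,
         \sum_i a i = 1 & x = \sum_i a i *: p i]].

(* Dimension of the affine hull; a nonempty set has exactly one, and the
   default value 0 is only reached by the empty set. *)
Definition has_dim (R : realType) (n : nat) (A : set 'rV[R]_n) (d : nat) : Prop :=
  exists (p : 'rV[R]_n) (V : {vspace 'rV[R]_n}),
    affine_hull A = [set p + v | v in [set` V]] /\ \dim V = d.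

Definition aff_dim (R : realType) (n : nat) (A : set 'rV[R]_n) : nat :=
  xget 0%N [set d | has_dim A d].

Definition relint (R : realType) (n : nat) (A : set 'rV[R]_n) : set 'rV[R]_n :=
  [set x | A x /\ within (affine_hull A) (nbhs x) A].

Definition polytope (R : realType) (n : nat) (P : set 'rV[R]_n) : Prop :=
  P !=set0 /\ exists s : seq 'rV[R]_n, P = convex_hull [set` s].

(* Taking u = 0 and c = 0 shows that P is a face of itself. *)
Definition face (R : realType) (n : nat) (P F : set 'rV[R]_n) : Prop :=
  F !=set0 /\
  exists (u : 'cV[R]_n) (c : R),
    (forall x, P x -> pairing u x <= c) /\
    F = [set x | P x /\ pairing u x = c].

Definition vertex (R : realType) (n : nat) (P : set 'rV[R]_n) (v : 'rV[R]_n) :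
    Prop := face P [set v].

Definition facet (R : realType) (n : nat) (P F : set 'rV[R]_n) : Prop :=
  face P F /\ aff_dim P = (aff_dim F).+1.

Definition lattice_polytope (R : realType) (n : nat) (P : set 'rV[R]_n) : Prop :=
  polytope P /\ forall v, vertex P v -> integral_points R n v.

Definition affine_lattice (R : realType) (n : nat) (A : set 'rV[R]_n) :
    set 'rV[R]_n := affine_hull A `&` integral_points R n.

(* u restricts to an element of the dual of the lattice of the affine hull of
   P: only its values on differences of lattice points of that affine hull are
   constrained, as only those matter when P is not full-dimensional. *)
Definition integral_functional (R : realType) (n : nat) (P : set 'rV[R]_n)
    (u : 'cV[R]_n) : Prop :=
  forall x y, affine_lattice P x -> affine_lattice P y ->
    pairing u x - pairing u y \is a Num.int.

Definition reflexive_polytope (R : realType) (n : nat) (P : set 'rV[R]_n) :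
    Prop :=
  lattice_polytope P /\
  exists m, [/\ relint P m, integral_points R n m &
    forall F, facet P F ->
      exists u, integral_functional P u /\
        forall f, F f -> pairing u f - pairing u m = 1].

Definition dilate (R : realType) (n : nat) (r : nat) (P : set 'rV[R]_n) :
    set 'rV[R]_n := [set r%:R *: x | x in P].

Definition gorenstein (R : realType) (n : nat) (P : set 'rV[R]_n) : Prop :=
  lattice_polytope P /\
  exists r : nat, (0 < r)%N /\ reflexive_polytope (dilate r P).

Definition interior_multiple (R : realType) (n : nat) (P : set 'rV[R]_n)
    (r : nat) : Prop :=
  (0 < r)%N /\ relint (dilate r P) `&` integral_points R n !=set0.

(* The minimum exists for every lattice polytope and is at most aff_dim P + 1, so
   neither the default value 0 nor the truncated subtraction in degree matters. *)
Definition codegree (R : realType) (n : nat) (P : set 'rV[R]_n) : nat :=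
  xget 0%N [set r | interior_multiple P r /\
                    forall q, interior_multiple P q -> (r <= q)%N].

Definition degree (R : realType) (n : nat) (P : set 'rV[R]_n) : nat :=
  (aff_dim P + 1 - codegree P)%N.

Definition affine_on (R : realType) (n m : nat) (A : set 'rV[R]_n)
    (f : 'rV[R]_n -> 'rV[R]_m) : Prop :=
  forall (x y : 'rV[R]_n) (t : R), A x -> A y ->
    f ((1 - t) *: x + t *: y) = (1 - t) *: f x + t *: f y.

Definition isomorphic (R : realType) (n m : nat) (P : set 'rV[R]_n)
    (Q : set 'rV[R]_m) : Prop :=
  exists f : 'rV[R]_n -> 'rV[R]_m,
    [/\ affine_on (affine_hull P) f,
        set_bij (affine_hull P) (affine_hull Q) f,
        f @` P = Q &
        f @` affine_lattice P = affine_lattice Q].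

Definition full_dimensional (R : realType) (n : nat) (P : set 'rV[R]_n) : Prop :=
  aff_dim P = n.

Definition free_join (R : realType) (n1 n2 : nat) (P1 : set 'rV[R]_n1)
    (P2 : set 'rV[R]_n2) : set 'rV[R]_(n1 + n2 + 1) :=
  convex_hull
    ([set row_mx (row_mx x (0 : 'rV[R]_n2)) (0 : 'rV[R]_1) | x in P1] `|`
     [set row_mx (row_mx (0 : 'rV[R]_n1) y) (const_mx 1 : 'rV[R]_1) | y in P2]).

(* Free join of k.+1 copies of a polytope in dimension n. *)
Fixpoint free_join_dim (n k : nat) : nat :=
  if k is k'.+1 then (free_join_dim n k' + n + 1)%N else n.

Fixpoint free_join_copiesS (R : realType) (n : nat) (P : set 'rV[R]_n) (k : nat) :
    set 'rV[R]_(free_join_dim n k) :=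
  match k return set 'rV[R]_(free_join_dim n k) with
  | 0 => P
  | k'.+1 => free_join (@free_join_copiesS R n P k') P
  end.
Arguments free_join_copiesS {R n} P k.

(* A lattice point that is full-dimensional with respect to its lattice is the
   origin of the lattice of rank 0. *)
Definition lattice_pyramid (R : realType) (n : nat) (P : set 'rV[R]_n) : Prop :=
  (exists p, integral_points R n p /\ P = [set p]) \/
  exists (m : nat) (Q : set 'rV[R]_m),
    [/\ lattice_polytope Q, full_dimensional Q &
        isomorphic P (free_join Q [set (0 : 'rV[R]_0)])].

Definition unit_square (R : realType) : set 'rV[R]_2 :=
  [set x | forall i, 0 <= x 0 i <= 1].
Arguments unit_square : clear implicits.

(* Main.v *)
Require Import Defs.
From mathcomp Require Import all_boot all_order all_algebra.
From mathcomp Require Import all_classical all_reals all_analysis.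
From mathcomp Require Import ring lra zify.
Import Order.TTheory GRing.Theory Num.Theory.
Import numFieldNormedType.Exports.

Set Implicit Arguments.
Unset Strict Implicit.
Unset Printing Implicit Defensive.

Local Open Scope ring_scope.

(* Homogenize: over P = conv(s) take the cone with generators v at height 1 and
   facet functionals u normalized by u(m) = 1 at the interior lattice point m of
   height r, the codegree. Let D = dim P + 1, so that 3 r = 2 D in the theorem.

   A vertex e is "good" if u(e) is 0 or 1 for all u; then the face with
   m - e in its relative interior is again such a cone, with point m - e ("peeling" e). Good vertices
   exist when 2 r > D. Let K_e be the space on which all u with u(e) = 1 agree;
   if K_e is everything, P is a lattice pyramid with apex e. Otherwise choose e
   good with K_e of maximal dimension D - k. By induction the peeled cone has at
   least 2 k - 1 + (3 r - 2 D) apexes, whose spaces K all coincide with K_e. So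
   we get at least 2 k classes of facets whose convex hulls are k-dimensional
   with parallel directions. Picking one facet from each of k + 1 of them
   suitably, their sum is positive on every vertex outside K_e, which forces the
   sum over all classes to be rigid; hence there are at most k + 1 classes. Thus
   k = 1 and 3 r = 2 D, and the two classes of facets, two values each, split off
   a unit square from P. *)

(** * Cones and Farkas' lemma *)

(** The apex count comes from the excess 3 r - 2 D. Peeling [e] lowers r by 1 and D by k + 1, so the
    peeled cone has excess 3 r - 2 D + 2 k - 1. The space K of an apex of the peeled cone contains
    K_e, because the functionals that are 1 at that apex vanish at [e]; the maximal choice of [e]
    turns inclusion into equality.

    Rigidity rests on writing the height as a positive combination of the functionals. Weighting
    each term by its value on the sum of the chosen vertices gives one functional, [center], that is
    at most 1 on all generators and agrees, on K and at m, with every sum of one functional per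
    class. A sum that is at least 1 at the generators off K dominates it there, and equality at the
    interior point m forces equality everywhere. A class outside the k + 1 selected ones can then be
    varied without changing the sum, so its functionals all coincide, against K being proper.

    The converse is separate: every vertex of a join of squares is a corner of a parallelogram of
    vertices, which the apex of a pyramid cannot be. *)

Section Pairing.
Variables (R : realType) (n : nat).
Implicit Types (u w : 'cV[R]_n) (x y : 'rV[R]_n).

Lemma pairingDr u x y : pairing u (x + y) = pairing u x + pairing u y.
Proof. by rewrite /pairing mulmxDl mxE. Qed.

Lemma pairingZr u a x : pairing u (a *: x) = a * pairing u x.
Proof. by rewrite /pairing -scalemxAl mxE. Qed.

Lemma pairingNr u x : pairing u (- x) = - pairing u x.
Proof. by rewrite /pairing mulNmx mxE. Qed.

Lemma pairingBr u x y : pairing u (x - y) = pairing u x - pairing u y.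
Proof. by rewrite pairingDr pairingNr. Qed.

Lemma pairing0r u : pairing u 0 = 0.
Proof. by rewrite /pairing mul0mx mxE. Qed.

Lemma pairing_sumr (I : Type) (r : seq I) (Q : pred I) (F : I -> 'rV[R]_n) u :
  pairing u (\sum_(i <- r | Q i) F i) = \sum_(i <- r | Q i) pairing u (F i).
Proof.
exact: (big_morph (pairing u) (pairingDr u) (pairing0r u)).
Qed.

Lemma pairingDl u w x : pairing (u + w) x = pairing u x + pairing w x.
Proof. by rewrite /pairing mulmxDr mxE. Qed.

Lemma pairingZl u a x : pairing (a *: u) x = a * pairing u x.
Proof. by rewrite /pairing -scalemxAr mxE. Qed.

Lemma pairingNl u x : pairing (- u) x = - pairing u x.
Proof. by rewrite /pairing mulmxN mxE. Qed.

Lemma pairingBl u w x : pairing (u - w) x = pairing u x - pairing w x.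
Proof. by rewrite pairingDl pairingNl. Qed.

Lemma pairing0l x : pairing 0 x = 0.
Proof. by rewrite /pairing mulmx0 mxE. Qed.

Lemma pairing_suml (I : Type) (r : seq I) (Q : pred I) (F : I -> 'cV[R]_n) x :
  pairing (\sum_(i <- r | Q i) F i) x = \sum_(i <- r | Q i) pairing (F i) x.
Proof.
exact: (big_morph (fun u => pairing u x) (fun u w => pairingDl u w x) (pairing0l x)).
Qed.

Definition annihilator (us : seq 'cV[R]_n) : {vspace 'rV[R]_n} :=
  foldr (fun u V => lker (linfun (mulmxr u : 'rV_n -> 'rV_1)) :&: V)%VS fullv us.

Lemma annihilatorP us x :
  reflect (forall u, u \in us -> pairing u x = 0) (x \in annihilator us).
Proof.
elim: us => [|u us IH] /=; first by rewrite memvf; apply: ReflectT.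
have E : (x *m u == 0) = (pairing u x == 0).
  apply/eqP/eqP => H; first by rewrite /pairing H mxE.
  by apply/matrixP => i j; rewrite !ord1 [RHS]mxE; exact: H.
rewrite memv_cap memv_ker lfunE /= E.
apply: (iffP andP) => [[/eqP u0 /IH Hus] w|H].
  by rewrite inE => /orP[/eqP -> //|]; apply: Hus.
split; first by rewrite H ?mem_head.
by apply/IH => w wus; apply: H; rewrite inE wus orbT.
Qed.

Lemma pairing_span (vs : seq 'rV[R]_n) u :
  (forall v, v \in vs -> pairing u v = 0) ->
  forall x, x \in <<vs>>%VS -> pairing u x = 0.
Proof.
move=> Hu x.
have /subvP sub : (<<vs>> <= annihilator [:: u])%VS.
  apply/span_subvP => v vin; apply/annihilatorP => w; rewrite inE => /eqP ->; exact: Hu.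
by move=> /sub/annihilatorP; apply; rewrite mem_head.
Qed.

Lemma pairing_eq_span (vs : seq 'rV[R]_n) u w :
  (forall v, v \in vs -> pairing u v = pairing w v) ->
  forall x, x \in <<vs>>%VS -> pairing u x = pairing w x.
Proof.
move=> H x /(@pairing_span vs (u - w)) E; apply/eqP; rewrite -subr_eq0 -pairingBl E //.
by move=> v vin; rewrite pairingBl H // subrr.
Qed.

End Pairing.

Section Cone.
Variables (R : realType) (n : nat).
Implicit Types (u w : 'cV[R]_n) (x y v : 'rV[R]_n) (vs : seq 'rV[R]_n).

(** A coefficient belongs to the vector and not to its position in the list, so repeated generators
    share it. This is why [cone_mem] divides by [count_mem]. *)
Definition cone vs : set 'rV[R]_n :=
  [set x | exists a : 'rV[R]_n -> R,
     (forall v, 0 <= a v) /\ x = \sum_(v <- vs) a v *: v].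

Lemma cone0 vs : cone vs 0.
Proof.
by exists (fun _ => 0); split=> //; rewrite big1 // => v _; rewrite scale0r.
Qed.

Lemma coneD vs x y : cone vs x -> cone vs y -> cone vs (x + y).
Proof.
move=> [a [a0 ->]] [b [b0 ->]]; exists (fun v => a v + b v); split.
  by move=> v; rewrite addr_ge0.
by rewrite -big_split; apply: eq_bigr => v _; rewrite scalerDl.
Qed.

Lemma coneZ vs c x : 0 <= c -> cone vs x -> cone vs (c *: x).
Proof.
move=> c0 [a [a0 ->]]; exists (fun v => c * a v); split.
  by move=> v; rewrite mulr_ge0.
by rewrite scaler_sumr; apply: eq_bigr => v _; rewrite scalerA.
Qed.

Lemma cone_mem vs v : v \in vs -> cone vs v.
Proof.
move=> vin; exists (fun y => (y == v)%:R / (count_mem v vs)%:R); split.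
  by move=> w; rewrite divr_ge0.
have c0 : (count_mem v vs)%:R != 0 :> R by rewrite pnatr_eq0 -lt0n -has_count has_pred1.
rewrite (bigID (pred1 v)) /= [X in _ + X]big1 ?addr0; last first.
  by move=> w /negbTE ->; rewrite mul0r scale0r.
rewrite (eq_bigr (fun=> (count_mem v vs)%:R^-1 *: v)); last first.
  by move=> w /eqP ->; rewrite eqxx mul1r.
by rewrite big_const_seq iter_addr_0 -scaler_nat scalerA divff // scale1r.
Qed.

Lemma cone_sum vs (I : eqType) (r : seq I) (a : I -> R) (F : I -> 'rV[R]_n) :
  (forall i, i \in r -> 0 <= a i) -> (forall i, i \in r -> cone vs (F i)) ->
  cone vs (\sum_(i <- r) a i *: F i).
Proof.
move=> a0 HF; rewrite big_seq; apply: (big_ind (cone vs)) => [||i ir].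
- exact: cone0.
- by move=> x y; apply: coneD.
- by apply: coneZ; [exact: a0 | exact: HF].
Qed.

Lemma cone_sub vs ws x : {subset vs <= ws} -> cone vs x -> cone ws x.
Proof.
by move=> sub [a [a0 ->]]; apply: cone_sum => [v _|v /sub /cone_mem].
Qed.

Lemma cone_span vs x : cone vs x -> x \in <<vs>>%VS.
Proof.
move=> [a [_ ->]]; rewrite big_seq; apply: memv_suml => v vin.
by rewrite memvZ // memv_span.
Qed.

Lemma cone_pairing_ge0 vs u x :
  (forall v, v \in vs -> 0 <= pairing u v) -> cone vs x -> 0 <= pairing u x.
Proof.
move=> H [a [a0 ->]]; rewrite pairing_sumr big_seq sumr_ge0 // => v /H vin.
by rewrite pairingZr mulr_ge0.
Qed.

(** Induction on the number of generators, without topology: a functional that separates [x] from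
    all generators but [v] either works already or is negative at [v], and then [v] can be projected
    away. *)
Lemma farkas vs x :
  cone vs x \/ exists u, (forall v, v \in vs -> 0 <= pairing u v) /\ pairing u x < 0.
Proof.
have [k] := ubnP (size vs); elim: k vs x => // k IH [|v vs] x /= szs.
  have [->|x0] := eqVneq x 0; first by left; apply: cone0.
  (* No generators: [- x^T] pairs with [x] to minus the sum of the squares of its entries. *)
  right; exists (- x^T); split=> //.
  rewrite pairingNl oppr_lt0 lt0r; apply/andP; split; last first.
    by rewrite /pairing mxE sumr_ge0 // => i _; rewrite mxE -expr2 sqr_ge0.
  apply: contra x0 => /eqP; rewrite /pairing mxE => H; apply/eqP/rowP => i.
  have := psumr_eq0P _ H; rewrite mxE => /(_ _ i isT).
  rewrite mxE => E; apply/eqP; rewrite -(@sqrf_eq0 R) expr2; apply/eqP; apply: E => j _.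
  by rewrite mxE -expr2 sqr_ge0.
have [Hc|[u [uvs ux]]] := IH vs x szs.
  by left; apply: cone_sub Hc => w win; rewrite inE win orbT.
have [uv|uv] := leP 0 (pairing u v).
  by right; exists u; split=> // w; rewrite inE => /orP[/eqP ->|/uvs].
(* projecting along v onto the kernel of u reduces to fewer generators *)
pose p y := y - (pairing u y / pairing u v) *: v.
have szp : (size (map p vs) < k)%N by rewrite size_map.
have [Hc|[w [wvs wx]]] := IH _ (p x) szp.
  left.
  (* [pairing u x] and [pairing u v] are both negative, so [v] enters with a coefficient >= 0;
     writing [p y] through the generators [y] and [v] also gives [v] a coefficient - u(y) / u(v) >=
     0. *)
  have -> : x = p x + (pairing u x / pairing u v) *: v by rewrite subrK.
  apply: coneD; last first.
    apply: coneZ; last by apply: cone_mem; rewrite mem_head.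
    by rewrite mulr_le0 // ?invr_le0 ltW.
  have [a [a0 ->]] := Hc; rewrite big_map; apply: cone_sum => // y yin.
  rewrite /p -scaleNr; apply: coneD; first by apply: cone_mem; rewrite inE yin orbT.
  apply: coneZ; last by apply: cone_mem; rewrite mem_head.
  by rewrite -mulrN mulr_ge0 ?uvs // oppr_ge0 invr_le0 ltW.
(* This is [w] composed with the projection [p], which sends [v] to 0. *)
right; exists (w - (pairing w v / pairing u v) *: u).
have E y : pairing (w - (pairing w v / pairing u v) *: u) y = pairing w (p y).
  by rewrite pairingBl pairingZl pairingBr pairingZr mulrAC [pairing w v * _]mulrC mulrAC.
split; last by rewrite E.
move=> y; rewrite inE => /orP[/eqP ->|yin]; last by rewrite E wvs ?map_f.
by rewrite E /p divff ?lt_eqF // scale1r subrr pairing0r.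
Qed.

(** A basis of [V] together with its negatives generates [V] as a cone, so [farkas] applies; being
    >= 0 on both signs means vanishing on [V]. *)
Lemma pairing_separates (V : {vspace 'rV[R]_n}) x :
  x \notin V -> exists u, (forall y, y \in V -> pairing u y = 0) /\ pairing u x != 0.
Proof.
move=> xV; have [/cone_span|[u [uV ux]]] := farkas (vbasis V ++ map -%R (vbasis V)) x.
  rewrite span_cat => /(subvP _) xin; case/negP: xV; apply: xin.
  rewrite subv_add; apply/andP; split; apply/span_subvP => y.
    exact: vbasis_mem.
  by case/mapP => z /vbasis_mem zV ->; rewrite memvN.
exists u; split; last by rewrite lt_eqF.
move=> y; rewrite -(span_basis (vbasisP V)); apply: pairing_span => z zin.
apply/eqP; rewrite eq_le uV ?mem_cat ?zin // andbT -oppr_ge0 -pairingNr.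
by apply: uV; rewrite mem_cat map_f ?orbT.
Qed.

Lemma span_coef vs x : uniq vs -> x \in <<vs>>%VS ->
  exists b : 'rV[R]_n -> R, x = \sum_(v <- vs) b v *: v.
Proof.
elim: vs x => [|v vs IH] x /=.
  by rewrite span_nil memv0 => _ /eqP ->; exists (fun=> 0); rewrite big_nil.
case/andP=> vvs uvs; rewrite span_cons => /memv_addP[_ /vlineP[k ->]] [y yin ->].
have [b ->] := IH _ uvs yin.
exists (fun z => if z == v then k else b z); rewrite big_cons eqxx; congr (_ + _).
apply: eq_big_seq => z zin; case: eqP => // zv; by rewrite -zv zin in vvs.
Qed.

Lemma not_free_relation vs : uniq vs -> ~~ free vs ->
  exists b : 'rV[R]_n -> R, \sum_(v <- vs) b v *: v = 0 /\
    exists2 v, v \in vs & 0 < b v.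
Proof.
move=> uvs nf.
suff [b [b0 [v vin bv]]] : exists b : 'rV[R]_n -> R, \sum_(v <- vs) b v *: v = 0 /\
    exists2 v, v \in vs & b v != 0.
  have [bp|bn] := ltP 0 (b v); first by exists b; split=> //; exists v.
  exists (fun z => - b z); split; last first.
    by exists v => //; rewrite oppr_gt0 lt_neqAle bv.
  by rewrite -[RHS]oppr0 -[in RHS]b0 -sumrN; apply: eq_bigr => z _; rewrite scaleNr.
elim: vs uvs nf => [|v vs IH] /=; first by rewrite nil_free.
case/andP=> vvs uvs; rewrite free_cons negb_and negbK => /orP[vin|nf]; last first.
  have [b [b0 [w win bw]]] := IH uvs nf.
  exists (fun z => if z == v then 0 else b z); split; last first.
    exists w; first by rewrite inE win orbT.
    by case: (w =P v) => // wv; rewrite -wv win in vvs.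
  rewrite big_cons eqxx scale0r add0r -[RHS]b0; apply: eq_big_seq => z zin.
  by case: eqP => // zv; rewrite -zv zin in vvs.
have [b vE] := span_coef uvs vin.
exists (fun z => if z == v then - 1 else b z); split; last first.
  by exists v; rewrite ?mem_head // eqxx oppr_eq0 oner_eq0.
rewrite big_cons eqxx scaleN1r; apply/eqP; rewrite addrC subr_eq0; apply/eqP.
rewrite [RHS]vE; apply: eq_big_seq => z zin.
by case: eqP => // zv; rewrite -zv zin in vvs.
Qed.

(** While the generators are dependent, a multiple of a linear relation is subtracted from the
    coefficients until the first one reaches 0; the generator with the smallest ratio [a w / b w] is
    the one removed. *)
Lemma caratheodory vs x : cone vs x ->
  exists ws, [/\ free ws, {subset ws <= vs} & cone ws x].
Proof.
move=> xc; have : cone (undup vs) x by apply: cone_sub xc => v; rewrite mem_undup.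
have sub : {subset undup vs <= vs} by move=> v; rewrite mem_undup.
move: (undup_uniq vs) sub; move: (undup vs) => ws.
have [k] := ubnP (size ws); elim: k ws => // k IH ws szw uws sub wx.
have [fw|nfw] := boolP (free ws); first by exists ws.
have [b [b0 [v vin bv]]] := not_free_relation uws nfw.
have [a [a0 xE]] := wx.
pose pos := [seq z <- ws | 0 < b z].
have vpos : v \in pos by rewrite mem_filter bv.
have [w wpos wmin] : exists2 w, w \in pos &
    forall z, z \in pos -> a w / b w <= a z / b z.
  have Hv : [pred i : seq_sub pos | true] (SeqSub vpos) by [].
  case: (arg_minP (fun i : seq_sub pos => a (val i) / b (val i)) Hv) => i _ Hi.
  exists (val i); first exact: valP.
  by move=> z zpos; apply: (Hi (SeqSub zpos)).
move: (wpos); rewrite mem_filter => /andP[bw win].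
have [||||zs [fz szs xz]] := IH (rem w ws).
- by rewrite size_rem // prednK //; case: (ws) win.
- exact: rem_uniq.
- by move=> z /mem_rem /sub.
(* [cone] asks for coefficients >= 0 on all vectors, also outside the list; the [max] enforces this
   and changes nothing on [ws]. *)
- exists (fun z => Num.max 0 (a z - a w / b w * b z)); split.
    by move=> z; rewrite le_max lexx.
  have -> : x = \sum_(z <- ws) (a z - a w / b w * b z) *: z.
    under eq_bigr do rewrite scalerBl -scalerA.
    by rewrite sumrB -scaler_sumr b0 scaler0 subr0.
  rewrite (perm_big _ (perm_to_rem win)) big_cons /= divfK ?gt_eqF // subrr scale0r add0r.
  apply: eq_big_seq => z /mem_rem zin; congr (_ *: _); apply/esym/max_idPr.
  have [bz|bz] := ltP 0 (b z).
    by rewrite subr_ge0 -ler_pdivlMr // wmin // mem_filter bz.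
  by rewrite subr_ge0 (le_trans _ (a0 z)) // mulr_ge0_le0 // divr_ge0 // ltW.
by exists zs; split=> // z /szs.
Qed.

End Cone.

(** The dual of [farkas] relative to a subspace: in coordinates of a basis of [U] functionals become
    vectors, and [u] is tested for membership in the cone of [us], up to functionals that vanish on
    [U]. *)
Lemma farkas_functional (R : realType) (n : nat) (U : {vspace 'rV[R]_n}) (us : seq 'cV[R]_n) (u : 'cV[R]_n) :
  (forall x, x \in U -> (forall w, w \in us -> 0 <= pairing w x) -> 0 <= pairing u x) ->
  exists c : 'cV[R]_n -> R, (forall w, 0 <= c w) /\
    (forall x, x \in U -> pairing u x = \sum_(w <- us) c w * pairing w x).
Proof.
move=> H; pose B : 'M[R]_(\dim U, n) := \matrix_i (vbasis U)`_i.
have BP (y : 'rV_(\dim U)) : y *m B \in U.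
  rewrite mulmx_sum_row memv_suml // => i _.
  by rewrite memvZ // rowK vbasis_mem // mem_nth // size_tuple.
have BE (x : 'rV[R]_n) : x \in U -> exists y : 'rV_(\dim U), x = y *m B.
  move=> /coord_vbasis xE; exists (\row_i coord (vbasis U) i x).
  rewrite {1}xE mulmx_sum_row; apply: eq_bigr => i _.
  by rewrite rowK mxE.
have tr (z : 'cV[R]_(\dim U)) (w : 'cV[R]_n) : pairing z (B *m w)^T = pairing w (z^T *m B).
  by rewrite /pairing -mulmxA -[in RHS](trmxK (B *m w)) -trmx_mul [RHS]mxE.
have [[a [a0 xE]]|[z [zus zu]]] := farkas [seq (B *m w)^T | w <- us] (B *m u)^T.
  exists (fun w => a (B *m w)^T); split=> // x /BE[y ->].
  rewrite -[y]trmxK -tr xE big_map pairing_sumr; apply: eq_bigr => w _.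
  by rewrite pairingZr tr.
have := H _ (BP z^T); rewrite -tr leNgt zu => /(_ _)/negP; case=> //.
by move=> w win; rewrite -tr; apply: zus; apply/mapP; exists w.
Qed.

(** * Gorenstein cones *)

Lemma int_ge1 (R : realType) (x : R) : x \is a Num.int -> 0 < x -> 1 <= x.
Proof. by case/intrP => k ->; rewrite ltr0z ler1z. Qed.

Lemma int_01 (R : realType) (x : R) :
  x \is a Num.int -> 0 <= x -> x <= 1 -> x = 0 \/ x = 1.
Proof.
move=> xi; rewrite le_eqVlt => /orP[/eqP <-|/(int_ge1 xi) x1 x1']; first by left.
by right; apply/le_anti; rewrite x1 x1'.
Qed.

Lemma small_eps (R : realType) (I : eqType) (r : seq I) (f : I -> R) :
  exists2 e : R, 0 < e & forall i, i \in r -> e * `|f i| <= 1.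
Proof.
have S0 : 0 <= \sum_(i <- r) `|f i| by apply: sumr_ge0.
exists (1 + \sum_(i <- r) `|f i|)^-1; first by rewrite invr_gt0; lra.
move=> i ir; rewrite mulrC ler_pdivrMr ?mul1r; last by lra.
rewrite (perm_big _ (perm_to_rem ir)) big_cons /=.
have : 0 <= \sum_(i <- rem i r) `|f i| by apply: sumr_ge0.
lra.
Qed.

Section Integral.
Variables (R : realType) (n : nat).
Local Notation integral := (integral_points R n).

Lemma integralD x y : integral x -> integral y -> integral (x + y).
Proof. by move=> Hx Hy i; rewrite mxE rpredD. Qed.

Lemma integralN x : integral x -> integral (- x).
Proof. by move=> Hx i; rewrite mxE rpredN. Qed.

Lemma integralB x y : integral x -> integral y -> integral (x - y).
Proof. by move=> Hx Hy; apply: integralD => //; apply: integralN. Qed.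

Lemma integralZ (a : R) x : a \is a Num.int -> integral x -> integral (a *: x).
Proof. by move=> Ha Hx i; rewrite mxE rpredM. Qed.

Lemma integral0 : integral 0.
Proof. by move=> i; rewrite mxE. Qed.

Lemma integral_sum (I : eqType) (r : seq I) (F : I -> 'rV[R]_n) :
  (forall i, i \in r -> integral (F i)) -> integral (\sum_(i <- r) F i).
Proof.
move=> H; rewrite big_seq; apply: (big_ind integral) => //.
- exact: integral0.
- exact: integralD.
Qed.
End Integral.

Section Gorenstein.
Variables (R : realType) (n : nat).
Implicit Types (u w h : 'cV[R]_n) (x y v e m : 'rV[R]_n).
Implicit Types (vs : seq 'rV[R]_n) (us : seq 'cV[R]_n).
Local Notation integral := (integral_points R n).

(** A sum of terms >= 0 vanishes only termwise, so generators off the face carry coefficient 0. *)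
Lemma cone_face vs us x :
  (forall u v, u \in us -> v \in vs -> 0 <= pairing u v) ->
  cone vs x -> (forall u, u \in us -> pairing u x = 0) ->
  cone [seq v <- vs | all (fun u => pairing u v == 0) us] x.
Proof.
move=> H [a [a0 xE]] ux0.
have az v u : v \in vs -> u \in us -> a v * pairing u v = 0.
  move=> vin uin; move: (ux0 u uin); rewrite xE pairing_sumr.
  rewrite (perm_big _ (perm_to_rem vin)) big_cons /= pairingZr => /eqP.
  rewrite paddr_eq0 ?mulr_ge0 ?H // => [/andP[/eqP]//|].
  rewrite big_seq sumr_ge0 // => w /mem_rem win.
  by rewrite pairingZr mulr_ge0 ?H.
exists a; split=> //; rewrite xE big_filter [in RHS]big_mkcond /=.
apply: eq_big_seq => v vin; case: ifPn => // /allPn[u uin uv].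
by have /eqP := az v u vin uin; rewrite mulf_eq0 (negbTE uv) orbF => /eqP ->; rewrite scale0r.
Qed.

(* The cone over a Gorenstein polytope: generators vs at height 1, inequalities
   us (possibly redundant), and the lattice point m on which every u in us is 1.
   The lattice is the set of integral points of the span of vs. *)
Record gor_cone vs us h m : Prop := GorCone {
  gor_vs_int : forall v, v \in vs -> integral v;
  gor_height : forall v, v \in vs -> pairing h v = 1;
  gor_us_int : forall u x, u \in us -> x \in <<vs>>%VS -> integral x ->
    pairing u x \is a Num.int;
  gor_ge0 : forall u v, u \in us -> v \in vs -> 0 <= pairing u v;
  gor_mem : forall x, x \in <<vs>>%VS ->
    (forall u, u \in us -> 0 <= pairing u x) -> cone vs x;
  gor_m_span : m \in <<vs>>%VS;
  gor_m_int : integral m;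
  gor_m1 : forall u, u \in us -> pairing u m = 1 }.

(** For good [e] the functionals that are 1 at [e] vanish at [m - e] and the others are 1 there, so
    the kept generators are those of the face with [m - e] in its relative interior. *)
Definition peel_vs vs us e :=
  [seq v <- vs | all (fun u => pairing u v == 0) [seq u <- us | pairing u e == 1]].

Definition peel_us us e := [seq u <- us | pairing u e != 1].

Definition good vs us e := (e \in vs) && all (fun u => pairing u e <= 1) us.

(* The space K_e. *)
Definition level vs us e : {vspace 'rV[R]_n} :=
  (<<vs>> :&: annihilator [seq u - w | u <- [seq u <- us | pairing u e == 1],
                                      w <- [seq u <- us | pairing u e == 1]])%VS.

Definition apex vs us e := good vs us e && (<<vs>> <= level vs us e)%VS.

Lemma levelP vs us e x :
  x \in level vs us e <-> x \in <<vs>>%VS /\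
    forall u w, u \in us -> w \in us -> pairing u e = 1 -> pairing w e = 1 ->
      pairing u x = pairing w x.
Proof.
rewrite memv_cap; split=> [/andP[xU /annihilatorP H]|[xU H]].
  split=> // u w uin win ue we; apply/eqP; rewrite -subr_eq0 -pairingBl H //.
  by apply/allpairsP; exists (u, w); rewrite !mem_filter ue we eqxx uin win.
rewrite xU; apply/annihilatorP => z /allpairsP[[u w] /= [+ + ->]].
rewrite !mem_filter => /andP[/eqP ue uin] /andP[/eqP we win].
by rewrite pairingBl (H u w) ?subrr.
Qed.

Variables (vs : seq 'rV[R]_n) (us : seq 'cV[R]_n) (h : 'cV[R]_n) (m : 'rV[R]_n).
Hypothesis G : gor_cone vs us h m.

Lemma gor_cone_ge0 u x : u \in us -> cone vs x -> 0 <= pairing u x.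
Proof. by move=> uin; apply: cone_pairing_ge0 => v; apply: (gor_ge0 G). Qed.

Lemma gor_height_ge0 x : cone vs x -> 0 <= pairing h x.
Proof. by apply: cone_pairing_ge0 => v vin; rewrite (gor_height G). Qed.

Lemma gor_height_eq0 x : cone vs x -> pairing h x = 0 -> x = 0.
Proof.
move=> [a [a0 ->]]; rewrite pairing_sumr (eq_big_seq a) => [/eqP|v vin]; last first.
  by rewrite pairingZr (gor_height G) // mulr1.
rewrite psumr_eq0 // => /allP H; apply: big1_seq => v /= vin.
by rewrite (eqP (H v vin)) scale0r.
Qed.

Lemma gor_m_cone : cone vs m.
Proof.
by apply: (gor_mem G (gor_m_span G)) => u uin; rewrite (gor_m1 G).
Qed.

Lemma good_01 e u : good vs us e -> u \in us -> pairing u e = 0 \/ pairing u e = 1.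
Proof.
case/andP=> ein /allP H uin; apply: int_01; last exact: H.
- by apply: (gor_us_int G) => //; [exact: memv_span | exact: (gor_vs_int G)].
- exact: (gor_ge0 G).
Qed.

Lemma good_cone e : e \in vs -> good vs us e <-> cone vs (m - e).
Proof.
move=> ein; rewrite /good ein /=; split=> [/allP H|H].
  apply: (gor_mem G) => [|u uin]; first by rewrite memvB ?(gor_m_span G) ?memv_span.
  by rewrite pairingBr (gor_m1 G) // subr_ge0 H.
by apply/allP => u uin; rewrite -(gor_m1 G uin) -subr_ge0 -pairingBr gor_cone_ge0.
Qed.

(** If all functionals vanished at [e], then [- e] would lie in the cone, at height -1. *)
Lemma good_ex1 e : good vs us e -> exists2 u, u \in us & pairing u e = 1.
Proof.
move=> ge; have /andP[ein _] := ge.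
have [/hasP[u uin /eqP ue]|/hasPn H] := boolP (has (fun u => pairing u e == 1) us).
  by exists u.
have : cone vs (- e).
  apply: (gor_mem G) => [|u uin]; first by rewrite memvN memv_span.
  have [E|/eqP E] := good_01 ge uin; first by rewrite pairingNr E oppr0.
  by have := H u uin; rewrite E.
move=> /gor_height_ge0; rewrite pairingNr (gor_height G) //; lra.
Qed.

(** The equations cut out no more than the span of the face: [m - e] can be moved by a small
    multiple of [x] without leaving the face, and [x] is a multiple of the difference of two such
    points. *)
Lemma peel_span e x : good vs us e ->
  (x \in <<peel_vs vs us e>>%VS) <-> (x \in <<vs>>%VS /\
     forall u, u \in us -> pairing u e = 1 -> pairing u x = 0).
Proof.
move=> ge; have /andP[ein _] := ge; split=> [xin|[xU Hx]].
  split.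
    by move: xin; apply: subvP; apply: sub_span => v; rewrite mem_filter => /andP[].
  move=> u uin ue; apply: pairing_span xin => v; rewrite mem_filter => /andP[/allP H vin].
  by apply/eqP; apply: H; rewrite mem_filter ue eqxx.
have [eps e0 He] := small_eps us (fun u => pairing u x).
have inpeel t : `|t| <= eps -> m - e + t *: x \in <<peel_vs vs us e>>%VS.
  move=> te; apply: cone_span; apply: cone_face.
  - by move=> u v; rewrite mem_filter => /andP[_ uin] vin; apply: (gor_ge0 G).
  - apply: (gor_mem G) => [|u uin].
      by rewrite memvD ?memvB ?memvZ ?(gor_m_span G) // memv_span.
    rewrite pairingDr pairingBr pairingZr (gor_m1 G) //.
    have [E|E] := good_01 ge uin; rewrite E; last by rewrite Hx //; lra.
    have := He u uin.
    have : `|t * pairing u x| <= eps * `|pairing u x| by rewrite normrM ler_wpM2r.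
    have := ler_norm (- (t * pairing u x)); rewrite normrN; lra.
  - move=> u; rewrite mem_filter => /andP[/eqP ue uin].
    by rewrite pairingDr pairingBr pairingZr (gor_m1 G) // ue Hx // subrr mulr0 addr0.
have H0 := inpeel 0; rewrite scale0r addr0 normr0 (ltW e0) in H0.
have H1 := inpeel eps; rewrite ger0_norm ?(ltW e0) // in H1.
have := memvB (H1 (lexx _)) (H0 isT); rewrite addrAC subrr add0r.
by move=> /(memvZ eps^-1); rewrite scalerA mulVf ?scale1r ?gt_eqF.
Qed.

(** A functional that is not 1 at [e] is 0 there, so it is still 1 at [m - e]; the dropped ones
    vanish on the face. *)
Lemma peel_gor e : good vs us e ->
  gor_cone (peel_vs vs us e) (peel_us us e) h (m - e).
Proof.
move=> ge; have /andP[ein _] := ge.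
have sub : {subset peel_vs vs us e <= vs} by move=> v; rewrite mem_filter => /andP[].
split.
- by move=> v /sub; apply: (gor_vs_int G).
- by move=> v /sub; apply: (gor_height G).
- by move=> u x; rewrite mem_filter => /andP[_ uin] /(peel_span _ ge)[xU _]; apply: (gor_us_int G).
- by move=> u v; rewrite mem_filter => /andP[_ uin] /sub; apply: (gor_ge0 G).
- move=> x /(peel_span _ ge)[xU Hx] Hu; apply: cone_face.
  + by move=> u v; rewrite mem_filter => /andP[_ uin] vin; apply: (gor_ge0 G).
  + apply: (gor_mem G) => // u uin; have [E|E] := good_01 ge uin; last by rewrite Hx.
    by apply: Hu; rewrite mem_filter E eq_sym oner_eq0.
  + by move=> u; rewrite mem_filter => /andP[/eqP ue uin]; rewrite Hx.
- apply/(peel_span _ ge); split; first by rewrite memvB ?(gor_m_span G) ?memv_span.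
  by move=> u uin ue; rewrite pairingBr (gor_m1 G) // ue subrr.
- by apply: integralB; [exact: (gor_m_int G) | exact: (gor_vs_int G)].
- move=> u; rewrite mem_filter => /andP[ue uin].
  rewrite pairingBr (gor_m1 G) //; have [->|E] := good_01 ge uin; first by rewrite subr0.
  by rewrite E eqxx in ue.
Qed.

(** The functionals that are 1 at [e] have one common value on a vector of the level space;
    subtracting that multiple of [e] lands in the span of the face. So the level space is this span
    plus the line of [e]. *)
Lemma peel_dim e : good vs us e ->
  \dim (level vs us e) = (\dim <<peel_vs vs us e>>).+1.
Proof.
move=> ge; have /andP[ein _] := ge.
have [u0 u0in u0e] := good_ex1 ge.
have -> : level vs us e = (<<peel_vs vs us e>> + <[e]>)%VS.
  apply/eqP; rewrite eqEsubv; apply/andP; split; apply/subvP => x.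
    move=> /levelP[xU Hx]; rewrite -[x](subrK (pairing u0 x *: e)).
    rewrite memv_add ?memvZ ?memv_line //; apply/(peel_span _ ge); split.
      by rewrite memvB ?memvZ ?(memv_span ein).
    by move=> u uin ue; rewrite pairingBr pairingZr ue mulr1 (Hx u u0) ?subrr.
  case/memv_addP => y /(peel_span _ ge)[yU Hy] [z /vlineP[k ->] ->].
  apply/levelP; split; first by rewrite memvD ?memvZ ?(memv_span ein).
  by move=> u w uin win ue we; rewrite !pairingDr !pairingZr ue we !Hy.
rewrite dimv_disjoint_sum; last first.
  apply/eqP; rewrite -subv0; apply/subvP => x; rewrite memv_cap => /andP[].
  move=> /(peel_span _ ge)[_ H] /vlineP[k xE]; have := H u0 u0in u0e.
  by rewrite xE pairingZr u0e mulr1 => ->; rewrite scale0r mem0v.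
rewrite dim_vline addnC; case: eqP => // e0.
by move: u0e; rewrite e0 pairing0r => /esym/eqP; rewrite oner_eq0.
Qed.

Lemma free_extend (ws : seq 'rV[R]_n) : free ws -> {subset ws <= vs} ->
  exists bs, [/\ free bs, {subset ws <= bs}, {subset bs <= vs} & <<bs>>%VS = <<vs>>%VS].
Proof.
have [k] := ubnP (\dim <<vs>> - size ws); elim: k ws => // k IH ws szk fw sub.
have [spw|/subvP nsp] := boolP (<<vs>> <= <<ws>>)%VS.
  exists ws; split=> //; apply/eqP; rewrite eqEsubv spw andbT.
  exact: sub_span.
have [/allP H|/allPn[v vin vw]] := boolP (all (fun v => v \in <<ws>>%VS) vs).
  by case: nsp; apply/subvP/span_subvP => v /H.
have fvw : free (v :: ws) by rewrite free_cons vw.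
have subv : {subset v :: ws <= vs} by move=> z; rewrite inE => /orP[/eqP ->|/sub].
have szv : (size (v :: ws) <= \dim <<vs>>)%N.
  by rewrite -(eqP fvw); apply/dimvS/sub_span.
have szk' : (\dim <<vs>> - size (v :: ws) < k)%N by move: szk szv => /=; lia.
have [bs [fb sb b1 b2]] := IH (v :: ws) szk' fvw subv.
by exists bs; split=> // z zw; apply: sb; rewrite inE zw orbT.
Qed.

(* If no coefficient of m in a basis of generators reached 1, the sum of the
   basis minus m would be an interior lattice point lower than m. *)
Lemma exists_good : (\dim <<vs>>)%:R < 2 * pairing h m -> exists e, good vs us e.
Proof.
move=> dlt; have [ws [fw sub [a [a0 mE]]]] := caratheodory gor_m_cone.
have uw := free_uniq fw.
have [/hasP[v vin av]|/hasPn alt] := boolP (has (fun v => 1 <= a v) ws).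
  exists v; apply/good_cone; first exact: sub.
  apply: (cone_sub sub).
  have -> : m - v = \sum_(z <- ws) (a z - (z == v)%:R) *: z.
    under [RHS]eq_bigr do rewrite scalerBl.
    rewrite sumrB -mE; congr (_ - _).
    rewrite (perm_big _ (perm_to_rem vin)) big_cons /= eqxx scale1r.
    rewrite big1_seq ?addr0 // => z /=; rewrite mem_rem_uniq // inE => /andP[/negbTE -> _].
    by rewrite scale0r.
  apply: cone_sum => z zin; last exact: cone_mem.
  by case: eqP => [->|_]; rewrite ?subr_ge0 // subr0.
have [bs [fb wb bv spb]] := free_extend fw sub.
(* The vectors that complete the basis get coefficient 0, so all coefficients of [m] stay below
   1. *)
pose a' v := if v \in ws then a v else 0.
have a'0 v : 0 <= a' v by rewrite /a'; case: ifP.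
have a'1 v : a' v < 1.
  by rewrite /a'; case: ifP => // vin; rewrite ltNge alt.
have mE' : m = \sum_(v <- bs) a' v *: v.
  rewrite mE (eq_big_seq (fun v => a' v *: v)) => [|v vin]; last by rewrite /a' vin.
  rewrite [RHS](bigID (mem ws)) /= [X in _ + X]big1 ?addr0; last first.
    by move=> v /negbTE vn; rewrite /a' vn scale0r.
  rewrite -[RHS]big_filter; apply: perm_big; apply: uniq_perm => //.
    by rewrite filter_uniq // free_uniq.
  by move=> v; rewrite mem_filter /=; case: (boolP (v \in ws)) => // /wb ->.
pose y := \sum_(v <- bs) v - m.
have yE : y = \sum_(v <- bs) (1 - a' v) *: v.
  rewrite /y mE' -sumrB; apply: eq_bigr => v _; by rewrite scalerBl scale1r.
have yU : y \in <<vs>>%VS.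
  rewrite memvB ?(gor_m_span G) // big_seq memv_suml // => v /bv vin.
  exact: memv_span.
have yint : integral y.
  apply: integralB; last exact: (gor_m_int G).
  by apply: integral_sum => v /bv; apply: (gor_vs_int G).
have y1 u : u \in us -> 1 <= pairing u y.
  move=> uin; apply: int_ge1; first exact: (gor_us_int G).
  have E : pairing u y = \sum_(v <- bs) (1 - a' v) * pairing u v.
    by rewrite yE pairing_sumr; apply: eq_bigr => v _; rewrite pairingZr.
  rewrite lt_neqAle eq_sym; apply/andP; split; last first.
    rewrite E big_seq sumr_ge0 // => v /bv vin.
    by rewrite mulr_ge0 ?(gor_ge0 G) // subr_ge0 ltW.
  apply/eqP; rewrite E big_seq => /eqP; rewrite psumr_eq0; last first.
    by move=> v /bv vin; rewrite mulr_ge0 ?(gor_ge0 G) // subr_ge0 ltW.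
  move=> /allP H; have := gor_m1 G uin; rewrite mE' pairing_sumr big1_seq.
    by move=> /eqP; rewrite eq_sym oner_eq0.
  move=> v /= vin; have /implyP/(_ vin) := H v vin.
  rewrite mulf_eq0 pairingZr subr_eq0 eq_sym (lt_eqF (a'1 v)) => /eqP ->.
  by rewrite mulr0.
(* The contradiction: the height of [y - m] is D - 2 h(m) < 0, where D is the size of the basis
   [bs]. *)
have : cone vs (y - m).
  apply: (gor_mem G) => [|u uin]; first by rewrite memvB ?(gor_m_span G).
  by rewrite pairingBr (gor_m1 G) // subr_ge0 y1.
move=> /gor_height_ge0; rewrite pairingBr /y pairingBr pairing_sumr.
rewrite (eq_big_seq (fun=> 1)) => [|v /bv]; last exact: (gor_height G).
rewrite big_const_seq iter_addr_0 count_predT -(eqP fb) spb; lra.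
Qed.
End Gorenstein.

Lemma seq_max (T : eqType) (s : seq T) (f : T -> nat) x0 : x0 \in s ->
  exists2 x, x \in s & forall y, y \in s -> (f y <= f x)%N.
Proof.
elim: s x0 => // a s IH x0 _; case: s IH => [|b s] IH.
  by exists a; rewrite ?mem_head // => y; rewrite inE => /eqP ->.
have [x xs Hx] := IH b (mem_head _ _).
have [le|lt] := leqP (f a) (f x).
  exists x; first by rewrite inE xs orbT.
  by move=> y; rewrite inE => /orP[/eqP -> //|/Hx].
exists a; rewrite ?mem_head // => y; rewrite inE => /orP[/eqP -> //|/Hx le].
exact: leq_trans le (ltnW lt).
Qed.

(* Induction by restricting to the hyperplane u = w of W, for two functionals
   u, w in the set of e1. The vectors minimised by all the other picks lie on one
   side of it: combining two on opposite sides gives a vector on it, hence in K. *)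
Lemma selection (R : realType) (n : nat) (T : eqType) (Gf : T -> seq 'cV[R]_n)
    (K : {vspace 'rV[R]_n}) (e0 : T) (es : seq T) (W : {vspace 'rV[R]_n}) :
  uniq (e0 :: es) ->
  (forall e, e \in e0 :: es -> exists u, u \in Gf e) ->
  (forall e x, e \in e0 :: es -> x \in W ->
     (forall u w, u \in Gf e -> w \in Gf e -> pairing u x = pairing w x) -> x \in K) ->
  (forall e x u w, e \in e0 :: es -> x \in K -> u \in Gf e -> w \in Gf e ->
     pairing u x = pairing w x) ->
  (\dim W <= \dim K + size es)%N -> (K <= W)%VS ->
  exists g : T -> 'cV[R]_n, (forall e, e \in e0 :: es -> g e \in Gf e) /\
    forall x, x \in W ->
      (forall e u, e \in e0 :: es -> u \in Gf e -> pairing (g e) x <= pairing u x) ->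
      x \in K.
Proof.
elim: es W => [|e1 es IH] W ues ne WK Kc dimW KW.
  have [u ue] := ne e0 (mem_head _ _); exists (fun=> u); split.
    by move=> e; rewrite inE => /eqP ->.
  move=> x xW _; have -> // : K = W.
  by apply/eqP; rewrite eqEdim KW; move: dimW; rewrite addn0.
have [allW|] := pselect (forall u w x, u \in Gf e1 -> w \in Gf e1 -> x \in W ->
    pairing u x = pairing w x).
  have /choice[g Hg] : forall e, exists u, e \in [:: e0, e1 & es] -> u \in Gf e.
    move=> e; have [/ne[u ue]|//] := boolP (e \in [:: e0, e1 & es]); first by exists u.
    by exists 0.
  exists g; split=> // x xW _; apply: (WK e1) => // [|u w ue we].
    by rewrite !inE eqxx orbT.
  exact: allW.
move=> /existsNP[u /existsNP[w /existsNP[x0 /not_implyP[ue /not_implyP[we]]]]].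
move=> /not_implyP[x0W /eqP uwx].
pose W' := (W :&: annihilator [:: u - w])%VS.
have W'P x : x \in W' <-> x \in W /\ pairing u x = pairing w x.
  rewrite memv_cap; split=> [/andP[-> /annihilatorP/(_ _ (mem_head _ _))/eqP]|[-> E]].
    by rewrite pairingBl subr_eq0 => /eqP.
  by apply/annihilatorP => z; rewrite inE => /eqP ->; rewrite pairingBl E subrr.
have sub e : e \in e0 :: es -> e \in [:: e0, e1 & es].
  by rewrite !inE => /orP[->|->]; rewrite ?orbT.
have e1in : e1 \in [:: e0, e1 & es] by rewrite !inE eqxx orbT.
have [||||||g [gG gK]] := IH W'.
- by move: ues => /=; rewrite inE negb_or => /andP[/andP[_ ->] /andP[_ ->]].
- by move=> e /sub; apply: ne.
- by move=> e x /sub ein /W'P[xW _]; apply: WK.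
- by move=> e x v v' /sub ein; apply: Kc.
- have : (\dim W' < \dim W)%N.
    rewrite ltn_neqAle dimvS ?capvSl // andbT; apply/negP => /eqP E.
    have /eqP W'E : W' == W by rewrite eqEdim capvSl E /=.
    by move: x0W; rewrite -W'E => /W'P[_ E']; rewrite E' eqxx in uwx.
  by move: dimW => /=; lia.
- apply/subvP => x xK; apply/W'P; split; first by apply: (subvP KW).
  exact: (Kc e1).
pose minimised x := x \in W /\ forall e v, e \in e0 :: es -> v \in Gf e ->
  pairing (g e) x <= pairing v x.
have key x1 x2 : minimised x1 -> minimised x2 ->
    pairing w x1 < pairing u x1 -> pairing u x2 < pairing w x2 -> False.
  move=> [x1W H1] [x2W H2] d1 d2.
  pose y := (pairing w x2 - pairing u x2) *: x1 + (pairing u x1 - pairing w x1) *: x2.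
  have p1 : 0 < pairing w x2 - pairing u x2 by lra.
  have p2 : 0 < pairing u x1 - pairing w x1 by lra.
  have yK : y \in K.
    apply: gK; first by apply/W'P; rewrite /y memvD ?memvZ // !pairingDr !pairingZr; split=> //; ring.
    move=> e v ein vin; rewrite /y !pairingDr !pairingZr.
    by rewrite lerD // ler_pM2l // ?H1 ?H2.
  suff x1K : x1 \in K by have := Kc e1 x1 u w e1in x1K ue we; lra.
  (* The class of [e0] agrees at [y], which lies in [K], so the two minimality inequalities adding
     up to it are equalities. This is where the extra class [e0], beyond one per dimension of
     codimension, enters. *)
  have E v : v \in Gf e0 -> pairing (g e0) x1 = pairing v x1.
    move=> vin; have := Kc e0 y (g e0) v (mem_head _ _) yK (gG _ (mem_head _ _)) vin.
    rewrite /y !pairingDr !pairingZr => E.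
    have := H1 e0 v (mem_head _ _) vin; have := H2 e0 v (mem_head _ _) vin.
    rewrite -(ler_pM2l p2) le_eqVlt => L2 L1; apply: le_anti; rewrite L1 /=.
    rewrite -(ler_pM2l p1); case/orP: L2 => [/eqP|] L2; lra.
  apply: (WK e0) => //; first exact: mem_head.
  by move=> v v' vin v'in; rewrite -!E.
have upd z : z \in Gf e1 ->
    (forall x, minimised x -> (forall v, v \in Gf e1 -> pairing z x <= pairing v x) ->
       pairing u x = pairing w x) ->
    exists g : T -> 'cV[R]_n, (forall e, e \in [:: e0, e1 & es] -> g e \in Gf e) /\
    forall x, x \in W ->
      (forall e u, e \in [:: e0, e1 & es] -> u \in Gf e -> pairing (g e) x <= pairing u x) ->
      x \in K.
  move=> zin Hz; exists (fun e => if e == e1 then z else g e); split=> [e|x xW Hx].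
    case: eqP => [-> //|ne1]; rewrite !inE => /or3P[/eqP ->|/eqP //|ein].
      by apply: gG; rewrite mem_head.
    by apply: gG; rewrite inE ein orbT.
  have xmin : minimised x.
    split=> // e v ein vin; have := Hx e v (sub e ein) vin; case: eqP => // ee1.
    move: ues; rewrite -ee1 /= inE negb_or; move: ein; rewrite inE => /orP[/eqP ->|->].
      by rewrite eqxx.
    by rewrite andbF.
  apply: gK; last by case: xmin.
  apply/W'P; split=> //; apply: Hz => // v vin.
  by have := Hx e1 v e1in vin; rewrite eqxx.
(* By [key], minimised vectors do not occur on both sides of the hyperplane. Picking for [e1]
   whichever of [u], [w] is the larger on the occupied side leaves only those on the hyperplane. *)
have [H|] := pselect (exists2 x, minimised x & pairing w x < pairing u x).
  case: H => x1 m1 d1; apply: (upd u) => // x mx Hx.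
  apply: le_anti; rewrite Hx //= leNgt; apply/negP => lt.
  exact: key m1 mx d1 lt.
move=> /forall2NP H; apply: (upd w) => // x mx Hx.
apply: le_anti; rewrite (Hx u ue) andbT leNgt; apply/negP => lt.
by case: (H x).
Qed.

(** * Counting apexes *)

Section Core.
Variables (R : realType) (n : nat).
Implicit Types (u w h : 'cV[R]_n) (x y v e m : 'rV[R]_n).
Implicit Types (vs : seq 'rV[R]_n) (us : seq 'cV[R]_n).
Local Notation integral := (integral_points R n).

Section Fixed.
Variables (vs : seq 'rV[R]_n) (us : seq 'cV[R]_n) (h : 'cV[R]_n) (m : 'rV[R]_n).
Hypothesis G : gor_cone vs us h m.

(** Farkas yields coefficients >= 0; applied to the height minus a small multiple of the sum of
    [us], it yields strictly positive ones. Strictness lets [square_split] conclude from a vanishing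
    weighted sum that single functionals vanish. *)
Lemma height_pos_comb : exists c : 'cV[R]_n -> R, (forall u, 0 < c u) /\
  forall x, x \in <<vs>>%VS -> pairing h x = \sum_(u <- us) c u * pairing u x.
Proof.
pose S := \sum_(u <- us) u.
have [eps e0 He] := small_eps vs (pairing S).
have [|c [c0 Hc]] := @farkas_functional _ _ <<vs>>%VS us (h - eps *: S).
  move=> x xU /(gor_mem G xU); apply: cone_pairing_ge0 => v vin.
  rewrite pairingBl pairingZl (gor_height G) // subr_ge0 (le_trans _ (He v vin)) //.
  by rewrite ler_wpM2l ?ler_norm // ltW.
exists (fun u => c u + eps); split=> [u|x xU]; first by rewrite ltr_wpDl.
have := Hc x xU; rewrite pairingBl pairingZl => /eqP; rewrite subr_eq => /eqP ->.
by rewrite pairing_suml mulr_sumr -big_split; apply: eq_bigr => u _; rewrite mulrDl.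
Qed.

(** [m] minus a small multiple of any generator stays in the cone, so [w] cannot be positive at that
    generator. *)
Lemma interior_zero w : (forall v, v \in vs -> 0 <= pairing w v) -> pairing w m = 0 ->
  forall x, x \in <<vs>>%VS -> pairing w x = 0.
Proof.
move=> w0 wm; apply: pairing_span => v vin; apply/le_anti; rewrite w0 // andbT.
have [eps e0 He] := small_eps us (fun u => pairing u v).
have : 0 <= pairing w (m - eps *: v).
  apply: cone_pairing_ge0 w0 _; apply: (gor_mem G) => [|u uin].
    by rewrite memvB ?(gor_m_span G) // memvZ // memv_span.
  rewrite pairingBr pairingZr (gor_m1 G) // subr_ge0 (le_trans _ (He u uin)) //.
  by rewrite ler_wpM2l ?ler_norm // ltW.
by rewrite pairingBr pairingZr wm sub0r oppr_ge0 pmulr_rle0.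
Qed.

Variables (K : {vspace 'rV[R]_n}) (E : seq 'rV[R]_n).
Hypotheses (goodE : forall e, e \in E -> good vs us e)
  (levelE : forall e, e \in E -> level vs us e = K) (coneE : cone vs (m - \sum_(e <- E) e))
  (uE : uniq E).

Variable c : 'cV[R]_n -> R.
Hypotheses (c0 : forall u, 0 < c u)
  (hc : forall x, x \in <<vs>>%VS -> pairing h x = \sum_(u <- us) c u * pairing u x).

Let goodE_span e : e \in E -> e \in <<vs>>%VS.
Proof. by move=> /goodE /andP[ein _]; apply: memv_span. Qed.

(** The expansion [hc] of the height with each term weighted by the value of its functional on the
    sum of [E]. It turns out to be the common value of all admissible sums of one functional per
    class. *)
Definition center := \sum_(u <- us) (c u * pairing u (\sum_(e <- E) e)) *: u.

Let sum_span : \sum_(e <- E) e \in <<vs>>%VS.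
Proof. by rewrite big_seq memv_suml // => e /goodE_span. Qed.

(** By [coneE] the sum of [E] pairs with every functional to at most u(m) = 1, so the center is
    dominated termwise by the height. *)
Lemma center_le v : v \in vs -> pairing center v <= 1.
Proof.
move=> vin; rewrite -(gor_height G vin) hc ?memv_span // /center pairing_suml.
rewrite big_seq [leRHS]big_seq; apply: ler_sum => u uin.
rewrite pairingZl -subr_ge0 -mulrA -mulrBr mulr_ge0 ?(ltW (c0 _)) //.
rewrite -{1}[pairing u v]mul1r -mulrBl mulr_ge0 ?(gor_ge0 G) //.
by rewrite -(gor_m1 G uin) -pairingBr (gor_cone_ge0 G).
Qed.

Lemma center_m : pairing center m = (size E)%:R.
Proof.
rewrite /center pairing_suml (eq_big_seq (fun u => c u * pairing u (\sum_(e <- E) e))).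
  rewrite -hc // pairing_sumr (eq_big_seq (fun=> 1)) => [|e /goodE /andP[ein _]].
    by rewrite big_const_seq iter_addr_0 count_predT.
  exact: (gor_height G).
by move=> u uin; rewrite pairingZl (gor_m1 G) // mulr1.
Qed.

(** For fixed [e], the functionals that are 0 at [e] drop out and the others agree at [y]; what
    remains is g_e(y) times a total weight of h(e) = 1. *)
Lemma center_level (g : 'rV[R]_n -> 'cV[R]_n) y :
  (forall e, e \in E -> g e \in us /\ pairing (g e) e = 1) ->
  y \in K -> pairing center y = \sum_(e <- E) pairing (g e) y.
Proof.
move=> gE yK; rewrite /center pairing_suml.
transitivity (\sum_(u <- us) \sum_(e <- E) c u * pairing u e * pairing (g e) y).
  apply: eq_big_seq => u uin; rewrite pairingZl pairing_sumr mulr_sumr mulr_suml.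
  apply: eq_big_seq => e ein; have [->|ue] := good_01 G (goodE ein) uin.
    by rewrite !(mulr0, mul0r).
  have [gin ge] := gE e ein; congr (_ * _).
  by move: yK; rewrite -(levelE ein) => /levelP[_ H]; apply: H.
rewrite exchange_big; apply: eq_big_seq => e ein /=.
rewrite -mulr_suml -hc ?goodE_span // (gor_height G) ?mul1r //.
by case/andP: (goodE ein).
Qed.

(** The difference vanishes on [K], is >= 0 at the generators off [K], where the sum is at least 1
    and the center at most 1, and vanishes at the interior point [m]. *)
Lemma center_eq (g : 'rV[R]_n -> 'cV[R]_n) :
  (forall e, e \in E -> g e \in us /\ pairing (g e) e = 1) ->
  (forall v, v \in vs -> v \notin K -> exists2 e, e \in E & 1 <= pairing (g e) v) ->
  forall x, x \in <<vs>>%VS -> \sum_(e <- E) pairing (g e) x = pairing center x.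
Proof.
move=> gE gv x xU; apply/eqP; rewrite -subr_eq0 -pairing_suml -pairingBl.
apply/eqP; apply: interior_zero xU => [v vin|]; last first.
  rewrite pairingBl center_m pairing_suml (eq_big_seq (fun=> 1)).
    by rewrite big_const_seq iter_addr_0 count_predT subrr.
  by move=> e /gE[gin _]; rewrite (gor_m1 G).
rewrite pairingBl pairing_suml; have [vK|vK] := boolP (v \in K).
  by rewrite (center_level gE) // subrr.
rewrite subr_ge0; apply: le_trans (center_le vin) _.
have [e ein ge] := gv v vin vK.
rewrite (perm_big _ (perm_to_rem ein)) big_cons /= -[leLHS]addr0 lerD //.
rewrite big_seq sumr_ge0 // => z /mem_rem /gE[gin _]; exact: (gor_ge0 G).
Qed.

Hypothesis KU : (\dim K < \dim <<vs>>)%N.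


Lemma selection_level e0 (es : seq 'rV[R]_n) : {subset e0 :: es <= E} -> uniq (e0 :: es) ->
  (\dim <<vs>> <= \dim K + size es)%N ->
  exists g : 'rV[R]_n -> 'cV[R]_n,
    (forall e, e \in E -> g e \in us /\ pairing (g e) e = 1) /\
    forall x, x \in <<vs>>%VS -> (forall e u, e \in e0 :: es -> u \in us ->
       pairing u e = 1 -> pairing (g e) x <= pairing u x) -> x \in K.
Proof.
move=> sub ues dimU; pose Gf e := [seq u <- us | pairing u e == 1].
have GfP e u : u \in Gf e <-> u \in us /\ pairing u e = 1.
  by rewrite mem_filter; split=> [/andP[/eqP]|[-> ->]]; rewrite ?eqxx.
have [|||||g0 [g0G g0K]] := @selection _ _ _ Gf K e0 es <<vs>>%VS ues.
- by move=> e /sub/goodE/(good_ex1 G)[u uin ue]; exists u; apply/GfP.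
- move=> e x /sub ein xU H; rewrite -(levelE ein); apply/levelP; split=> // u w uin win ue we.
  by apply: H; apply/GfP.
- move=> e x u w /sub ein; rewrite -(levelE ein) => /levelP[_ H] /GfP[uin ue] /GfP[win we].
  exact: H.
- by [].
- by rewrite -(levelE (sub e0 (mem_head _ _))) capvSl.
have /choice[g1 Hg1] : forall e, exists u, e \in E -> u \in us /\ pairing u e = 1.
  move=> e; have [/goodE/(good_ex1 G)[u uin ue]|//] := boolP (e \in E).
    by exists u.
  by exists 0.
exists (fun e => if e \in e0 :: es then g0 e else g1 e); split=> [e ein|x xU H].
  by case: ifPn => [/g0G/GfP//|_]; apply: Hg1.
apply: g0K => // e u ein /GfP[uin ue].
by have := H e u ein uin ue; rewrite ein.
Qed.

(** A functional that is not minimal at [v] within its class exceeds another one that is >= 0 there;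
    being integral at [v], it is at least 1. This supplies the hypothesis of [center_eq]. *)
Lemma not_minimised_ge1 (g : 'rV[R]_n -> 'cV[R]_n) (es : seq 'rV[R]_n) v :
  {subset es <= E} -> (forall e, e \in E -> g e \in us /\ pairing (g e) e = 1) ->
  v \in vs ->
  ~ (forall e u, e \in es -> u \in us -> pairing u e = 1 ->
       pairing (g e) v <= pairing u v) ->
  exists2 e, e \in es & 1 <= pairing (g e) v.
Proof.
move=> sub gE vin.
move=> /existsNP[e /existsNP[u /not_implyP[ein /not_implyP[uin /not_implyP[ue]]]]].
move=> /negP; rewrite -ltNge => lt; exists e => //.
have [gin _] := gE e (sub e ein).
apply: int_ge1; first by apply: (gor_us_int G) => //; [exact: memv_span|exact: (gor_vs_int G)].
exact: le_lt_trans (gor_ge0 G uin vin) lt.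
Qed.

(** With more classes some [e1] stays outside the selection. Its functional can be exchanged within
    its class while [center_eq] still applies, so the class agrees on the whole span, against
    [KU]. *)
Lemma size_le_codim : (size E <= (\dim <<vs>> - \dim K).+1)%N.
Proof.
rewrite leqNgt; apply/negP; set k := (_ - _)%N => ltE.
have k0 : (0 < k)%N by rewrite /k subn_gt0.
case EE : E ltE => [//|e0 es] /= ltE.
have [e1 e1in e1n] : exists2 e1, e1 \in E & e1 \notin e0 :: take k es.
  exists (nth e0 es k); first by rewrite EE inE mem_nth ?orbT.
  have := uE; rewrite EE -[X in e0 :: X](cat_take_drop k) /= mem_cat cat_uniq.
  rewrite (drop_nth e0) //= => /and4P[e0n _ /norP[n1 _] _].
  by rewrite inE (negbTE n1) orbF; apply: contraNneq e0n => ->; rewrite mem_head orbT.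
have sub : {subset e0 :: take k es <= E}.
  by move=> e; rewrite EE !inE => /orP[->//|/mem_take ->]; rewrite orbT.
have uet : uniq (e0 :: take k es).
  have := uE; rewrite EE /= => /andP[e0n ues]; rewrite take_uniq // andbT.
  by apply: contra e0n => /mem_take.
have dimU : (\dim <<vs>> <= \dim K + size (take k es))%N.
  by rewrite size_take (ltE : (k < size es)%N) /k; lia.
have [g [gE gK]] := selection_level sub uet dimU.
have upd u : u \in us -> pairing u e1 = 1 -> forall x, x \in <<vs>>%VS ->
    pairing u x = pairing center x - \sum_(e <- rem e1 E) pairing (g e) x.
  move=> uin ue x xU; pose g' e := if e == e1 then u else g e.
  have g'E e : e \in E -> g' e \in us /\ pairing (g' e) e = 1.
    by rewrite /g'; case: eqP => [-> //|_]; apply: gE.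
  rewrite -(center_eq g'E) => // [|v vin vK].
    rewrite (perm_big _ (perm_to_rem e1in)) big_cons /= {1}/g' eqxx.
    rewrite [X in _ + X - _](eq_big_seq (fun e => pairing (g e) x)) ?addrK // => e.
    by rewrite mem_rem_uniq // inE /g' => /andP[/negbTE ->].
  have [e ein ge] := not_minimised_ge1 sub gE vin (fun H => negP vK (gK v (memv_span vin) H)).
  exists e; first exact: sub.
  by rewrite /g'; case: eqP => // ee1; rewrite -ee1 ein in e1n.
suff : (<<vs>> <= K)%VS by move=> /dimvS; rewrite leqNgt KU.
apply/subvP => x xU; rewrite -(levelE e1in); apply/levelP; split=> // u w uin win ue we.
by rewrite (upd u) // (upd w).
Qed.
End Fixed.
End Core.

Section Apexes.
Variables (R : realType) (n : nat).
Implicit Types (u w h : 'cV[R]_n) (x y v e m : 'rV[R]_n).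
Implicit Types (vs : seq 'rV[R]_n) (us : seq 'cV[R]_n).

Lemma mem_peel vs us e v : v \in peel_vs vs us e <->
  v \in vs /\ forall u, u \in us -> pairing u e = 1 -> pairing u v = 0.
Proof.
rewrite mem_filter; split=> [/andP[/allP H ->]|[-> H]].
  split=> // u uin ue; apply/eqP; apply: H; by rewrite mem_filter ue eqxx.
rewrite andbT; apply/allP => u; rewrite mem_filter => /andP[/eqP ue uin].
by rewrite H.
Qed.

Lemma peel_not_mem vs us h m e : gor_cone vs us h m -> good vs us e ->
  e \notin peel_vs vs us e.
Proof.
move=> G ge; apply/negP => /mem_peel[_ H]; have [u uin ue] := good_ex1 G ge.
by have := H u uin ue; rewrite ue => /eqP; rewrite oner_eq0.
Qed.

Lemma peel_size vs us h m e : gor_cone vs us h m -> good vs us e ->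
  (size (peel_vs vs us e) < size vs)%N.
Proof.
move=> G ge; rewrite size_filter -(count_predC (fun v => all (fun u => pairing u v == 0)
  [seq u <- us | pairing u e == 1]) vs) -[X in (X < _)%N]addn0 ltn_add2l -has_count.
apply/hasP; exists e; first by case/andP: ge.
apply: contraNN (peel_not_mem G ge) => /= H.
by rewrite mem_filter H; case/andP: ge.
Qed.

Lemma peel_good vs us h m e v : gor_cone vs us h m -> good vs us e ->
  good (peel_vs vs us e) (peel_us us e) v -> good vs us v.
Proof.
move=> G ge /andP[/mem_peel[vin Hv] /allP H]; rewrite /good vin; apply/allP => u uin.
have [ue|/eqP ue] := eqVneq (pairing u e) 1; first by rewrite Hv.
by apply: H; rewrite mem_filter uin andbT; apply/eqP.
Qed.

(** A functional that is 1 at [v] vanishes at [e], as [v] lies on the peeled face. So subtracting a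
    multiple of [e] moves [x] into the span of the face, where [v] is an apex, without changing the
    values in question. *)
Lemma peel_apex_level vs us h m e v : gor_cone vs us h m -> good vs us e ->
  apex (peel_vs vs us e) (peel_us us e) v -> (level vs us e <= level vs us v)%VS.
Proof.
move=> G ge /andP[gv /subvP av]; have [/mem_peel[vin Hv] _] := andP gv.
have ein : e \in vs by case/andP: ge.
have [u0 u0in u0e] := good_ex1 G ge.
apply/subvP => x /levelP[xU Hx]; apply/levelP; split=> // u w uin win uv wv.
have z u' : u' \in us -> pairing u' v = 1 -> pairing u' e = 0.
  move=> uin' uv'; have [//|ue] := good_01 G ge uin'.
  by move: uv'; rewrite Hv // => /esym/eqP; rewrite oner_eq0.
have /av/levelP[_ H] : x - pairing u0 x *: e \in <<peel_vs vs us e>>%VS.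
  apply/(peel_span G _ ge); split; first by rewrite memvB ?memvZ ?(memv_span ein).
  by move=> u' uin' ue'; rewrite pairingBr pairingZr ue' mulr1 (Hx u' u0) ?subrr.
have pu u' : u' \in us -> pairing u' v = 1 -> u' \in peel_us us e.
  by move=> uin' uv'; rewrite mem_filter uin' z // eq_sym oner_eq0.
have := H u w (pu u uin uv) (pu w win wv) uv wv.
by rewrite !pairingBr !pairingZr !z // !mulr0 !subr0.
Qed.

(** The cone condition says that the apexes can be subtracted from [m] jointly; this is what
    [center_le] asks of [E]. *)
Definition apex_bound vs us h m := exists A : seq 'rV[R]_n,
  [/\ uniq A, forall v, v \in A -> apex vs us v, cone vs (m - \sum_(v <- A) v) &
      3 * pairing h m <= 2 * (\dim <<vs>>)%:R + (size A)%:R].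

(** The bound for smaller cones is a hypothesis, so that the lemma serves inside the induction that
    proves this bound, where the final equality is contradictory, and again afterwards in
    [square_split]. *)
Lemma no_apex_core vs us h m : gor_cone vs us h m ->
  (forall e, ~~ apex vs us e) -> (0 < \dim <<vs>>)%N ->
  2 * (\dim <<vs>>)%:R <= 3 * pairing h m ->
  (forall vs' us' m', (size vs' < size vs)%N -> gor_cone vs' us' h m' ->
     apex_bound vs' us' h m') ->
  exists e0 e1, [/\ uniq [:: e0; e1], good vs us e0 /\ good vs us e1,
    level vs us e0 = level vs us e1, cone vs (m - (e0 + e1)) &
    \dim <<vs>> = (\dim (level vs us e0)).+1 /\
    3 * pairing h m = 2 * (\dim <<vs>>)%:R].
Proof.
move=> G na dimU ge2 IH.
have [e ge] : exists e, good vs us e.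
  have D0 : 0 < (\dim <<vs>>)%:R :> R by rewrite ltr0n.
  by apply: (exists_good G); lra.
have [e0 /[!mem_filter]/andP[ge0 _] maxe0] : exists2 e0, e0 \in [seq e <- vs | good vs us e] &
    forall e, e \in [seq e <- vs | good vs us e] ->
      (\dim (level vs us e) <= \dim (level vs us e0))%N.
  by apply: (seq_max _ (x0 := e)); rewrite mem_filter ge; case/andP: ge.
have e0in : e0 \in vs by case/andP: ge0.
have [A [uA apA coneA boundA]] := IH _ _ _ (peel_size G ge0) (peel_gor G ge0).
have goodA v : v \in A -> good vs us v.
  by move=> /apA/andP[gv _]; apply: peel_good G ge0 gv.
have levA v : v \in A -> level vs us v = level vs us e0.
  move=> vA; apply/eqP; rewrite eq_sym eqEdim (peel_apex_level G ge0 (apA v vA)) /=.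
  by apply: maxe0; rewrite mem_filter goodA //; case/andP: (goodA v vA).
pose E := e0 :: A; pose K := level vs us e0.
have gE e1 : e1 \in E -> good vs us e1.
  by rewrite inE => /orP[/eqP ->|/goodA].
have lE e1 : e1 \in E -> level vs us e1 = K.
  by rewrite inE => /orP[/eqP ->|/levA].
have uE : uniq E.
  rewrite /= uA andbT; apply/negP => /apA/andP[/andP[e0p _] _].
  by move: (peel_not_mem G ge0); rewrite e0p.
have sub : {subset peel_vs vs us e0 <= vs} by move=> v /mem_peel[].
have cE : cone vs (m - \sum_(v <- E) v).
  by rewrite big_cons opprD addrA; apply: cone_sub sub coneA.
have KU : (\dim K < \dim <<vs>>)%N.
  rewrite ltnNge; apply: contraNN (na e0) => le; rewrite /apex ge0 /=.
  by have /eqP <- : K == <<vs>>%VS by rewrite eqEdim capvSl.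
have [c [c0 hc]] := height_pos_comb G.
have szE := size_le_codim G gE lE cE uE c0 hc KU.
have dK := peel_dim G ge0; rewrite -/K in dK.
move: boundA; rewrite pairingBr (gor_height G e0in) => boundA.
have dKr : (\dim K)%:R = 1 + (\dim <<peel_vs vs us e0>>)%:R :> R by rewrite dK -natr1 addrC.
have [d dE] : exists d, (\dim <<vs>> = \dim K + d.+1)%N.
  by exists (\dim <<vs>> - \dim K).-1; rewrite prednK ?subn_gt0 // subnKC // ltnW.
have szA : (size A <= d.+1)%N by move: szE; rewrite dE addKn.
have szAr : (size A)%:R <= 1 + d%:R :> R by rewrite -[1]/(1%:R) -natrD ler_nat add1n.
have dEr : (\dim <<vs>>)%:R = (\dim K)%:R + (1 + d%:R) :> R by rewrite dE natrD -natr1 [d%:R + 1]addrC.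
(* With D the dimension of the span, r = h(m) and d + 1 the codimension of [K], the bound for the
   peeled cone, of dimension D - d - 2, reads 3 r - 2 D + 2 d + 1 <= |A|. Together with |A| <= d + 1
   and 2 D <= 3 r this leaves d = 0. *)
have d0 : d%:R = 0 :> R.
  by apply/le_anti; rewrite ler0n andbT; lra.
have dd : d = 0%N by apply/eqP; rewrite -(pnatr_eq0 R) d0.
have szA1 : size A = 1%N.
  apply/eqP; rewrite eqn_leq; move: szA; rewrite dd => -> /=.
  by rewrite -(ler_nat R); lra.
case AE : A szA1 => [//|e1 [|//]] _.
have e1A : e1 \in A by rewrite AE mem_head.
exists e0, e1; split.
- by move: uE; rewrite /E AE.
- by split=> //; apply: goodA.
- by rewrite levA.
- by move: cE; rewrite /E AE !big_cons big_nil addr0.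
- split; first by rewrite -/K dE dd addn1.
  apply: le_anti; rewrite ge2 andbT; lra.
Qed.

(** Peeling an apex lowers r and D by 1 each, hence 3 r - 2 D by 1, which pays for the apex added to
    the list. Without an apex and with 3 r > 2 D, [no_apex_core] is contradictory. *)
Lemma apex_boundP vs us h m : gor_cone vs us h m -> apex_bound vs us h m.
Proof.
have [k] := ubnP (size vs); elim: k vs us m => // k IH vs us m szk G.
have [le|lt] := leP (3 * pairing h m) (2 * (\dim <<vs>>)%:R).
  exists [::]; split=> //; last by rewrite addr0.
  by rewrite big_nil subr0; apply: gor_m_cone G.
have dimU : (0 < \dim <<vs>>)%N.
  rewrite lt0n; apply/negP => /eqP d0.
  have m0 : m = 0.
    have := gor_m_span G; have /eqP -> : <<vs>>%VS == 0%VS by rewrite -dimv_eq0 d0.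
    by rewrite memv0 => /eqP.
  by move: lt; rewrite d0 m0 pairing0r !mulr0 ltxx.
have [[e ae]|na] := pselect (exists e, apex vs us e); last first.
  have na' e : ~~ apex vs us e by apply/negP => ae; apply: na; exists e.
  have [|e0 [e1 [_ _ _ _ [_ E]]]] := no_apex_core G na' dimU (ltW lt).
    by move=> vs' us' m' lt'; apply: IH; apply: leq_trans lt' _; rewrite -ltnS.
  by move: lt; rewrite E ltxx.
have [ge levU] := andP ae; have ein : e \in vs by case/andP: ge.
have [|A [uA apA coneA boundA]] := IH _ _ _ _ (peel_gor G ge).
  by apply: leq_trans (peel_size G ge) _; rewrite -ltnS.
have sub : {subset peel_vs vs us e <= vs} by move=> v /mem_peel[].
exists (e :: A); split.
- rewrite /= uA andbT; apply/negP => /apA/andP[/andP[ep _] _].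
  by move: (peel_not_mem G ge); rewrite ep.
- move=> v; rewrite inE => /orP[/eqP -> //|vA].
  have /andP[gv _] := apA v vA; rewrite /apex (peel_good G ge gv) /=.
  exact: subv_trans levU (peel_apex_level G ge (apA v vA)).
- by rewrite big_cons opprD addrA; apply: cone_sub sub coneA.
- move: boundA; rewrite pairingBr (gor_height G ein).
  have -> : (\dim <<vs>>)%:R = 1 + (\dim <<peel_vs vs us e>>)%:R :> R.
    rewrite -[1]/(1%:R) -natrD add1n -(peel_dim G ge); congr (_%:R); apply/eqP.
    by rewrite eqn_leq dimvS //= dimvS // capvSl.
  by rewrite /= -natr1; lra.
Qed.
End Apexes.

(** * Splitting off a square *)

Section Squares.
Variables (R : realType) (n : nat).
Implicit Types (u w h : 'cV[R]_n) (x y v e m : 'rV[R]_n).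
Implicit Types (vs : seq 'rV[R]_n) (us : seq 'cV[R]_n).
Local Notation integral := (integral_points R n).

(** The cone is pointed: [x] and [- x] both lie in it, at opposite heights that are both >= 0. *)
Lemma gor_separated vs us h m x : gor_cone vs us h m -> x \in <<vs>>%VS ->
  (forall u, u \in us -> pairing u x = 0) -> x = 0.
Proof.
move=> G xU H.
have cx : cone vs x by apply: (gor_mem G) => // u /H ->.
have cnx : cone vs (- x).
  by apply: (gor_mem G) => [|u /H E]; rewrite ?memvN // pairingNr E oppr0.
apply: (gor_height_eq0 G cx); apply: le_anti; rewrite (gor_height_ge0 G cx) andbT.
by have := gor_height_ge0 G cnx; rewrite pairingNr oppr_ge0.
Qed.

(* The generators are those of a unit square with vertices e0, y2, e1, y1 (in
   cyclic order) together with those of vs', and (a, b, H) are the coordinates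
   and the height on the square's part. *)
Record square_summand vs vs' (a b H : 'cV[R]_n) (e0 e1 y1 y2 : 'rV[R]_n) : Prop :=
  SquareSummand {
  sq_block : forall v, v \in [:: e0; e1; y1; y2] -> v \in vs;
  sq_sub : {subset vs' <= vs};
  sq_cover : forall v, v \in vs -> v \in [:: e0; e1; y1; y2] \/ v \in vs';
  sq_int : forall x, x \in <<vs>>%VS -> integral x ->
    [/\ pairing a x \is a Num.int, pairing b x \is a Num.int & pairing H x \is a Num.int];
  sq_e0 : [/\ pairing a e0 = 0, pairing b e0 = 0 & pairing H e0 = 1];
  sq_e1 : [/\ pairing a e1 = 1, pairing b e1 = 1 & pairing H e1 = 1];
  sq_y1 : [/\ pairing a y1 = 0, pairing b y1 = 1 & pairing H y1 = 1];
  sq_y2 : [/\ pairing a y2 = 1, pairing b y2 = 0 & pairing H y2 = 1];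
  sq_rel : e0 + e1 = y1 + y2;
  sq_rest : forall v, v \in vs' -> [/\ pairing a v = 0, pairing b v = 0 & pairing H v = 0];
  sq_proj : forall x, x \in <<vs>>%VS ->
    x - (pairing a x *: y2 + pairing b x *: y1 +
         (pairing H x - pairing a x - pairing b x) *: e0) \in <<vs'>>%VS }.

(** The values at one generator of two functionals from each of the two classes; [q] is the value of
    the center, equal to both crossed sums. *)
Lemma square_values (ul uh wl wh q : R) : ul \is a Num.int -> uh \is a Num.int ->
  0 <= ul -> 0 <= wl -> uh + wl = q -> ul + wh = q -> q <= 1 -> ul < uh ->
  [/\ ul = 0, uh = 1, wl = 0 & wh = 1].
Proof.
move=> uli uhi p0 p1 c1 c2 ql lt; have ge1 := int_ge1 uhi (le_lt_trans p0 lt).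
have le1 : ul <= 1 by lra.
have [z|z] := int_01 uli p0 le1; last by lra.
by split=> //; lra.
Qed.

Lemma square_values_flat (u w q : R) : u \is a Num.int -> w \is a Num.int ->
  0 <= u -> 0 <= w -> q = u + w -> q <= 1 ->
  q = 0 \/ q = 1 /\ (u = 1 /\ w = 0 \/ u = 0 /\ w = 1).
Proof.
move=> ui wi p0 p1 c1 ql.
have u1 : u <= 1 by lra.
have w1 : w <= 1 by lra.
have [z|z] := int_01 ui p0 u1.
  have [z'|z'] := int_01 wi p1 w1; first by left; lra.
  by right; split; [lra|right].
by right; split; [lra|left; split=> //; lra].
Qed.

(** With [ul], [uh] from the class of [e0] and [wl], [wh] from that of [e1], four values sort the
    generators: off [K] they are those of [y1] or [y2]; in [K] they are those of [e0] or [e1] if the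
    center is 1, and all 0 on the face left after peeling both. *)
Lemma square_split vs us h m : gor_cone vs us h m ->
  (forall e, ~~ apex vs us e) -> (0 < \dim <<vs>>)%N ->
  3 * pairing h m = 2 * (\dim <<vs>>)%:R ->
  exists vs' us' m' a b H e0 e1 y1 y2,
    [/\ gor_cone vs' us' h m', forall e, ~~ apex vs' us' e,
        3 * pairing h m' = 2 * (\dim <<vs'>>)%:R,
        (\dim <<vs>> = \dim <<vs'>> + 3)%N &
        square_summand vs vs' a b H e0 e1 y1 y2].
Proof.
move=> G na dimU E32.
have [||e0 [e1 [u01 [g0 g1] levE coneE [dimK _]]]] := no_apex_core G na dimU.
- by rewrite E32.
- by move=> vs' us' m' _; apply: apex_boundP.
set K := level vs us e0 in levE dimK.
have e0in : e0 \in vs by case/andP: g0.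
have e1in : e1 \in vs by case/andP: g1.
have e01 : e0 != e1 by move: u01; rewrite /= inE andbT.
pose E := [:: e0; e1].
have sumE : \sum_(e <- E) e = e0 + e1 by rewrite !big_cons big_nil addr0.
have gE e : e \in E -> good vs us e by rewrite !inE => /orP[/eqP ->|/eqP ->].
have lE e : e \in E -> level vs us e = K by rewrite !inE => /orP[/eqP ->|/eqP ->].
have cE : cone vs (m - \sum_(e <- E) e) by rewrite sumE.
have [c [c0 hc]] := height_pos_comb G.
have disj u : u \in us -> pairing u e0 + pairing u e1 <= 1.
  by move=> uin; have := gor_cone_ge0 G uin coneE; rewrite pairingBr pairingDr (gor_m1 G) // subr_ge0.
have disj10 u : u \in us -> pairing u e1 = 1 -> pairing u e0 = 0.
  move=> uin ue; have := disj u uin; have := gor_ge0 G uin e0in; rewrite ue.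
  by move=> p q; apply: le_anti; rewrite p andbT; lra.
have disj01 u : u \in us -> pairing u e0 = 1 -> pairing u e1 = 0.
  move=> uin ue; have := disj u uin; have := gor_ge0 G uin e1in; rewrite ue.
  by move=> p q; apply: le_anti; rewrite p andbT; lra.
pose q := center us E c.
have qE y : y \in <<vs>>%VS -> pairing q y =
    \sum_(u <- us) c u * (pairing u e0 + pairing u e1) * pairing u y.
  move=> yU; rewrite /q /center sumE pairing_suml; apply: eq_big_seq => u uin.
  by rewrite pairingZl pairingDr.
(* Where the center vanishes, its terms vanish one by one, and functionals of the two classes occur
   in it with positive weight. *)
have q0 y u : y \in vs -> pairing q y = 0 -> u \in us ->
    pairing u e0 = 1 \/ pairing u e1 = 1 -> pairing u y = 0.
  move=> yin; rewrite qE ?memv_span // big_seq => /eqP; rewrite psumr_eq0; last first.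
    move=> z zin; rewrite !mulr_ge0 ?(ltW (c0 _)) ?(gor_ge0 G) //.
    by rewrite addr_ge0 ?(gor_ge0 G).
  move=> /allP H uin ue; have /implyP/(_ uin) := H u uin.
  rewrite !mulf_eq0 (gt_eqF (c0 u)) /= => /orP[/eqP s0|/eqP //].
  move: s0; case: ue => ue; rewrite ue.
    by rewrite (disj01 u uin ue) addr0 => /eqP; rewrite oner_eq0.
  by rewrite (disj10 u uin ue) add0r => /eqP; rewrite oner_eq0.
(* Dually, where the center equals the height, the terms of their difference vanish; functionals
   outside both classes keep their full weight there. *)
have q1 y u : y \in vs -> pairing q y = 1 -> u \in us ->
    pairing u e0 = 0 -> pairing u e1 = 0 -> pairing u y = 0.
  move=> yin qy uin ue0 ue1; have := gor_height G yin; rewrite hc ?memv_span // => hy.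
  have : \sum_(u <- us) c u * (1 - (pairing u e0 + pairing u e1)) * pairing u y = 0.
    transitivity (\sum_(u <- us) c u * pairing u y - pairing q y); last by rewrite hy qy subrr.
    rewrite qE ?memv_span // -sumrB; apply: eq_bigr => z _; ring.
  rewrite big_seq => /eqP; rewrite psumr_eq0; last first.
    move=> z zin; rewrite !mulr_ge0 ?(ltW (c0 _)) ?(gor_ge0 G) //.
    by rewrite subr_ge0 disj.
  move=> /allP H; have /implyP/(_ uin) := H u uin.
  by rewrite ue0 ue1 addr0 subr0 mulr1 mulf_eq0 (gt_eqF (c0 u)) => /eqP.
have KU : (K <= <<vs>>)%VS by apply: capvSl.
have [y1 y1in y1K] : exists2 y, y \in vs & y \notin K.
  apply/hasP; rewrite -[has _ _]negbK -all_predC; apply/negP => /allP H.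
  have : (<<vs>> <= K)%VS by apply/span_subvP => v /H; rewrite /= negbK.
  by move/dimvS; rewrite dimK ltnn.
have UK x : x \in <<vs>>%VS -> exists t, exists2 k, k \in K & x = k + t *: y1.
  have -> : <<vs>>%VS = (K + <[y1]>)%VS.
    apply/esym/eqP; rewrite eqEdim subv_add KU -memvE memv_span //=.
    rewrite dimK dimv_disjoint_sum ?dim_vline.
      by case: eqP y1K => [->|_ _]; rewrite ?mem0v // addn1.
    apply/eqP; rewrite -subv0; apply/subvP => z; rewrite memv_cap => /andP[zK /vlineP[t zE]].
    have [t0|t0] := eqVneq t 0; first by rewrite zE t0 scale0r mem0v.
    by move: zK => /(memvZ t^-1); rewrite zE scalerA mulVf // scale1r (negbTE y1K).
  by case/memv_addP => k kK [_ /vlineP[t ->] ->]; exists t, k.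
have K0 x u w : x \in K -> u \in us -> w \in us -> pairing u e0 = 1 -> pairing w e0 = 1 ->
    pairing u x = pairing w x by move=> /levelP[_ H]; apply: H.
have K1 x u w : x \in K -> u \in us -> w \in us -> pairing u e1 = 1 -> pairing w e1 = 1 ->
    pairing u x = pairing w x by rewrite levE => /levelP[_ H]; apply: H.
have pick e : e \in E -> exists ul uh, [/\ ul \in us, uh \in us, pairing ul e = 1,
    pairing uh e = 1 & pairing ul y1 < pairing uh y1].
  move=> ein; have := y1K; rewrite -(lE e ein) => /negP H.
  have : ~ forall u w, u \in us -> w \in us -> pairing u e = 1 -> pairing w e = 1 ->
    pairing u y1 = pairing w y1.
    by move=> H'; apply: H; apply/levelP; split; [exact: memv_span|].
  move=> /existsNP[u /existsNP[w /not_implyP[uin /not_implyP[win /not_implyP[ue /not_implyP[we]]]]]].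
  move=> /eqP; rewrite neq_lt => /orP[lt|lt]; first by exists u, w.
  by exists w, u.
have [ul [uh [ulin uhin ule uhe ult]]] := pick e0 (mem_head _ _).
have [wl [wh [wlin whin wle whe wlt]]] : exists ul uh, [/\ ul \in us, uh \in us,
    pairing ul e1 = 1, pairing uh e1 = 1 & pairing ul y1 < pairing uh y1].
  by apply: pick; rewrite !inE eqxx orbT.
have int u v : u \in us -> v \in vs -> pairing u v \is a Num.int.
  by move=> uin vin; apply: (gor_us_int G) => //; [exact: memv_span|exact: (gor_vs_int G)].
(* The two mixed choices of a low and a high functional both satisfy the
   hypothesis of center_eq, hence agree with the center. *)
have cen g0' g1' : g0' \in us -> g1' \in us -> pairing g0' e0 = 1 -> pairing g1' e1 = 1 ->
    (forall t k, k \in K -> k + t *: y1 \in vs -> t != 0 ->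
       1 <= pairing g0' (k + t *: y1) \/ 1 <= pairing g1' (k + t *: y1)) ->
    forall x, x \in <<vs>>%VS -> pairing g0' x + pairing g1' x = pairing q x.
  move=> in0 in1 ee0 ee1 H x xU.
  pose g e := if e == e0 then g0' else g1'.
  have ge0 : g e0 = g0' by rewrite /g eqxx.
  have ge1 : g e1 = g1' by rewrite /g eq_sym (negbTE e01).
  rewrite -(@center_eq _ _ vs us h m G K E gE lE cE c c0 hc g) //.
  - by rewrite !big_cons big_nil addr0 ge0 ge1.
  - by move=> e; rewrite !inE => /orP[] /eqP ->; rewrite ?ge0 ?ge1.
  - move=> v vin vK; have [t [k kK vE]] := UK v (memv_span vin).
    have t0 : t != 0 by apply: contraNneq vK => t0; rewrite vE t0 scale0r addr0.
    move: vin; rewrite vE => vin; have [?|?] := H t k kK vin t0.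
      by exists e0; rewrite ?mem_head // ge0.
    by exists e1; rewrite ?ge1 // !inE eqxx orbT.
(* High minus low has the sign of [t] in both classes, [t] being the coefficient of [y1] modulo the
   hyperplane [K]. *)
have pos_t v t k : k \in K -> v = k + t *: y1 ->
    pairing uh v - pairing ul v = t * (pairing uh y1 - pairing ul y1) /\
    pairing wh v - pairing wl v = t * (pairing wh y1 - pairing wl y1).
  move=> kK ->; rewrite !pairingDr !pairingZr.
  by rewrite (K0 k uh ul) // (K1 k wh wl) //; split; ring.
have cen1 x : x \in <<vs>>%VS -> pairing uh x + pairing wl x = pairing q x.
  apply: cen => // t k kK vin t0; have [d0 d1] := pos_t _ t k kK erefl.
  have p0 := gor_ge0 G ulin vin; have p1 := gor_ge0 G whin vin.
  case/orP: (lt_total t0) => [tn|tp].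
    right; apply: int_ge1; first exact: int.
    have : t * (pairing wh y1 - pairing wl y1) < 0 by rewrite nmulr_rlt0 // subr_gt0.
    by rewrite -d1 subr_lt0; apply: le_lt_trans.
  left; apply: int_ge1; first exact: int.
  have : 0 < t * (pairing uh y1 - pairing ul y1) by rewrite mulr_gt0 // subr_gt0.
  by rewrite -d0 subr_gt0; apply: le_lt_trans.
have cen2 x : x \in <<vs>>%VS -> pairing ul x + pairing wh x = pairing q x.
  apply: cen => // t k kK vin t0; have [d0 d1] := pos_t _ t k kK erefl.
  have p0 := gor_ge0 G uhin vin; have p1 := gor_ge0 G wlin vin.
  case/orP: (lt_total t0) => [tn|tp].
    left; apply: int_ge1; first exact: int.
    have : t * (pairing uh y1 - pairing ul y1) < 0 by rewrite nmulr_rlt0 // subr_gt0.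
    by rewrite -d0 subr_lt0; apply: le_lt_trans.
  right; apply: int_ge1; first exact: int.
  have : 0 < t * (pairing wh y1 - pairing wl y1) by rewrite mulr_gt0 // subr_gt0.
  by rewrite -d1 subr_gt0; apply: le_lt_trans.
have memU v : v \in vs -> v \in <<vs>>%VS by apply: memv_span.
have qle v : v \in vs -> pairing q v <= 1 by apply: (center_le G cE c0 hc).
have d0 : 0 < pairing uh y1 - pairing ul y1 by rewrite subr_gt0.
have eqK x : x \in <<vs>>%VS -> pairing uh x = pairing ul x -> x \in K.
  move=> xU E'; have [t [k kK xE]] := UK x xU; have [d _] := pos_t x t k kK xE.
  have t0 : t = 0.
    apply/eqP; have /eqP : t * (pairing uh y1 - pairing ul y1) = 0 by rewrite -d E' subrr.
    by rewrite mulf_eq0 (gt_eqF d0) orbF.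
  by rewrite xE t0 scale0r addr0.
have type_pos v : v \in vs -> pairing ul v < pairing uh v ->
    [/\ pairing ul v = 0, pairing uh v = 1, pairing wl v = 0 & pairing wh v = 1].
  move=> vin; apply: (square_values _ _ _ _ (cen1 v _) (cen2 v _) (qle v vin));
  by rewrite ?int ?(gor_ge0 G) ?memU.
have type_neg v : v \in vs -> pairing uh v < pairing ul v ->
    [/\ pairing ul v = 1, pairing uh v = 0, pairing wl v = 1 & pairing wh v = 0].
  move=> vin lt; have [||||t1 t2 t3 t4] // :=
    square_values _ _ _ _ (cen2 v (memU v vin)) (cen1 v (memU v vin)) (qle v vin) lt;
  by rewrite ?int ?(gor_ge0 G).
have type_K v : v \in vs -> v \in K -> [/\ pairing uh v = pairing ul v,
    pairing wh v = pairing wl v & pairing q v = 0 \/ pairing q v = 1 /\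
      (pairing ul v = 1 /\ pairing wl v = 0 \/ pairing ul v = 0 /\ pairing wl v = 1)].
  move=> vin vK; rewrite (K0 v uh ul) // (K1 v wh wl) //; split=> //.
  have := qle v vin; have := cen1 v (memU v vin); rewrite (K0 v uh ul) // => c1 ql.
  by apply: square_values_flat (esym c1) ql; rewrite ?int ?(gor_ge0 G).
have sep x : x \in <<vs>>%VS -> pairing ul x = 0 -> pairing uh x = 0 -> pairing wl x = 0 ->
    pairing wh x = 0 -> x \in K /\ forall u, u \in us ->
      pairing u e0 = 1 \/ pairing u e1 = 1 -> pairing u x = 0.
  move=> xU z1 z2 z3 z4; have xK : x \in K by apply: eqK; rewrite ?z1.
  split=> // u uin [ue|ue]; first by rewrite (K0 x u ul).
  by rewrite (K1 x u wl).
have uniq_type v v' : v \in vs -> v' \in vs -> pairing q v = 1 -> pairing q v' = 1 ->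
    pairing ul v = pairing ul v' -> pairing uh v = pairing uh v' ->
    pairing wl v = pairing wl v' -> pairing wh v = pairing wh v' -> v = v'.
  move=> vin v'in qv qv' t1 t2 t3 t4; apply/eqP; rewrite -subr_eq0; apply/eqP.
  have xU : v - v' \in <<vs>>%VS by rewrite memvB ?memU.
  have [_ S] : v - v' \in K /\ forall u, u \in us ->
      pairing u e0 = 1 \/ pairing u e1 = 1 -> pairing u (v - v') = 0.
    by apply: sep; rewrite // pairingBr ?t1 ?t2 ?t3 ?t4 subrr.
  apply: (gor_separated G xU) => u uin.
  have [ue0|ue0] := good_01 G g0 uin; last by apply: S => //; left.
  have [ue1|ue1] := good_01 G g1 uin; last by apply: S => //; right.
  by rewrite pairingBr (q1 v) // (q1 v') // subrr.
(* [uh - ul] vanishes at the interior point [m] but not at [y1], so it is negative at some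
   generator. *)
have [y2 y2in y2lt] : exists2 y, y \in vs & pairing uh y < pairing ul y.
  apply/hasP; rewrite -[has _ _]negbK -all_predC; apply/negP => /allP H.
  have : pairing (uh - ul) y1 = 0.
    apply: (interior_zero G) (memU _ y1in) => [v /H|]; last by rewrite pairingBl !(gor_m1 G) ?subrr.
    by rewrite /= -leNgt pairingBl subr_ge0.
  by rewrite pairingBl => E'; move: d0; rewrite E' ltxx.
have [a1 b1 a2 b2] := type_pos y1 y1in ult.
have [a3 b3 a4 b4] := type_neg y2 y2in y2lt.
have ul1 : pairing ul e1 = 0 by apply: disj01.
have uh1 : pairing uh e1 = 0 by apply: disj01.
have wl0 : pairing wl e0 = 0 by apply: disj10.
have wh0 : pairing wh e0 = 0 by apply: disj10.
have qe0 : pairing q e0 = 1 by rewrite -cen1 ?memU // uhe wl0 addr0.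
have qe1 : pairing q e1 = 1 by rewrite -cen1 ?memU // uh1 wle add0r.
have qy1 : pairing q y1 = 1 by rewrite -cen1 ?memU // b1 a2 addr0.
have qy2 : pairing q y2 = 1 by rewrite -cen1 ?memU // b3 a4 add0r.
pose vs1 := peel_vs vs us e0; pose us1 := peel_us us e0.
have G1 : gor_cone vs1 us1 h (m - e0) := peel_gor G g0.
have e1in1 : e1 \in vs1.
  by apply/mem_peel; split=> // u uin ue; apply: disj01.
have g11 : good vs1 us1 e1.
  rewrite /good e1in1; apply/allP => u; rewrite mem_filter => /andP[_ uin].
  by case/andP: g1 => _ /allP; apply.
pose vs' := peel_vs vs1 us1 e1; pose us' := peel_us us1 e1.
have G2 : gor_cone vs' us' h (m - e0 - e1) := peel_gor G1 g11.
have us1P u : u \in us -> pairing u e1 = 1 -> u \in us1.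
  by move=> uin ue; rewrite mem_filter uin (disj10 u uin ue) eq_sym oner_eq0.
have vs'P v : v \in vs' <-> v \in vs /\ forall u, u \in us ->
    pairing u e0 = 1 \/ pairing u e1 = 1 -> pairing u v = 0.
  split=> [/mem_peel[/mem_peel[vin H0] H1]|[vin H]].
    by split=> // u uin [ue|ue]; [apply: H0|apply: H1 => //; apply: us1P].
  apply/mem_peel; split; first by apply/mem_peel; split=> // u uin ue; apply: H => //; left.
  by move=> u; rewrite mem_filter => /andP[_ uin] ue; apply: H => //; right.
have spanP x : x \in <<vs>>%VS -> (forall u, u \in us ->
    pairing u e0 = 1 \/ pairing u e1 = 1 -> pairing u x = 0) -> x \in <<vs'>>%VS.
  move=> xU H; apply/(peel_span G1 _ g11); split.
    by apply/(peel_span G _ g0); split=> // u uin ue; apply: H => //; left.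
  by move=> u; rewrite mem_filter => /andP[_ uin] ue; apply: H => //; right.
(* [K] has codimension 1, the face left by peeling [e0] has one dimension less than [K], and in that
   face [e1] is an apex, so peeling it costs exactly one more. *)
have dims : (\dim <<vs>> = \dim <<vs'>> + 3)%N.
  rewrite dimK /K (peel_dim G g0) -/vs1.
  have -> : \dim <<vs1>> = (\dim <<vs'>>).+1; last by rewrite addn3.
  rewrite -(peel_dim G1 g11); congr (\dim _); apply/esym/eqP; rewrite eqEsubv capvSl.
  apply/subvP => x xU1; apply/levelP; split=> // u w.
  rewrite !mem_filter => /andP[_ uin] /andP[_ win]; apply: K1 => //.
  have /(peel_span G _ g0)[xU H] := xU1.
  by apply: eqK => //; rewrite !H.
(* [wl] and [wh] take the values (0,0), (1,1), (0,1), (1,0) at [e0], [e1], [y1], [y2]. The height of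
   the square is the center, written as [uh + wl] to make its integrality visible. *)
exists vs', us', (m - e0 - e1), wl, wh, (uh + wl), e0, e1, y1, y2; split=> //.
(* An apex [v] of the rest would be one of [vs]: functionals that are 1 at [v] vanish at [e0] and
   [e1], hence at all generators with center 1, and they agree on the remaining ones. *)
- move=> v; apply/negP => /andP[gv lev]; case/negP: (na v).
  have gv1 := peel_good G1 g11 gv; have gv0 := peel_good G g0 gv1.
  rewrite /apex gv0; apply/subvP => x xU; apply/levelP; split=> // u w uin win uv wv.
  have /vs'P[vin vz] : v \in vs' by case/andP: gv.
  have ue0 z : z \in us -> pairing z v = 1 -> pairing z e0 = 0 /\ pairing z e1 = 0.
    move=> zin zv; split.
      have [//|E'] := good_01 G g0 zin; move: zv; rewrite vz //; last by left.
      by move=> /esym/eqP; rewrite oner_eq0.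
    have [//|E'] := good_01 G g1 zin; move: zv; rewrite vz //; last by right.
    by move=> /esym/eqP; rewrite oner_eq0.
  have us'P z : z \in us -> pairing z v = 1 -> z \in us'.
    move=> zin zv; have [z0 z1] := ue0 z zin zv.
    by rewrite !mem_filter zin z0 z1 eq_sym oner_eq0.
  apply: pairing_eq_span xU => y yin.
  have [u0 u1'] := ue0 u uin uv; have [w0 w1] := ue0 w win wv.
  have [vq|vq] : pairing q y = 1 \/ y \in vs'; last 2 first.
  + by rewrite (q1 y u) // (q1 y w).
  + have /(subvP lev)/levelP[_ H] : y \in <<vs'>>%VS by apply: memv_span.
    by apply: H; rewrite ?us'P.
  have [yK|yK] := boolP (y \in K).
    have [_ _ [z|[z _]]] := type_K y yin yK; last by left.
    by right; apply/vs'P; split=> // u' uin' ue'; apply: q0 ue'.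
  left; have : pairing uh y != pairing ul y by apply: contraNneq yK => ?; apply: eqK => //; apply: memU.
  rewrite neq_lt => /orP[/(type_neg y yin)[]|/(type_pos y yin)[]] t1 t2 t3 t4;
  by rewrite -cen1 ?memU // t2 t3 ?addr0 ?add0r.
- rewrite !pairingBr (gor_height G e0in) (gor_height G e1in).
  by move: E32; rewrite dims natrD; lra.
split=> //.
- by move=> v; rewrite !inE => /or4P[] /eqP ->.
- by move=> v /vs'P[].
- move=> v vin; have [vK|vK] := boolP (v \in K).
    have [t1 t2 [z|[z [[t3 t4]|[t3 t4]]]]] := type_K v vin vK.
    + by right; apply/vs'P; split=> // u' uin' ue'; apply: q0 ue'.
    + left; have -> : v = e0 by apply: uniq_type; rewrite ?t1 ?t2 ?t3 ?t4 ?ule ?uhe ?wl0 ?wh0.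
      exact: mem_head.
    + left; have -> : v = e1 by apply: uniq_type; rewrite ?t1 ?t2 ?t3 ?t4 ?ul1 ?uh1 ?wle ?whe.
      by rewrite !inE eqxx orbT.
  left; have : pairing uh v != pairing ul v by apply: contraNneq vK => ?; apply: eqK => //; apply: memU.
  rewrite neq_lt => /orP[/(type_neg v vin)[]|/(type_pos v vin)[]] t1 t2 t3 t4.
    have qv : pairing q v = 1 by rewrite -cen1 ?memU // t2 t3 add0r.
    have -> : v = y2 by apply: uniq_type; rewrite ?t1 ?t2 ?t3 ?t4.
    by rewrite !inE eqxx !orbT.
  have qv : pairing q v = 1 by rewrite -cen1 ?memU // t2 t3 addr0.
  have -> : v = y1 by apply: uniq_type; rewrite ?t1 ?t2 ?t3 ?t4.
  by rewrite !inE eqxx !orbT.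
- move=> x xU xi; have iu u : u \in us -> pairing u x \is a Num.int.
    by move=> uin; apply: (gor_us_int G).
  by split; rewrite ?pairingDl ?rpredD ?iu.
- by rewrite pairingDl wl0 wh0 uhe addr0.
- by rewrite pairingDl wle whe uh1 add0r.
- by rewrite pairingDl a2 b2 b1 addr0.
- by rewrite pairingDl a4 b4 b3 add0r.
- apply/eqP; rewrite -subr_eq0; apply/eqP.
  have rU : e0 + e1 - (y1 + y2) \in <<vs>>%VS by rewrite memvB // memvD // memU.
  have rE u : pairing u (e0 + e1 - (y1 + y2)) =
      pairing u e0 + pairing u e1 - (pairing u y1 + pairing u y2).
    by rewrite pairingBr !pairingDr.
  have [_ S] : e0 + e1 - (y1 + y2) \in K /\ forall u, u \in us ->
      pairing u e0 = 1 \/ pairing u e1 = 1 -> pairing u (e0 + e1 - (y1 + y2)) = 0.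
    apply: sep => //; rewrite rE.
    - by rewrite ule ul1 a1 a3 addr0 add0r subrr.
    - by rewrite uhe uh1 b1 b3 !addr0 subrr.
    - by rewrite wle wl0 a2 a4 !add0r subrr.
    - by rewrite whe wh0 b2 b4 add0r addr0 subrr.
  apply: (gor_separated G rU) => u uin.
  have [ue0|ue0] := good_01 G g0 uin; last by apply: S => //; left.
  have [ue1|ue1] := good_01 G g1 uin; last by apply: S => //; right.
  by rewrite rE ue0 ue1 (q1 y1 u) // (q1 y2 u) // !addr0 subrr.
- move=> v /vs'P[vin vz].
  by rewrite pairingDl !vz ?addr0 //; by [left|right].
- move=> x xU; have c1 := cen1 x xU; have c2 := cen2 x xU.
  set z := (X in X \in _).
  have zU : z \in <<vs>>%VS.
    by rewrite /z memvB // !memvD // memvZ // memU.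
  have zE u : pairing u z = pairing u x - (pairing wl x * pairing u y2 +
      pairing wh x * pairing u y1 + (pairing uh x + pairing wl x - pairing wl x - pairing wh x) *
      pairing u e0).
    by rewrite /z pairingBr !pairingDr !pairingZr pairingDl.
  apply: spanP => //; apply: (sep z zU _ _ _ _).2; rewrite zE.
  + by rewrite a3 a1 ule; lra.
  + by rewrite b3 b1 uhe; lra.
  + by rewrite a4 a2 wl0; lra.
  + by rewrite b4 b2 wh0; lra.
Qed.
End Squares.

(** * Lattice coordinates on a free join of unit squares *)

Section Charts.
Variable R : realType.

Definition square_point (a b : R) : 'rV[R]_2 := \row_i (if i == 0 then a else b).

(** In the order of [e0], [e1], [y1], [y2] in [square_summand]: one diagonal, then the other. *)
Definition square_vertices : seq 'rV[R]_2 :=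
  [:: square_point 0 0; square_point 1 1; square_point 0 1; square_point 1 0].

Fixpoint join_vertices (k : nat) : seq 'rV[R]_(free_join_dim 2 k) :=
  match k return seq 'rV[R]_(free_join_dim 2 k) with
  | 0 => square_vertices
  | k'.+1 => [seq row_mx (row_mx x (0 : 'rV[R]_2)) (0 : 'rV[R]_1) | x <- join_vertices k'] ++
      [seq row_mx (row_mx (0 : 'rV[R]_(free_join_dim 2 k')) y) (const_mx 1 : 'rV[R]_1)
         | y <- square_vertices]
  end.

(** A linear map that, together with the height, is injective on the span and detects the lattice.
    Only the slice at height 1 matters for the polytope, so injectivity is asked at height 0 and
    integrality at integral heights. *)
Record lattice_chart n d (vs : seq 'rV[R]_n) (h : 'cV[R]_n) (W : seq 'rV[R]_d)
    (A : 'M[R]_(n, d)) : Prop := LatticeChart {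
  chart_sub : forall v, v \in vs -> v *m A \in W;
  chart_onto : forall w, w \in W -> exists2 v, v \in vs & v *m A = w;
  chart_inj : forall x, x \in <<vs>>%VS -> pairing h x = 0 -> x *m A = 0 -> x = 0;
  chart_int : forall x, x \in <<vs>>%VS -> pairing h x \is a Num.int ->
    integral_points R d (x *m A) <-> integral_points R n x }.

Lemma integral_row_mx n1 n2 (x : 'rV[R]_n1) (y : 'rV[R]_n2) :
  integral_points R _ (row_mx x y) <-> integral_points R _ x /\ integral_points R _ y.
Proof.
split=> [H|[Hx Hy] i].
  by split=> i; [have := H (lshift _ i)|have := H (rshift _ i)]; rewrite ?row_mxEl ?row_mxEr.
by rewrite mxE; case: splitP.
Qed.

Lemma integral_const (a : R) : integral_points R 1 (const_mx a) <-> a \is a Num.int.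
Proof. by split=> [/(_ 0)|H i]; rewrite mxE. Qed.

Lemma integral_square_point a b :
  integral_points R 2 (square_point a b) <-> a \is a Num.int /\ b \is a Num.int.
Proof.
split=> [H|[ai bi] i]; last by rewrite mxE; case: ifP.
by split; [have := H 0|have := H 1]; rewrite mxE.
Qed.

Lemma mulmx_pairing n (x : 'rV[R]_n) (u : 'cV[R]_n) : x *m u = const_mx (pairing u x).
Proof. by apply/matrixP => i j; rewrite !ord1 [RHS]mxE. Qed.

Lemma mulmx_rank1 n (x : 'rV[R]_n) (u : 'cV[R]_n) (y : 'rV[R]_n) :
  x *m (u *m y) = pairing u x *: y.
Proof.
rewrite mulmxA mulmx_pairing; apply/matrixP => i j; rewrite !ord1 !mxE big_ord1.
by rewrite !mxE.
Qed.

Definition square_map n (a b : 'cV[R]_n) : 'M[R]_(n, 2) :=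
  \matrix_(i, j) (if j == 0 then a i 0 else b i 0).

Lemma square_mapE n (a b : 'cV[R]_n) x :
  x *m square_map a b = square_point (pairing a x) (pairing b x).
Proof.
apply/rowP => j; rewrite !mxE; case: ifP => jE; rewrite /pairing mxE;
by apply: eq_bigr => i _; rewrite mxE jE.
Qed.

Lemma square_point00 : square_point 0 0 = 0.
Proof. by apply/rowP => i; rewrite !mxE if_same. Qed.

Lemma square_point_eq0 a b : square_point a b = 0 -> a = 0 /\ b = 0.
Proof. by move=> /rowP E; split; [have := E 0|have := E 1]; rewrite !mxE. Qed.

(** Each square contributes its coordinates [a], [b] and, as the join coordinate, its height [H],
    which is 1 on the square and 0 on the rest. The rest is charted by induction after projecting
    along the square with [Pi]. *)
Lemma squares_chart n (vs : seq 'rV[R]_n) us h m k : gor_cone vs us h m ->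
  (forall e, ~~ apex vs us e) -> \dim <<vs>> = (3 * k.+1)%N ->
  3 * pairing h m = 2 * (\dim <<vs>>)%:R ->
  exists A : 'M[R]_(n, free_join_dim 2 k), lattice_chart vs h (join_vertices k) A.
Proof.
elim: k vs us m => [|k IH] vs us m G na dimU E32.
  all: have [|vs' [us' [m' [a [b [H [e0 [e1 [y1 [y2 [G' na' E32' dim' S]]]]]]]]]]] :=
    square_split G na _ E32; first by rewrite dimU.
  all: have [ae0 be0 he0] := sq_e0 S; have [ae1 be1 he1] := sq_e1 S.
  all: have [ay1 by1 hy1] := sq_y1 S; have [ay2 by2 hy2] := sq_y2 S.
  all: have he0' : pairing h e0 = 1 by rewrite (gor_height G) // (sq_block S) // !inE eqxx ?orbT.
  all: have hy1' : pairing h y1 = 1 by rewrite (gor_height G) // (sq_block S) // !inE eqxx ?orbT.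
  all: have hy2' : pairing h y2 = 1 by rewrite (gor_height G) // (sq_block S) // !inE eqxx ?orbT.
  (* One square uses up dimension 3, so the span of the rest is 0. *)
  have sp0 x : x \in <<vs'>>%VS -> x = 0.
    have /eqP -> : <<vs'>>%VS == 0%VS by rewrite -dimv_eq0; apply/eqP; lia.
    by rewrite memv0 => /eqP.
  have xE x : x \in <<vs>>%VS -> x = pairing a x *: y2 + pairing b x *: y1 +
      (pairing H x - pairing a x - pairing b x) *: e0.
    by move=> /(sq_proj S)/sp0/eqP; rewrite subr_eq0 => /eqP.
  have hE x : x \in <<vs>>%VS -> pairing h x = pairing H x.
    by move=> /xE {1}->; rewrite !pairingDr !pairingZr he0' hy1' hy2'; lra.
  exists (square_map a b); split.
  - move=> v /(sq_cover S)[|vin]; last first.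
      have := gor_height G' vin; rewrite (sp0 v (memv_span vin)) pairing0r => /eqP.
      by rewrite eq_sym oner_eq0.
    by rewrite !inE square_mapE => /or4P[] /eqP ->;
      rewrite ?(ae0, be0, ae1, be1, ay1, by1, ay2, by2) eqxx ?orbT.
  - have bl := sq_block S; rewrite /= => w; rewrite !inE => /or4P[] /eqP ->.
    + by exists e0; rewrite ?bl ?inE ?eqxx ?orbT // square_mapE ae0 be0.
    + by exists e1; rewrite ?bl ?inE ?eqxx ?orbT // square_mapE ae1 be1.
    + by exists y1; rewrite ?bl ?inE ?eqxx ?orbT // square_mapE ay1 by1.
    + by exists y2; rewrite ?bl ?inE ?eqxx ?orbT // square_mapE ay2 by2.
  - move=> x xU; rewrite hE // square_mapE => h0 /square_point_eq0[a0 b0].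
    by rewrite (xE x xU) h0 a0 b0 !subr0 !scale0r !addr0.
  - move=> x xU; rewrite hE // square_mapE integral_square_point => Hi.
    split=> [[ai bi]|/(sq_int S xU)[//]].
    have bl v : v \in [:: e0; e1; y1; y2] -> integral_points R n v.
      by move=> /(sq_block S)/(gor_vs_int G).
    rewrite (xE x xU); apply: integralD; first apply: integralD.
    + by apply: integralZ => //; apply: bl; rewrite !inE eqxx ?orbT.
    + by apply: integralZ => //; apply: bl; rewrite !inE eqxx ?orbT.
    + by apply: integralZ; [rewrite !rpredB|apply: bl; rewrite !inE eqxx].
have dimU' : \dim <<vs'>> = (3 * k.+1)%N by lia.
have [A' C] := IH vs' us' m' G' na' dimU' E32'.
pose Pi : 'M[R]_n := 1%:M - (a *m y2 + b *m y1 + (H - a - b) *m e0).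
have PiE x : x *m Pi = x - (pairing a x *: y2 + pairing b x *: y1 +
      (pairing H x - pairing a x - pairing b x) *: e0).
  by rewrite /Pi mulmxBr mulmx1 !mulmxDr !mulmx_rank1 !pairingBl.
pose A : 'M[R]_(n, free_join_dim 2 k.+1) := row_mx (row_mx (Pi *m A') (square_map a b)) H.
have AE x : x *m A = row_mx (row_mx ((x *m Pi) *m A')
    (square_point (pairing a x) (pairing b x))) (const_mx (pairing H x) : 'rV_1).
  by rewrite /A !mul_mx_row mulmxA square_mapE mulmx_pairing.
have PiU x : x \in <<vs>>%VS -> x *m Pi \in <<vs'>>%VS.
  by move=> xU; rewrite PiE; apply: (sq_proj S).
have Pi0 v : v \in [:: e0; e1; y1; y2] -> v *m Pi = 0.
  rewrite !inE PiE => /or4P[] /eqP ->.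
  + by rewrite ae0 be0 he0 !scale0r !add0r !subr0 scale1r subrr.
  + by rewrite ae1 be1 he1 subrr sub0r !scale1r scaleN1r [y2 + y1]addrC -(sq_rel S) addrAC subrr add0r subrr.
  + by rewrite ay1 by1 hy1 !scale0r add0r subr0 subrr scale0r addr0 scale1r subrr.
  + by rewrite ay2 by2 hy2 !scale0r subrr subr0 scale0r !addr0 scale1r subrr.
have Pi1 v : v \in vs' -> v *m Pi = v.
  by move=> /(sq_rest S)[av bv Hv]; rewrite PiE av bv Hv !subr0 !scale0r !addr0 subr0.
have hE x : pairing h x = pairing H x + pairing h (x *m Pi).
  by rewrite PiE pairingBr !pairingDr !pairingZr he0' hy1' hy2'; lra.
have xE x : x = x *m Pi + (pairing a x *: y2 + pairing b x *: y1 +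
      (pairing H x - pairing a x - pairing b x) *: e0) by rewrite PiE subrK.
have block_vertex v p : v \in [:: e0; e1; y1; y2] -> pairing H v = 1 ->
    square_point (pairing a v) (pairing b v) = p ->
    v *m A = row_mx (row_mx 0 p) (const_mx 1 : 'rV_1).
  by move=> vin hv pv; rewrite AE Pi0 // mul0mx hv pv.
have rest_vertex v : v \in vs' -> v *m A = row_mx (row_mx (v *m A') 0) (0 : 'rV_1).
  by move=> vin; have [av bv Hv] := sq_rest S vin; rewrite AE Pi1 // av bv Hv square_point00.
have [m0 m1 m2 m3] : [/\ e0 \in [:: e0; e1; y1; y2], e1 \in [:: e0; e1; y1; y2],
    y1 \in [:: e0; e1; y1; y2] & y2 \in [:: e0; e1; y1; y2]].
  by rewrite !inE !eqxx !orbT.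
exists A; split.
- move=> v /(sq_cover S)[vin|vin]; rewrite mem_cat; apply/orP; last first.
    by left; rewrite rest_vertex //; apply: map_f; apply: (chart_sub C).
  have /or4P v4 : [|| v == e0, v == e1, v == y1 | v == y2] by move: vin; rewrite !inE.
  right; case: v4 => /eqP ->.
  + rewrite (block_vertex e0 (square_point 0 0)) ?ae0 ?be0 //.
    by apply/mapP; exists (square_point 0 0); rewrite // !inE eqxx.
  + rewrite (block_vertex e1 (square_point 1 1)) ?ae1 ?be1 //.
    by apply/mapP; exists (square_point 1 1); rewrite // !inE eqxx ?orbT.
  + rewrite (block_vertex y1 (square_point 0 1)) ?ay1 ?by1 //.
    by apply/mapP; exists (square_point 0 1); rewrite // !inE eqxx ?orbT.
  + rewrite (block_vertex y2 (square_point 1 0)) ?ay2 ?by2 //.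
    by apply/mapP; exists (square_point 1 0); rewrite // !inE eqxx ?orbT.
- move=> w; rewrite mem_cat => /orP[/mapP[x /(chart_onto C)[v vin <-] ->]|/mapP[p pin ->]].
    by exists v; [exact: (sq_sub S) | rewrite rest_vertex].
  move: pin; rewrite !inE => /or4P[] /eqP ->.
  + by exists e0; [exact: (sq_block S) | rewrite (block_vertex e0 _ m0 he0 erefl) ae0 be0].
  + by exists e1; [exact: (sq_block S) | rewrite (block_vertex e1 _ m1 he1 erefl) ae1 be1].
  + by exists y1; [exact: (sq_block S) | rewrite (block_vertex y1 _ m2 hy1 erefl) ay1 by1].
  + by exists y2; [exact: (sq_block S) | rewrite (block_vertex y2 _ m3 hy2 erefl) ay2 by2].
- move=> x xU hx; rewrite AE -[0]row_mx0 => /eq_row_mx[].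
  rewrite -[0]row_mx0 => /eq_row_mx[z0 /square_point_eq0[a0 b0]] /matrixP/(_ 0 0).
  rewrite !mxE => H0; have hz : pairing h (x *m Pi) = 0 by move: hx; rewrite hE H0 add0r.
  by rewrite (xE x) (chart_inj C (PiU x xU) hz z0) H0 a0 b0 !subr0 !scale0r !addr0.
- move=> x xU hx; rewrite AE !integral_row_mx integral_square_point integral_const.
  have bl v : v \in [:: e0; e1; y1; y2] -> integral_points R n v.
    by move=> /(sq_block S)/(gor_vs_int G).
  have hz : pairing H x \is a Num.int -> pairing h (x *m Pi) \is a Num.int.
    have -> : pairing h (x *m Pi) = pairing h x - pairing H x.
      by rewrite (hE x) addrAC subrr add0r.
    by move=> Hi; rewrite rpredB.
  have part : pairing a x \is a Num.int -> pairing b x \is a Num.int ->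
      pairing H x \is a Num.int -> integral_points R n (pairing a x *: y2 + pairing b x *: y1 +
      (pairing H x - pairing a x - pairing b x) *: e0).
    move=> ai bi Hi; apply: integralD; first by apply: integralD; apply: integralZ => //; apply: bl.
    by apply: integralZ; [rewrite !rpredB|apply: bl].
  split=> [[[zi [ai bi]] Hi]|xi].
    rewrite (xE x); apply: integralD; last exact: part.
    by apply/(chart_int C (PiU x xU)); rewrite ?hz.
  have [ai bi Hi] := sq_int S xU xi; split=> //; split=> //.
  apply/(chart_int C (PiU x xU)); first exact: hz.
  by rewrite PiE; apply: integralB => //; apply: part.
Qed.
End Charts.

Local Open Scope classical_set_scope.

(** * Convex hulls *)

Section Hulls.
Variable R : realType.

Definition at_height n (t : R) (x : 'rV[R]_n) : 'rV[R]_(n + 1) :=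
  row_mx x (const_mx t).

Local Notation hom := (at_height 1).

Definition height n : 'cV[R]_(n + 1) := col_mx 0 (const_mx 1).

Lemma pairing_row_col n1 n2 (u : 'cV[R]_n1) (w : 'cV[R]_n2) x y :
  pairing (col_mx u w) (row_mx x y) = pairing u x + pairing w y.
Proof. by rewrite /pairing mul_row_col mxE. Qed.

Lemma pairing_const (a b : R) : pairing (const_mx a : 'cV_1) (const_mx b) = b * a.
Proof. by rewrite /pairing mxE big_ord1 !mxE. Qed.

Lemma pairing_height n t (x : 'rV[R]_n) : pairing (height n) (at_height t x) = t.
Proof. by rewrite /height pairing_row_col pairing0l add0r pairing_const mulr1. Qed.

Lemma at_heightD n s t (x y : 'rV[R]_n) :
  at_height s x + at_height t y = at_height (s + t) (x + y).
Proof. by rewrite /at_height add_row_mx; congr row_mx; apply/rowP => i; rewrite !mxE. Qed.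

Lemma at_heightZ n c t (x : 'rV[R]_n) : c *: at_height t x = at_height (c * t) (c *: x).
Proof. by rewrite /at_height scale_row_mx; congr row_mx; apply/rowP => i; rewrite !mxE. Qed.

Lemma at_heightB n s t (x y : 'rV[R]_n) :
  at_height s x - at_height t y = at_height (s - t) (x - y).
Proof. by rewrite -scaleN1r at_heightZ mulN1r scaleN1r at_heightD. Qed.

Lemma at_height_inj n t : injective (@at_height n t).
Proof. by move=> x y /eq_row_mx[]. Qed.

Lemma at_heightP n (z : 'rV[R]_(n + 1)) :
  exists x, z = at_height (pairing (height n) z) x.
Proof.
exists (lsubmx z); rewrite -{1 2}[z]hsubmxK; congr row_mx.
rewrite /height pairing_row_col pairing0l add0r; apply/rowP => i.
by rewrite !ord1 !mxE /pairing !mxE big_ord1 !mxE mulr1.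
Qed.

Lemma at_height_int n t (x : 'rV[R]_n) :
  integral_points R _ (at_height t x) <-> integral_points R n x /\ t \is a Num.int.
Proof. by rewrite /at_height integral_row_mx integral_const. Qed.

Lemma hom_comb n k (p : 'I_k -> 'rV[R]_n) (a : 'I_k -> R) : \sum_i a i = 1 ->
  hom (\sum_i a i *: p i) = \sum_i a i *: hom (p i).
Proof.
move=> a1; rewrite -[in LHS]a1.
elim/big_rec3: _ => [|i x y z _ <-]; last by rewrite at_heightZ mulr1 at_heightD.
exact: row_mx0.
Qed.

(** The last coordinate of [hom] encodes that the coefficients sum to 1. *)
Lemma convex_hullP n (s : seq 'rV[R]_n) x :
  convex_hull [set` s] x <-> cone (map hom s) (hom x).
Proof.
split=> [[k [p [a [ps a0 a1 ->]]]]|[a [a0 E]]].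
  rewrite hom_comb //; apply: cone_sum => [i _|i _]; first exact: a0.
  by apply/cone_mem/map_f/ps.
move: E; rewrite big_map => E.
exists (size s), (tnth (in_tuple s)), (fun i => a (hom (tnth (in_tuple s) i))).
have a1 : \sum_i a (hom (tnth (in_tuple s) i)) = 1.
  have := congr1 (pairing (height n)) E.
  rewrite pairing_height pairing_sumr big_tnth => E1; apply: etrans (esym E1).
  apply: eq_bigr => i _.
  by rewrite pairingZr pairing_height mulr1.
split=> //; first by move=> i /=; rewrite (tnth_nth x) mem_nth.
by apply: (@at_height_inj _ 1); rewrite E hom_comb // big_tnth.
Qed.

Lemma convex_hull_sub n (B : set 'rV[R]_n) (s : seq 'rV[R]_n) :
  B `<=` convex_hull [set` s] -> convex_hull B `<=` convex_hull [set` s].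
Proof.
move=> H x [k [p [a [ps a0 a1 ->]]]]; apply/convex_hullP; rewrite hom_comb //.
by apply: cone_sum => [i _|i _]; [exact: a0 | apply/convex_hullP/H].
Qed.

Lemma mem_convex_hull n (B : set 'rV[R]_n) x : B x -> convex_hull B x.
Proof.
move=> Bx; exists 1%N, (fun=> x), (fun=> 1); rewrite !big_ord1 scale1r.
by split=> // _; rewrite ler01.
Qed.

Lemma mem_affine_hull n (B : set 'rV[R]_n) x : B x -> affine_hull B x.
Proof.
by move=> Bx; exists 1%N, (fun=> x), (fun=> 1); rewrite !big_ord1 scale1r.
Qed.

Lemma affine_hullP n (s : seq 'rV[R]_n) x :
  affine_hull (convex_hull [set` s]) x <-> hom x \in <<map hom s>>%VS.
Proof.
split=> [[k [p [a [ps a1 ->]]]]|E].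
  rewrite hom_comb // memv_suml // => i _.
  by rewrite memvZ //; apply/cone_span/convex_hullP/ps.
pose t := in_tuple (map hom s).
have := @coord_span _ _ _ t (hom x) E; set a := fun i => coord t i (hom x) => xE.
have /choice[p Hp] : forall i : 'I_(size (map hom s)), exists p, p \in s /\ t`_i = hom p.
  move=> i; have /mapP[p ps pE] : t`_i \in map hom s by apply: mem_nth; exact: ltn_ord.
  by exists p.
have xE' : hom x = \sum_i a i *: hom (p i).
  by rewrite [LHS]xE; apply: eq_bigr => i _; rewrite (Hp i).2.
have a1 : \sum_i a i = 1.
  have := congr1 (pairing (height n)) xE'; rewrite pairing_height pairing_sumr => E1.
  apply: etrans (esym E1).
  by apply: eq_bigr => i _; rewrite pairingZr pairing_height mulr1.
exists _, p, a; split=> //.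
  by move=> i; apply: mem_convex_hull; exact: (Hp i).1.
by apply: (@at_height_inj _ 1); rewrite xE' hom_comb.
Qed.

Definition preserves_combinations n m (f : 'rV[R]_n -> 'rV[R]_m) :=
  forall k (p : 'I_k -> 'rV[R]_n) (a : 'I_k -> R), \sum_i a i = 1 ->
    f (\sum_i a i *: p i) = \sum_i a i *: f (p i).

Lemma hom_mulmx_combinations n m (A : 'M[R]_(n + 1, m)) :
  preserves_combinations (fun x => hom x *m A).
Proof.
move=> k p a a1; rewrite hom_comb // mulmx_suml; apply: eq_bigr => i _.
by rewrite scalemxAl.
Qed.

Lemma image_convex_hull n m (f : 'rV[R]_n -> 'rV[R]_m) B :
  preserves_combinations f -> f @` convex_hull B = convex_hull (f @` B).
Proof.
move=> Hf; apply/seteqP; split=> [_ [x [k [p [a [pB a0 a1 ->]]]] <-]|y].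
  by exists k, (f \o p), a; split=> // [i|]; [exists (p i) | rewrite Hf].
move=> [k [q [a [qB a0 a1 ->]]]].
have /choice[p Hp] : forall i, exists p, B p /\ f p = q i.
  by move=> i; have [p Bp pq] := qB i; exists p.
exists (\sum_i a i *: p i).
  by exists k, p, a; split=> // i; have [] := Hp i.
by rewrite Hf //; apply: eq_bigr => i _; rewrite (Hp i).2.
Qed.

Lemma image_affine_hull n m (f : 'rV[R]_n -> 'rV[R]_m) B :
  preserves_combinations f -> f @` affine_hull B = affine_hull (f @` B).
Proof.
move=> Hf; apply/seteqP; split=> [_ [x [k [p [a [pB a1 ->]]]] <-]|y].
  by exists k, (f \o p), a; split=> // [i|]; [exists (p i) | rewrite Hf].
move=> [k [q [a [qB a1 ->]]]].
have /choice[p Hp] : forall i, exists p, B p /\ f p = q i.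
  by move=> i; have [p Bp pq] := qB i; exists p.
exists (\sum_i a i *: p i).
  by exists k, p, a; split=> // i; have [] := Hp i.
by rewrite Hf //; apply: eq_bigr => i _; rewrite (Hp i).2.
Qed.

Lemma chart_isomorphic n d (s : seq 'rV[R]_n) (W : seq 'rV[R]_d) A :
  lattice_chart (map hom s) (height n) W A ->
  isomorphic (convex_hull [set` s]) (convex_hull [set` W]).
Proof.
move=> C; pose f (x : 'rV[R]_n) := hom x *m A; have Hf := hom_mulmx_combinations A.
have fs : f @` [set` s] = [set` W].
  apply/seteqP; split=> [_ [p ps <-]|w wW].
    by apply: (chart_sub C); apply: map_f.
  by have [_ /mapP[p ps ->] pw] := chart_onto C wW; exists p.
have fP : f @` convex_hull [set` s] = convex_hull [set` W] by rewrite image_convex_hull // fs.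
have fA : f @` affine_hull (convex_hull [set` s]) = affine_hull (convex_hull [set` W]).
  by rewrite image_affine_hull // fP.
exists f; split=> //.
- move=> x y t _ _; rewrite /f !scalemxAl -mulmxDl; congr (_ *m _).
  by rewrite !at_heightZ at_heightD !mulr1 subrK.
- split=> [x Hx|x y|y].
  + by rewrite -fA; exists x.
  + rewrite !inE => /affine_hullP Hx /affine_hullP Hy E; apply: (@at_height_inj _ 1).
    apply/eqP; rewrite -subr_eq0; apply/eqP; apply: (chart_inj C); first exact: memvB.
      by rewrite pairingBr !pairing_height subrr.
    by rewrite mulmxBl; apply/eqP; rewrite subr_eq0; apply/eqP.
  + by rewrite -fA.
- have int x : affine_hull (convex_hull [set` s]) x ->
      integral_points R d (f x) <-> integral_points R n x.
    move=> /affine_hullP xU; have := chart_int C xU.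
    rewrite pairing_height at_height_int => /(_ (rpred1 _)) E.
    by rewrite /f E; split=> [[]|].
  apply/seteqP; split=> [_ [x [xA xi] <-]|y [yA yi]].
    by split; [rewrite -fA; exists x | apply/int].
  by move: yA; rewrite -fA => -[x xA xy]; exists x => //; split=> //; apply/int; rewrite // xy.
Qed.

Lemma free_join_hull n1 n2 (s1 : seq 'rV[R]_n1) (s2 : seq 'rV[R]_n2) :
  free_join (convex_hull [set` s1]) (convex_hull [set` s2]) =
  convex_hull [set` [seq row_mx (row_mx x (0 : 'rV[R]_n2)) (0 : 'rV[R]_1) | x <- s1] ++
    [seq row_mx (row_mx (0 : 'rV[R]_n1) y) (const_mx 1 : 'rV[R]_1) | y <- s2]].
Proof.
pose f (x : 'rV[R]_n1) := row_mx (row_mx x (0 : 'rV[R]_n2)) (0 : 'rV[R]_1).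
pose g (y : 'rV[R]_n2) := row_mx (row_mx (0 : 'rV[R]_n1) y) (const_mx 1 : 'rV[R]_1).
have Hf : preserves_combinations f.
  have fE x : f x = x *m row_mx (row_mx 1%:M 0) 0 by rewrite /f !mul_mx_row mulmx1 !mulmx0.
  move=> k p a _; rewrite fE mulmx_suml; apply: eq_bigr => i _.
  by rewrite fE scalemxAl.
have Hg : preserves_combinations g.
  pose B : 'M[R]_(n2, n1 + n2 + 1) := row_mx (row_mx 0 1%:M) 0.
  have gE y : g y = y *m B + row_mx 0 (const_mx 1).
    by rewrite /g !mul_mx_row mulmx1 !mulmx0 add_row_mx addr0 add0r.
  move=> k p a a1; under [RHS]eq_bigr do rewrite gE scalerDr scalemxAl.
  by rewrite gE big_split /= -scaler_suml a1 scale1r mulmx_suml.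
rewrite /free_join -/f -/g; apply/seteqP; split.
  apply: convex_hull_sub => z [] [x xs <-].
    have : (f @` convex_hull [set` s1]) (f x) by exists x.
    rewrite image_convex_hull //; apply: convex_hull_sub => _ [p ps <-].
    by apply: mem_convex_hull; rewrite /= mem_cat map_f.
  have : (g @` convex_hull [set` s2]) (g x) by exists x.
  rewrite image_convex_hull //; apply: convex_hull_sub => _ [p ps <-].
  by apply: mem_convex_hull; rewrite /= mem_cat orbC map_f.
move=> z [k [p [a [ps a0 a1 zE]]]]; exists k, p, a; split=> // i.
have /= := ps i; rewrite mem_cat => /orP[/mapP[x xs ->]|/mapP[x xs ->]]; [left|right];
by exists x => //; apply: mem_convex_hull.
Qed.

Lemma unit_square_hull : unit_square R = convex_hull [set` square_vertices R].
Proof.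
apply/seteqP; split=> x.
  move=> H; have /andP[a0 a1] := H 0; have /andP[b0 b1] := H 1.
  set a := x 0 0 in a0 a1; set b := x 0 1 in b0 b1.
  have xE : x = square_point a b.
    apply/rowP => i; rewrite !mxE; case: ifP => [/eqP -> //|i0].
    by congr (x _ _); apply/val_inj => /=; case: i i0 => -[|[|]].
  apply/convex_hullP.
  (* Product weights: the two coordinates are 1 with weights [a] and [b], independently. *)
  have -> : hom x = ((1 - a) * (1 - b)) *: hom (square_point 0 0) +
      (a * b) *: hom (square_point 1 1) + ((1 - a) * b) *: hom (square_point 0 1) +
      (a * (1 - b)) *: hom (square_point 1 0).
    rewrite xE !at_heightZ !at_heightD; congr at_height; first by ring.
    by apply/rowP => i; rewrite !mxE; case: ifP => _; ring.
  have mem p : p \in square_vertices R -> cone [seq hom i | i <- square_vertices R] (hom p).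
    by move=> pin; apply/cone_mem/map_f.
  by do 3?apply: coneD; apply: coneZ;
    rewrite ?mulr_ge0 ?subr_ge0 //; apply: mem; rewrite !inE eqxx ?orbT.
move=> [k [p [a [ps a0 a1 ->]]]] i; rewrite summxE.
have b01 j : 0 <= p j 0 i <= 1.
  by have /= := ps j; rewrite !inE => /or4P[] /eqP ->; rewrite mxE; case: ifP => _;
    rewrite ?lexx ?ler01.
apply/andP; split.
  apply: sumr_ge0 => j _; rewrite mxE mulr_ge0 //; by have /andP[] := b01 j.
rewrite -a1; apply: ler_sum => j _; rewrite mxE ler_piMr //; by have /andP[] := b01 j.
Qed.

Lemma free_join_copies_hull k :
  free_join_copiesS (unit_square R) k = convex_hull [set` join_vertices R k].
Proof.
elim: k => [|k IH] /=; first exact: unit_square_hull.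
by rewrite IH unit_square_hull free_join_hull.
Qed.
End Hulls.

Arguments height {R} n.

(** * From Gorenstein polytopes to Gorenstein cones *)

Lemma seq_min (R : realType) (T : eqType) (s : seq T) (f : T -> R) x0 : x0 \in s ->
  exists2 x, x \in s & forall y, y \in s -> f x <= f y.
Proof.
elim: s x0 => // a s IH x0 _; case: s IH => [|b s] IH.
  by exists a; rewrite ?mem_head // => y; rewrite inE => /eqP ->.
have [x xs Hx] := IH b (mem_head _ _).
have [le|lt] := leP (f x) (f a).
  exists x; first by rewrite inE xs orbT.
  by move=> y; rewrite inE => /orP[/eqP -> //|/Hx].
exists a; rewrite ?mem_head // => y; rewrite inE => /orP[/eqP -> //|/Hx le].
exact: le_trans (ltW lt) le.
Qed.

(** * Affine dimension, dilation and integral generators of hulls *)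

Section Dimension.
Variable R : realType.
Local Notation hom := (at_height 1).


Definition lift0 n : 'Hom('rV[R]_n, 'rV[R]_(n + 1)) :=
  linfun (mulmxr (row_mx 1%:M 0)).

Lemma lift0E n x : lift0 n x = at_height 0 x.
Proof.
by rewrite lfunE /= mul_mx_row mulmx1 mulmx0 /at_height; congr row_mx; apply/rowP => i; rewrite !mxE.
Qed.

Lemma has_dim_hull n (s : seq 'rV[R]_n) d : has_dim (convex_hull [set` s]) d ->
  s != [::] -> \dim <<map hom s>> = d.+1.
Proof.
move=> [p [V [affE <-]]] s0.
have affP x : hom x \in <<map hom s>>%VS <-> exists2 v, v \in V & p + v = x.
  have -> : hom x \in <<map hom s>>%VS <-> affine_hull (convex_hull [set` s]) x.
    by split=> /affine_hullP.
  by rewrite affE.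
have pU : hom p \in <<map hom s>>%VS by apply/affP; exists 0; rewrite ?mem0v ?addr0.
have -> : <<map hom s>>%VS = (lift0 n @: V + <[hom p]>)%VS.
  apply/eqP; rewrite eqEsubv; apply/andP; split.
    apply/span_subvP => _ /mapP[q qs ->].
    have /affP[v vV <-] : hom q \in <<map hom s>>%VS by rewrite memv_span // map_f.
    have -> : hom (p + v) = lift0 n v + hom p by rewrite lift0E at_heightD add0r addrC.
    by rewrite memv_add ?memv_img ?memv_line.
  rewrite subv_add -memvE pU andbT; apply/subvP => _ /memv_imgP[v vV ->].
  rewrite lift0E; have -> : at_height 0 v = hom (p + v) - hom p.
    by rewrite at_heightB subrr addrAC subrr add0r.
  by rewrite memvB //; apply/affP; exists v.
rewrite dimv_disjoint_sum ?dim_vline ?limg_dim_eq.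
- case: eqP => [p0|_]; last by rewrite addn1.
  have := congr1 (pairing (height n)) p0; rewrite pairing_height pairing0r => /eqP.
  by rewrite oner_eq0.
- apply/eqP; rewrite -subv0; apply/subvP => x; rewrite memv_cap memv_ker lift0E => /andP[_ /eqP].
  have -> : 0 = at_height 0 (0 : 'rV[R]_n) by rewrite -lift0E linear0.
  by move=> /at_height_inj ->; rewrite mem0v.
- apply/eqP; rewrite -subv0; apply/subvP => x; rewrite memv_cap => /andP[/memv_imgP[v vV ->]].
  move=> /vlineP[k E]; have := congr1 (pairing (height n)) E.
  rewrite lift0E pairing_height pairingZr pairing_height mulr1 => k0.
  by rewrite -lift0E E -k0 scale0r mem0v.
Qed.

Lemma has_dim_hull_exists n (s : seq 'rV[R]_n) : s != [::] ->
  exists d, has_dim (convex_hull [set` s]) d.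
Proof.
case: s => // p s _; set t := p :: s.
have pU : hom p \in <<map hom t>>%VS by rewrite memv_span // map_f ?mem_head.
eexists; exists p, (lift0 n @^-1: <<map hom t>>)%VS; split=> //.
apply/seteqP; split=> x.
  move=> /affine_hullP xU; exists (x - p); last by rewrite addrC subrK.
  rewrite /= -memv_preim lift0E; have -> : at_height 0 (x - p) = hom x - hom p.
    by rewrite at_heightB subrr.
  exact: memvB.
move=> [v /=]; rewrite -memv_preim lift0E => vU <-; apply/affine_hullP.
have -> : hom (p + v) = hom p + at_height 0 v by rewrite at_heightD addr0.
exact: memvD.
Qed.

Lemma aff_dim_hull n (s : seq 'rV[R]_n) : s != [::] ->
  \dim <<map hom s>> = (aff_dim (convex_hull [set` s])).+1.
Proof.
move=> s0; apply: has_dim_hull => //; have [d Hd] := has_dim_hull_exists s0.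
by rewrite /aff_dim; case: xgetP => // H; case: (H d).
Qed.

Lemma dilate_hull n r (s : seq 'rV[R]_n) :
  dilate r (convex_hull [set` s]) = convex_hull [set` map ( *:%R r%:R) s].
Proof.
rewrite /dilate image_convex_hull; last first.
  by move=> k p a _; rewrite scaler_sumr; apply: eq_bigr => i _; rewrite !scalerA mulrC.
by congr convex_hull; apply/seteqP; split=> [_ [x xs <-]|x /mapP[y ys ->]]; [exact: map_f|exists y].
Qed.

Lemma aff_dim_dilate n r (s : seq 'rV[R]_n) : (0 < r)%N -> s != [::] ->
  aff_dim (dilate r (convex_hull [set` s])) = aff_dim (convex_hull [set` s]).
Proof.
move=> r0 s0; have [d Hd] := has_dim_hull_exists s0.
have r0' : r%:R != 0 :> R by rewrite pnatr_eq0 -lt0n.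
have Hd' : has_dim (dilate r (convex_hull [set` s])) d.
  have [p [V [affE dV]]] := Hd; exists (r%:R *: p), V; split=> //.
  rewrite /dilate -image_affine_hull ?affE; last first.
    by move=> k q a _; rewrite scaler_sumr; apply: eq_bigr => i _; rewrite !scalerA mulrC.
  apply/seteqP; split=> [_ [_ [v vV <-] <-]|_ [v vV <-]].
    by exists (r%:R *: v); [exact: memvZ|rewrite scalerDr].
  exists (p + r%:R^-1 *: v); first by exists (r%:R^-1 *: v) => //; exact: memvZ.
  by rewrite scalerDr scalerA divff // scale1r.
apply: succn_inj; rewrite -(aff_dim_hull s0) (has_dim_hull Hd s0).
rewrite dilate_hull in Hd' *; have s0' : map ( *:%R r%:R) s != [::] by case: (s) s0.
by rewrite -(aff_dim_hull s0') (has_dim_hull Hd' s0').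
Qed.

(** The topology in [relint] enters only here: a segment ending in a relative interior point can be
    prolonged within the set. *)
Lemma relint_extend n (A : set 'rV[R]_n) x p : relint A x -> A p ->
  exists2 e : R, 0 < e & A (x + e *: (x - p)).
Proof.
move=> [Ax Hx] Ap.
have [e e0 He] := (nbhs_ballP _ _).1 Hx.
have [d d0 Hd] := small_eps (enum 'I_n) (fun i => (x - p) 0 i).
have de : 0 < d * (e / 2) by rewrite mulr_gt0 // divr_gt0.
(* [d] bounds the entries of [d *: (x - p)] by 1, and halving [e] makes the distance strictly
   smaller than [e]. *)
exists (d * (e / 2)) => //; apply: He.
  split=> // i j; rewrite !ord1 -ball_normE /= !mxE opprD addrA subrr sub0r normrN.
  have := Hd j (mem_enum _ _); rewrite !mxE normrM gtr0_norm // => H.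
  have : d * `|x 0 j - p 0 j| * (e / 2) <= 1 * (e / 2) by rewrite ler_wpM2r // divr_ge0 // ltW.
  have e2 : e / 2 < e by rewrite ltr_pdivrMr // ltr_pMr // ltr1n.
  by rewrite mul1r mulrAC => /le_lt_trans; apply.
exists 2%N, (fun i : 'I_2 => if i == 0 then x else p),
  (fun i : 'I_2 => if i == 0 then 1 + d * (e / 2) else - (d * (e / 2))).
rewrite !big_ord_recl !big_ord0 /= !addr0; split.
- by move=> i; case: ifP.
- by rewrite addrK.
- by rewrite scalerDl scale1r scalerBr scaleNr addrA.
Qed.

(** Generators that are not vertices are dropped until all are vertices, hence integral. Farkas
    decides: a generator outside the cone of the others is cut off by a functional that exhibits it
    as a vertex. *)
Lemma lattice_polytope_hull n (P : set 'rV[R]_n) : lattice_polytope P ->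
  exists s : seq 'rV[R]_n, [/\ P = convex_hull [set` s], s != [::] &
    forall p, p \in s -> integral_points R n p].
Proof.
move=> [[P0 [s PE]] Hv]; have [k] := ubnP (size s); elim: k s PE => // k IH s PE szk.
have [H|] := pselect (forall p, p \in s -> vertex P p).
  exists s; split=> // [|p /H/Hv //].
  apply: contra_notN (_ : ~ s = [::]) => [/eqP //|s0].
  by case: P0 => x; rewrite PE s0 => -[[|j] [p [a [ps a0 a1 _]]]];
    [move: a1; rewrite big_ord0 => /eqP; rewrite eq_sym oner_eq0|have := ps ord0].
move=> /existsNP[p /not_implyP[ps nv]].
pose s' := [seq q <- s | q != p].
have s's : {subset s' <= s} by move=> q; rewrite mem_filter => /andP[].
have mem_s q : q \in s -> q = p \/ q \in s'.
  by move=> qs; have [->|qp] := eqVneq q p; [left|right; rewrite mem_filter qp].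
have [cp|[u [us' up]]] := farkas (map hom s') (hom p).
  apply: (IH s').
    rewrite PE; apply/seteqP; split; apply: convex_hull_sub => q /= qs.
      by have [->|qs'] := mem_s q qs; [apply/convex_hullP|apply: mem_convex_hull].
    by apply/mem_convex_hull/s's.
  suff lt : (size s' < size s)%N by exact: leq_trans lt szk.
  rewrite size_filter -(count_predC (fun q => q != p) s).
  rewrite -[X in (X < _)%N]addn0 ltn_add2l -has_count; apply/hasP; exists p => //=.
  by rewrite negbK eqxx.
case: nv; split; first by exists p.
(* Since u(hom p) < 0 <= u at the other generators, this shift by a multiple of the height vanishes
   at [hom p] and is positive at the others. *)
pose u' := u - pairing u (hom p) *: height n.
have u'E x : pairing u' (hom x) = pairing u (hom x) - pairing u (hom p).
  by rewrite pairingBl pairingZl pairing_height mulr1.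
have u'0 v : v \in map hom s -> 0 <= pairing u' v.
  move=> /mapP[q /mem_s[->|qs] ->]; rewrite u'E; first by rewrite subrr.
  by rewrite subr_ge0 (le_trans (ltW up)) // us' // map_f.
have u'eq0 x : P x -> pairing u' (hom x) = 0 -> x = p.
  rewrite PE => /convex_hullP xc x0.
  have /cone_span : cone [seq v <- map hom s | all (fun w : 'cV[R]_(n + 1) => pairing w v == 0%R) [:: u']] (hom x).
    apply: (cone_face _ xc) => [w v|w]; rewrite inE => /eqP -> //; exact: u'0.
  have sub : (<<[seq v <- map hom s | all (fun w : 'cV[R]_(n + 1) => pairing w v == 0%R) [:: u']]>> <= <[hom p]>)%VS.
    apply/span_subvP => v; rewrite mem_filter /= andbT => /andP[/eqP v0 /mapP[q /mem_s[->|qs] vE]].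
      by rewrite vE memv_line.
    have : 0 < pairing u' v.
      by rewrite vE u'E subr_gt0 (lt_le_trans up) // us' // map_f.
    by rewrite v0 ltxx.
  move=> /(subvP sub)/vlineP[c E]; have := congr1 (pairing (height n)) E.
  rewrite pairing_height pairingZr pairing_height mulr1 => c1.
  by move: E; rewrite -c1 scale1r => /at_height_inj.
have split_u x : pairing u' (hom x) = pairing (usubmx u') x + dsubmx u' 0 0.
  rewrite -{1}[u']vsubmxK pairing_row_col; congr (_ + _).
  by rewrite /pairing mxE big_ord1 !mxE mul1r.
exists (- usubmx u'), (dsubmx u' 0 0); split.
  move=> x; rewrite PE => /convex_hullP/(cone_pairing_ge0 u'0).
  by rewrite split_u pairingNl; lra.
apply/seteqP; split=> [x ->|x [xP E]].
  split; first by rewrite PE; apply: mem_convex_hull.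
  by have := u'E p; rewrite subrr split_u pairingNl; lra.
move: E; rewrite pairingNl => E.
have z : pairing u' (hom x) = 0 by rewrite split_u; lra.
exact: (u'eq0 x xP z).
Qed.
End Dimension.

(** * Facet functionals of a cone *)

Section Facets.
Variables (R : realType) (n : nat).
Implicit Types (u w : 'cV[R]_n) (x y v m : 'rV[R]_n) (vs : seq 'rV[R]_n).

(** Relative interior of the cone in algebraic form, free of topology. *)
Definition interior_of vs m :=
  forall v, v \in vs -> exists2 e : R, 0 < e & cone vs (m - e *: v).

Definition zeros vs u : seq 'rV[R]_n := [seq v <- vs | pairing u v == 0].

Lemma interior_of_eq0 vs m w : interior_of vs m ->
  (forall v, v \in vs -> 0 <= pairing w v) -> pairing w m <= 0 ->
  forall v, v \in vs -> pairing w v = 0.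
Proof.
move=> I w0 wm v vin; apply/le_anti; rewrite w0 // andbT; have [e e0 c] := I v vin.
have := cone_pairing_ge0 w0 c; rewrite pairingBr pairingZr => ge0.
by rewrite -(pmulr_rle0 _ e0); lra.
Qed.

(* Rotating a separating functional about its zero set until the zero set
   spans a hyperplane. *)
Lemma facet_separation vs m x u : interior_of vs m -> m \in <<vs>>%VS ->
  x \in <<vs>>%VS -> (forall v, v \in vs -> 0 <= pairing u v) -> pairing u x < 0 ->
  exists w, [/\ forall v, v \in vs -> 0 <= pairing w v, pairing w x < 0 &
    (\dim <<zeros vs w>>).+1 = \dim <<vs>>].
Proof.
move=> I mU xU; have [k] := ubnP (\dim <<vs>> - \dim <<zeros vs u>>).
elim: k u => // k IH u szk u0 ux.
have Z0 y : y \in <<zeros vs u>>%VS -> pairing u y = 0.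
  by apply: pairing_span => v; rewrite mem_filter => /andP[/eqP].
have um : 0 < pairing u m.
  rewrite ltNge; apply/negP => um; have := interior_of_eq0 I u0 um.
  by move=> /pairing_span/(_ _ xU) ux0; rewrite ux0 ltxx in ux.
have mZ : m \notin <<zeros vs u>>%VS by apply/negP => /Z0 um0; rewrite um0 ltxx in um.
have sZ : (<<zeros vs u>> <= <<vs>>)%VS.
  by apply: sub_span => v; rewrite mem_filter => /andP[].
have dimZm : \dim <<m :: zeros vs u>> = (\dim <<zeros vs u>>).+1.
  rewrite span_cons dimv_disjoint_sum ?dim_vline.
    by case: eqP mZ => [->|_ _]; rewrite ?mem0v.
  apply/eqP; rewrite -subv0; apply/subvP => y; rewrite memv_cap => /andP[/vlineP[c ->] /Z0].
  rewrite pairingZr => /eqP; rewrite mulf_eq0 (gt_eqF um) orbF => /eqP ->.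
  by rewrite scale0r mem0v.
have sZm : (<<m :: zeros vs u>> <= <<vs>>)%VS by rewrite span_cons subv_add -memvE mU.
have [E|nE] := eqVneq (\dim <<zeros vs u>>).+1 (\dim <<vs>>); first by exists u.
have [v vin vZ] : exists2 v, v \in vs & v \notin <<m :: zeros vs u>>%VS.
  apply/hasP; rewrite -[has _ _]negbK -all_predC; apply/negP => /allP H.
  case/negP: nE; rewrite -dimZm; apply/eqP/eqP; rewrite eqn_leq !dimvS //.
  by apply/span_subvP => y /H; rewrite /= negbK.
(* The direction of rotation. Vanishing at the interior point [m] without being zero forces [w] to
   be negative at some generator; the sign with w(x) <= 0 keeps [x] separated. *)
have [w [wZ wv wx]] : exists w, [/\ forall y, y \in <<m :: zeros vs u>>%VS -> pairing w y = 0,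
    pairing w v != 0 & pairing w x <= 0].
  have [w [wZ wv]] := pairing_separates vZ.
  have [wx|wx] := leP (pairing w x) 0; first by exists w.
  exists (- w); split; rewrite ?pairingNl ?oppr_eq0 ?oppr_le0 ?ltW //.
  by move=> y /wZ yw; rewrite pairingNl yw oppr0.
have wm : pairing w m = 0 by apply: wZ; rewrite memv_span ?mem_head.
have wZ' y : y \in <<zeros vs u>>%VS -> pairing w y = 0.
  by move=> yin; apply: wZ; rewrite span_cons (subvP (addvSr _ _)).
have [v0 v0neg] : exists v, v \in [seq v <- vs | pairing w v < 0].
  have [/hasP[y yin wy]|/hasPn H] := boolP (has (fun v => pairing w v < 0) vs).
    by exists y; rewrite mem_filter wy.
  have w0 y : y \in vs -> 0 <= pairing w y by move=> /H; rewrite -leNgt.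
  have wm0 : pairing w m <= 0 by rewrite wm.
  by have := interior_of_eq0 I w0 wm0 vin => E; rewrite E eqxx in wv.
have [v1 v1neg v1min] := seq_min (fun v => pairing u v / - pairing w v) v0neg.
move: v1neg; rewrite mem_filter => /andP[wv1 v1in].
(* The largest multiple of [w] that keeps all generators >= 0; at this moment [v1] joins the zero
   set. *)
pose t := pairing u v1 / - pairing w v1.
have t0 : 0 <= t by rewrite /t divr_ge0 ?u0 // oppr_ge0 ltW.
pose u' := u + t *: w.
have u'E y : pairing u' y = pairing u y + t * pairing w y by rewrite pairingDl pairingZl.
have u'0 y : y \in vs -> 0 <= pairing u' y.
  move=> yin; rewrite u'E; have [wy|wy] := ltP (pairing w y) 0; last first.
    by rewrite addr_ge0 ?u0 // mulr_ge0.
  have := v1min y; rewrite mem_filter wy yin -/t => /(_ isT).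
  by rewrite ler_pdivlMr ?oppr_gt0 // mulrN; lra.
have u'x : pairing u' x < 0.
  rewrite u'E; have : t * pairing w x <= 0 by rewrite mulr_ge0_le0.
  lra.
apply: (IH u') => //.
have u'v1 : pairing u' v1 = 0.
  by rewrite u'E /t invrN mulrN mulNr divfK ?subrr // lt_eqF.
have lt : (\dim <<zeros vs u>> < \dim <<zeros vs u'>>)%N.
  have sub : (<<zeros vs u>> <= <<zeros vs u'>>)%VS.
    apply/span_subvP => y yin; apply: memv_span; move: (yin); rewrite !mem_filter => /andP[/eqP uy ->].
    by rewrite u'E uy wZ' ?memv_span // mulr0 addr0 eqxx.
  rewrite ltn_neqAle dimvS // andbT; apply/negP => /eqP dE.
  have /eqP E : <<zeros vs u>>%VS == <<zeros vs u'>>%VS by rewrite eqEdim sub dE /=.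
  have : v1 \in <<zeros vs u>>%VS by rewrite E memv_span // mem_filter u'v1 eqxx.
  by move/wZ' => w0; rewrite w0 ltxx in wv1.
have le : (\dim <<zeros vs u'>> <= \dim <<vs>>)%N.
  by apply/dimvS/sub_span => y; rewrite mem_filter => /andP[].
by move: szk lt le; move: (\dim _) (\dim <<zeros vs u>>) (\dim <<zeros vs u'>>) => a b c; clear; lia.
Qed.

(** Gathers facet functionals into a finite list, one for each sublist of generators that has one,
    although having one is only a proposition. *)
Lemma finite_choice (S T : eqType) (l : seq S) (Q : S -> T -> Prop) :
  exists ts : seq T, (forall t, t \in ts -> exists2 z, z \in l & Q z t) /\
    forall z, z \in l -> (exists t, Q z t) -> exists2 t, t \in ts & Q z t.
Proof.
elim: l => [|z l [ts [H1 H2]]]; first by exists [::].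
have [[t Ht]|nt] := pselect (exists t, Q z t).
  exists (t :: ts); split=> [t'|z'].
    rewrite inE => /orP[/eqP ->|/H1[z' zl Hz]]; first by exists z; rewrite ?mem_head.
    by exists z'; rewrite // inE zl orbT.
  rewrite inE => /orP[/eqP -> _|zl /(H2 _ zl)[t' tin Ht']].
    by exists t; rewrite ?mem_head.
  by exists t'; rewrite // inE tin orbT.
exists ts; split=> [t /H1[z' zl Hz]|z'].
  by exists z'; rewrite // inE zl orbT.
by rewrite inE => /orP[/eqP ->|/H2].
Qed.

Lemma hyperplane_proportional (zs vs : seq 'rV[R]_n) m u w x :
  {subset zs <= vs} -> (\dim <<zs>>).+1 = \dim <<vs>> -> m \in <<vs>>%VS ->
  (forall z, z \in zs -> pairing u z = 0) -> (forall z, z \in zs -> pairing w z = 0) ->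
  pairing u m = 1 -> x \in <<vs>>%VS -> pairing w x = pairing u x * pairing w m.
Proof.
move=> sub dimz mU uz wz um xU.
have sU : (<<zs>> <= <<vs>>)%VS by apply: sub_span.
have mz : m \notin <<zs>>%VS.
  by apply/negP => /(pairing_span uz); rewrite um => /eqP; rewrite oner_eq0.
have E : <<vs>>%VS = (<<zs>> + <[m]>)%VS.
  apply/esym/eqP; rewrite eqEdim subv_add sU -memvE mU /= -dimz dimv_disjoint_sum ?dim_vline.
    by case: eqP mz => [->|_ _]; rewrite ?mem0v // addn1.
  apply/eqP; rewrite -subv0; apply/subvP => y; rewrite memv_cap => /andP[/(pairing_span uz) uy].
  by move=> /vlineP[c yE]; move: uy; rewrite yE pairingZr um mulr1 => ->; rewrite scale0r mem0v.
move: xU; rewrite E => /memv_addP[z zin [_ /vlineP[c ->] ->]].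
by rewrite !pairingDr !pairingZr (pairing_span uz zin) (pairing_span wz zin) um; ring.
Qed.
End Facets.

(** * The cone over a Gorenstein polytope *)

Section GorensteinCone.
Variable R : realType.
Local Notation hom := (at_height 1).

Lemma dilate_cone n q (s : seq 'rV[R]_n) x : dilate q (convex_hull [set` s]) x ->
  cone (map hom s) (at_height q%:R x).
Proof.
move=> [y /convex_hullP yc <-].
have -> : at_height q%:R (q%:R *: y) = q%:R *: hom y by rewrite at_heightZ mulr1.
exact: coneZ.
Qed.

Lemma relint_interior n q (s : seq 'rV[R]_n) x : (0 < q)%N ->
  relint (dilate q (convex_hull [set` s])) x -> interior_of (map hom s) (at_height q%:R x).
Proof.
move=> q0 Hx _ /mapP[p ps ->].
have [|e e0 /dilate_cone c] := relint_extend Hx (_ : _ (q%:R *: p)).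
  by exists p => //; apply: mem_convex_hull.
have q0' : 0 < q%:R :> R by rewrite ltr0n.
have e1 : 0 < 1 + e by rewrite ltr_wpDl.
(* The prolonged point lies in the cone; dividing it by 1 + e gives [x] minus a positive multiple of
   [p], all at the level of the cone. *)
exists ((1 + e)^-1 * (e * q%:R)); first by rewrite mulr_gt0 ?invr_gt0 // mulr_gt0.
have -> : at_height q%:R x - (1 + e)^-1 * (e * q%:R) *: hom p =
    (1 + e)^-1 *: at_height q%:R (x + e *: (x - q%:R *: p)).
  rewrite !at_heightZ at_heightB; congr at_height.
    by field; rewrite gt_eqF.
  apply/rowP => i; rewrite !mxE; field; by rewrite gt_eqF.
by apply: coneZ c; rewrite invr_ge0 ltW.
Qed.

(** From u(f) - u(m) = 1 on a facet of the dilate, which sits at height r, the affine function 1 +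
    u(m) - u is 0 on the facet and 1 at [m]; made homogeneous, it is the functional wanted. *)
Lemma gorenstein_cone n (s : seq 'rV[R]_n) r m : s != [::] ->
  (forall p, p \in s -> integral_points R n p) -> (0 < r)%N ->
  (0 < aff_dim (convex_hull [set` s]))%N ->
  relint (dilate r (convex_hull [set` s])) m -> integral_points R n m ->
  (forall F, facet (dilate r (convex_hull [set` s])) F ->
     exists u, integral_functional (dilate r (convex_hull [set` s])) u /\
       forall f, F f -> pairing u f - pairing u m = 1) ->
  exists us, gor_cone (map hom s) us (height n) (at_height r%:R m).
Proof.
move=> s0 sint r0 dim0 mrel mint Hfacet; set vs := map hom s; set mh := at_height r%:R m.
set P := convex_hull [set` s] in dim0 mrel Hfacet.
have I : interior_of vs mh by apply: relint_interior.
have mcone : cone vs mh by apply: dilate_cone; case: mrel.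
have mU : mh \in <<vs>>%VS := cone_span mcone.
have r0' : r%:R != 0 :> R by rewrite pnatr_eq0 -lt0n.
pose facet_functional zs (u : 'cV[R]_(n + 1)) :=
  [/\ {subset zs <= vs}, (\dim <<zs>>).+1 = \dim <<vs>>,
      forall z, z \in zs -> pairing u z = 0, pairing u mh = 1 &
      (forall v, v \in vs -> 0 <= pairing u v) /\
      (forall x, x \in <<vs>>%VS -> integral_points R _ x -> pairing u x \is a Num.int)].
have exf w : (forall v, v \in vs -> 0 <= pairing w v) ->
    (\dim <<zeros vs w>>).+1 = \dim <<vs>> -> exists u, facet_functional (zeros vs w) u.
  move=> w0 dimw.
  pose t := [seq p <- s | pairing w (hom p) == 0].
  have tE : zeros vs w = map hom t by rewrite /zeros /vs filter_map.
  have dimU := aff_dim_hull s0; rewrite -/vs -/P in dimU.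
  (* An empty zero set would make the span one-dimensional and the polytope a point, against
     [dim0]. *)
  have t0 : t != [::].
    apply/eqP => t0; move: dimw; rewrite tE t0 /= span_nil dimv0 dimU => -[E].
    by rewrite -E in dim0.
  have dimF : (aff_dim (convex_hull [set` t])).+1 = aff_dim P.
    by apply: succn_inj; rewrite -dimU -dimw tE (aff_dim_hull t0).
  have ts p : p \in t -> p \in s by rewrite mem_filter => /andP[].
  pose F := dilate r (convex_hull [set` t]).
  have split_w (x : 'rV[R]_n) : pairing w (hom x) = pairing (usubmx w) x + dsubmx w 0 0.
    rewrite -{1}[w]vsubmxK pairing_row_col; congr (_ + _).
    by rewrite /pairing mxE big_ord1 !mxE mul1r.
  have [u [uint uF]] : exists u, integral_functional (dilate r P) u /\
       forall f, F f -> pairing u f - pairing u m = 1.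
    apply: Hfacet; split; last first.
      by rewrite /F !aff_dim_dilate ?dimF.
    split.
      have [p pt] : exists p, p \in t by case: (t) t0 => // p ? _; exists p; rewrite mem_head.
      by exists (r%:R *: p); exists p => //; apply: mem_convex_hull.
    exists (- usubmx w), (r%:R * dsubmx w 0 0); split.
      move=> _ [x /convex_hullP/(cone_pairing_ge0 w0) + <-].
      rewrite split_w pairingNl pairingZr -mulrN ler_pM2l ?ltr0n //; lra.
    apply/seteqP; split=> [_ [x xt <-]|_ [[x xP <-] E]].
      have xt' := (convex_hullP _ _).1 xt.
      have xP : P x.
        apply/convex_hullP; apply: cone_sub xt' => _ /mapP[p /ts ps ->]; exact: map_f.
      split; first by exists x.
      have wx : pairing w (hom x) = 0.
        apply: pairing_span (cone_span xt') => _ /mapP[p + ->].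
        by rewrite mem_filter => /andP[/eqP].
      by rewrite pairingNl pairingZr -mulrN; congr (_ * _); move: wx; rewrite split_w; lra.
    exists x => //; apply/convex_hullP; rewrite -tE.
    have wx : pairing w (hom x) = 0.
      rewrite split_w; move: E; rewrite pairingNl pairingZr -mulrN => /(mulfI r0'); lra.
    have c : cone [seq v <- vs | all (fun u : 'cV[R]_(n + 1) => pairing u v == 0) [:: w]] (hom x).
      apply: cone_face (_ : cone vs (hom x)) _ => [u v|/=|u].
      - by rewrite inE => /eqP ->; exact: w0.
      - exact/convex_hullP.
      - by rewrite inE => /eqP ->.
    by apply: cone_sub c => v; rewrite !mem_filter /= andbT.
  pose k := (1 + pairing u m) / r%:R.
  pose uh : 'cV[R]_(n + 1) := col_mx (- u) (const_mx k).
  have uhE a (x : 'rV[R]_n) : pairing uh (at_height a x) = a * k - pairing u x.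
    by rewrite pairing_row_col pairingNl pairing_const addrC.
  have kr : r%:R * k = 1 + pairing u m by rewrite /k mulrC divfK.
  have uhm : pairing uh mh = 1 by rewrite uhE kr addrK.
  have uhz z : z \in zeros vs w -> pairing uh z = 0.
    rewrite tE => /mapP[p pt ->]; rewrite uhE mul1r.
    have /uF : F (r%:R *: p) by exists p => //; apply: mem_convex_hull.
    rewrite pairingZr => E; apply: (mulfI r0'); rewrite mulrBr kr; lra.
  have subz : {subset zeros vs w <= vs} by move=> z; rewrite mem_filter => /andP[].
  have wz z : z \in zeros vs w -> pairing w z = 0 by rewrite mem_filter => /andP[/eqP].
  have prop x : x \in <<vs>>%VS -> pairing w x = pairing uh x * pairing w mh.
    by apply: (hyperplane_proportional subz dimw).
  have wm : 0 < pairing w mh.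
    rewrite ltNge; apply/negP => wm; have wvs := interior_of_eq0 I w0 wm.
    have : zeros vs w = vs by apply/all_filterP/allP => v /wvs ->.
    by move=> E; move: dimw; rewrite E => /eqP; rewrite eqn_leq ltnn.
  exists uh; split=> //; split=> [v vin|x xU xint].
    by rewrite -(pmulr_lge0 _ wm) -prop ?memv_span // w0.
  have [p pt] : exists p, p \in t by case: (t) t0 => // p ? _; exists p; rewrite mem_head.
  have ps := ts p pt.
  have uhp : pairing uh (hom p) = 0 by apply: uhz; rewrite tE map_f.
  have affm y : at_height r%:R y \in <<vs>>%VS -> integral_points R n y ->
      affine_lattice (dilate r P) y.
    move=> yU yi; split=> //; rewrite /dilate -image_affine_hull; last first.
      by move=> j q a _; rewrite scaler_sumr; apply: eq_bigr => i _; rewrite !scalerA mulrC.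
    exists (r%:R^-1 *: y); last by rewrite scalerA divff // scale1r.
    apply/affine_hullP; have -> : hom (r%:R^-1 *: y) = r%:R^-1 *: at_height r%:R y.
      by rewrite at_heightZ mulVf.
    exact: memvZ.
  have [y xE] := at_heightP x; set a := pairing _ x in xE.
  have [yi ai] : integral_points R n y /\ a \is a Num.int by apply/at_height_int; rewrite -xE.
  have pU : hom p \in <<vs>>%VS by rewrite memv_span // map_f.
  (* Reflexivity controls [u] only on lattice points at height r. Adding an integral multiple of
     [hom p], where [uh] vanishes, moves [x] to that height without changing [uh]. *)
  pose y' := y + (r%:R - a) *: p.
  have y'E : at_height r%:R y' = x + (r%:R - a) *: hom p.
    by rewrite xE at_heightZ at_heightD; congr at_height; ring.
  have y'aff : affine_lattice (dilate r P) y'.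
    apply: affm; first by rewrite y'E memvD // memvZ.
    by apply: integralD => //; apply: integralZ; [rewrite rpredB // rpred_nat|exact: sint].
  have maff : affine_lattice (dilate r P) m by apply: affm.
  have := uint _ _ y'aff maff.
  have -> : pairing u y' - pairing u m = 1 - pairing uh x.
    have : pairing uh (at_height r%:R y') = pairing uh x.
      by rewrite y'E pairingDr pairingZr uhp mulr0 addr0.
    by rewrite uhE kr => <-; ring.
  by move=> H; have := rpredB (rpred1 _) H; rewrite opprB addrC subrK.
pose subsets := [seq mask (tval t) vs | t : (size vs).-tuple bool].
have [us [usl usc]] := finite_choice subsets facet_functional.
exists us; split.
- by move=> _ /mapP[p ps ->]; apply/at_height_int; split; [exact: sint|exact: rpred1].
- by move=> _ /mapP[p ps ->]; rewrite pairing_height.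
- by move=> u x /usl[zs _ [_ _ _ _ [_ H]]]; apply: H.
- by move=> u v /usl[zs _ [_ _ _ _ [H _]]]; apply: H.
- move=> x xU Hu; have [//|[u [u0 ux]]] := farkas vs x.
  have [w [w0 wx dimw]] := facet_separation I mU xU u0 ux.
  have zin : zeros vs w \in subsets.
    rewrite /zeros filter_mask; have sz : size [seq pairing w v == 0 | v <- vs] == size vs.
      by rewrite size_map.
    by apply/mapP; exists (Tuple sz); rewrite // mem_enum.
  have [u' u'in [subz _ u'z u'm _]] := usc _ zin (exf w w0 dimw).
  have wz z : z \in zeros vs w -> pairing w z = 0 by rewrite mem_filter => /andP[/eqP].
  have prop := hyperplane_proportional subz dimw mU u'z wz u'm xU.
  have : 0 <= pairing w x.
    by rewrite prop mulr_ge0 ?Hu // (cone_pairing_ge0 w0).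
  by rewrite leNgt wx.
- exact: mU.
- by apply/at_height_int; split=> //; exact: rpred_nat.
- by move=> u /usl[zs _ []].
Qed.
End GorensteinCone.

(** * Lattice pyramids *)

Section LatticeBasis.
Variable R : realType.

Lemma span_rows k n (M : 'M[R]_(k, n)) x :
  x \in <<[seq row i M | i <- enum 'I_k]>>%VS <-> exists y, x = y *m M.
Proof.
split=> [|[y ->]]; last first.
  rewrite mulmx_sum_row memv_suml // => i _; rewrite memvZ // memv_span //.
  by apply/mapP; exists i; rewrite ?mem_enum.
have -> : (<<[seq row i M | i <- enum 'I_k]>> = linfun (mulmxr M : 'rV_k -> 'rV_n) @: fullv)%VS.
  apply/eqP; rewrite eqEsubv; apply/andP; split.
    apply/span_subvP => _ /mapP[i _ ->]; rewrite rowE.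
    by have := memv_img (linfun (mulmxr M : 'rV_k -> 'rV_n)) (memvf (delta_mx 0 i)); rewrite lfunE.
  apply/subvP => _ /memv_imgP[y _ ->]; rewrite lfunE /= mulmx_sum_row memv_suml // => i _.
  by rewrite memvZ // memv_span //; apply/mapP; exists i; rewrite ?mem_enum.
by move=> /memv_imgP[y _ ->]; exists y; rewrite lfunE.
Qed.

Definition integral_mx k n (M : 'M[R]_(k, n)) := forall i j, M i j \is a Num.int.

Lemma integral_mulmx k n (M : 'M[R]_(k, n)) x : integral_mx M ->
  integral_points R k x -> integral_points R n (x *m M).
Proof. by move=> HM Hx i; rewrite mxE rpred_sum // => j _; rewrite rpredM. Qed.

(* If L D Q is the Smith normal form of the matrix with rows ws, then B consists
   of the rows of Q with a nonzero diagonal entry, and C of the matching columns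
   of the inverse of Q. *)
Lemma lattice_basis n (ws : seq 'rV[R]_n) :
  (forall w, w \in ws -> integral_points R n w) ->
  exists d (B : 'M[R]_(d, n)) (C : 'M[R]_(n, d)),
    [/\ integral_mx B, integral_mx C, B *m C = 1%:M &
      forall x, x \in <<ws>>%VS <-> x = x *m C *m B].
Proof.
move=> wint; pose k := size ws.
pose M : 'M[int]_(k, n) := \matrix_(i, j) Num.floor (ws`_i 0 j).
have [L Lu [Q Qu [ds _ ME]]] := int_Smith_normal_form M.
pose f m1 m2 : 'M[int]_(m1, m2) -> 'M[R]_(m1, m2) := map_mx intr.
have fM m1 m2 m3 (X : 'M[int]_(m1, m2)) (Y : 'M[int]_(m2, m3)) : f _ _ (X *m Y) = f _ _ X *m f _ _ Y.
  exact: map_mxM.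
have f1 m1 : f m1 m1 1%:M = 1%:M by exact: map_mx1.
have spM x : x \in <<ws>>%VS <-> exists y, x = y *m f _ _ M.
  rewrite -span_rows; have -> // : [seq row i (f _ _ M) | i <- enum 'I_k] = ws.
  apply: (@eq_from_nth _ 0); first by rewrite size_map size_enum_ord.
  rewrite size_map size_enum_ord => i ik.
  rewrite (nth_map (Ordinal ik)) ?size_enum_ord //; apply/rowP => j.
  rewrite !mxE (nth_ord_enum _ (Ordinal ik)) /=; have := wint _ (mem_nth 0 ik) j.
  by move=> /floorK.
pose D : 'M[int]_(k, n) := \matrix_(i, j) (ds`_i *+ (i == j :> nat)).
pose J := [pred j : 'I_n | (j < k)%N && (ds`_j != 0)].
pose E : 'M[R]_n := \matrix_(i, j) ((i == j) && J i)%:R.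
(* [Dp] inverts the nonzero diagonal entries of [D], so [Dp] times [D] is the coordinate projection
   [E] onto [J]. *)
pose Dp : 'M[R]_(n, k) := \matrix_(i, j) (((ds`_j)%:~R)^-1 *+ ((i == j :> nat) && J i)).
have DE : f _ _ D *m E = f _ _ D.
  apply/matrixP => i j; rewrite mxE (bigD1 j) //= big1 ?addr0; last first.
    by move=> j' /negbTE nj; rewrite [E _ _]mxE nj mulr0.
  rewrite !mxE eqxx /=; have [ij|] := eqVneq (i : nat) j; last by rewrite mulr0n mul0r.
  by rewrite -ij ltn_ord /=; case: eqP => [->|_]; rewrite ?mul0rn ?mul0r ?mulr1.
have DpD : Dp *m f _ _ D = E.
  apply/matrixP => i j; rewrite [RHS]mxE mxE.
  have [Ji|nJi] := boolP (J i); last first.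
    by rewrite andbF big1 // => j' _; rewrite !mxE (negbTE nJi) andbF mul0r.
  have /andP[ik di] := Ji; rewrite (bigD1 (Ordinal ik)) //= big1 ?addr0; last first.
    move=> j' nj; rewrite !mxE; case: eqP => [ij|_]; last by rewrite mul0r.
    by case/eqP: nj; apply: val_inj.
  rewrite !mxE Ji /= eqxx /= mulr1n -val_eqE /= andbT.
  case: eqP => _; last by rewrite mulr0.
  by rewrite mulr1n mulVf // intr_eq0.
pose d := #|J|; pose B : 'M[R]_(d, n) := rowsub (@enum_val _ J) (f _ _ Q).
pose C : 'M[R]_(n, d) := colsub (@enum_val _ J) (f _ _ (invmx Q)).
have QQ : f _ _ Q *m f _ _ (invmx Q) = 1%:M by rewrite -fM mulmxV.
have QQ' : f _ _ (invmx Q) *m f _ _ Q = 1%:M by rewrite -fM mulVmx.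
have LL' : f _ _ (invmx L) *m f _ _ L = 1%:M by rewrite -fM mulVmx.
have CB : C *m B = f _ _ (invmx Q) *m E *m f _ _ Q.
  apply/matrixP => i j; rewrite !mxE.
  transitivity (\sum_(t | J t) f _ _ (invmx Q) i t * f _ _ Q t j).
    by rewrite [RHS]big_enum_val /=; apply: eq_bigr => t _; rewrite !mxE.
  rewrite big_mkcond; apply: eq_bigr => t _; rewrite [in RHS]mxE.
  rewrite (bigD1 t) //= big1 ?addr0; last first.
    by move=> t' /negbTE nt; rewrite [E _ _]mxE nt mulr0.
  rewrite [E _ _]mxE eqxx andTb -[(_ < _)%N && _]/(J t).
  by case: (J t); rewrite ?mulr1 // mulr0 mul0r.
exists d, B, C; split.
- by move=> i j; rewrite !mxE intr_int.
- by move=> i j; rewrite !mxE intr_int.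
- apply/matrixP => i j; have := congr1 (fun X : 'M[R]_n => X (enum_val i) (enum_val j)) QQ.
  rewrite !mxE (inj_eq enum_val_inj) => <-; apply: eq_bigr => t _.
  by rewrite !mxE.
move=> x; rewrite spM -mulmxA CB; split=> [[y ->]|xE].
  rewrite [in LHS]ME [in RHS]ME !fM -!mulmxA; congr (_ *m (_ *m _)).
  by rewrite [in RHS](mulmxA (f _ _ Q)) QQ mul1mx mulmxA DE.
exists (x *m f _ _ (invmx Q) *m Dp *m f _ _ (invmx L)).
rewrite ME !fM -/D {1}xE -DpD !mulmxA; congr (_ *m _ *m _).
by rewrite -[RHS]mulmxA LL' mulmx1.
Qed.
End LatticeBasis.

Section Pyramid.
Variable R : realType.
Local Notation hom := (at_height 1).

Lemma vertex_hull_mem n (s : seq 'rV[R]_n) v : vertex (convex_hull [set` s]) v -> v \in s.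
Proof.
move=> [_ [u [c [ule E]]]].
have [vP uv] : convex_hull [set` s] v /\ pairing u v = c by have : [set v] v by []; rewrite E.
pose w : 'cV[R]_(n + 1) := col_mx (- u) (const_mx c).
have wE x : pairing w (hom x) = c - pairing u x.
  by rewrite pairing_row_col pairingNl pairing_const mul1r addrC.
have /convex_hullP vc := vP.
have c' : cone [seq z <- map hom s | all (fun w : 'cV[R]_(n + 1) => pairing w z == 0) [:: w]] (hom v).
  apply: cone_face vc _ => [w' z|w']; rewrite inE => /eqP ->; last by rewrite wE uv subrr.
  by move=> /mapP[p ps ->]; rewrite wE subr_ge0 ule //; apply: mem_convex_hull.
have [z] : exists z, z \in [seq z <- map hom s | all (fun w : 'cV[R]_(n + 1) => pairing w z == 0) [:: w]].
  case: [seq _ <- _ | _] c' => [|z ? _]; last by exists z; rewrite mem_head.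
  move=> [a [_]]; rewrite big_nil => E0; have := congr1 (pairing (height n)) E0.
  by rewrite pairing_height pairing0r => /eqP; rewrite oner_eq0.
rewrite mem_filter /= andbT => /andP[/eqP + /mapP[p ps zE]]; rewrite zE wE => uw.
have : [set v] p by rewrite E; split; [exact: mem_convex_hull|lra].
by move=> <-.
Qed.

(** All functionals that are 1 at the apex agree, and such a [u] vanishes at every other generator.
    These form a base at lattice distance 1 from [e], and [lattice_basis] gives full-dimensional
    coordinates on it. *)
Lemma apex_lattice_pyramid n (s : seq 'rV[R]_n) us m e :
  gor_cone (map hom s) us (height n) m -> apex (map hom s) us e ->
  (1 < \dim <<map hom s>>)%N -> lattice_pyramid (convex_hull [set` s]).
Proof.
set vs := map hom s; set h := height n => G /andP[ge /subvP lev] dim1; right.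
have [u uin ue] := good_ex1 G ge; have /andP[ein _] := ge.
(* If c = u(v) > 0, then c >= 1, and v - c e lies in the cone by the apex property, at height 1 - c;
   so c = 1 and v = e. *)
have u0 v : v \in vs -> v != e -> pairing u v = 0.
  move=> vin; apply: contraNeq => uv; set c := pairing u v.
  have c0 : 0 < c by rewrite lt_neqAle eq_sym uv (gor_ge0 G).
  have c1 : 1 <= c by apply: int_ge1 => //; apply: (gor_us_int G) => //; [exact: memv_span|exact: (gor_vs_int G)].
  have cc : cone vs (v - c *: e).
    apply: (gor_mem G) => [|w win]; first by rewrite memvB ?memvZ ?memv_span.
    rewrite pairingBr pairingZr; have [->|we] := good_01 G ge win.
      by rewrite mulr0 subr0 (gor_ge0 G).
    have /lev/levelP[_ H] := memv_span vin.
    by rewrite we mulr1 (H w u) // subrr.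
  have hc : pairing h (v - c *: e) = 1 - c.
    by rewrite pairingBr pairingZr !(gor_height G) // mulr1.
  have := gor_height_ge0 G cc; rewrite hc subr_ge0 => c1'.
  have cE : c = 1 by apply: le_anti; rewrite c1 c1'.
  have := gor_height_eq0 G cc; rewrite hc cE subrr scale1r => /(_ erefl) /eqP.
  by rewrite subr_eq0.
pose ws0 := [seq v <- vs | v != e].
have [v0 v0in] : exists v0, v0 \in ws0.
  have [/hasP[v vin ve]|/hasPn H] := boolP (has (fun v => v != e) vs).
    by exists v; rewrite mem_filter ve.
  have sub : (<<vs>> <= <[e]>)%VS.
    by apply/span_subvP => v /H /negPn/eqP ->; rewrite memv_line.
  by move: dim1; rewrite ltnNge (leq_trans (dimvS sub)) // dim_vline leq_b1.
have v0vs : v0 \in vs by move: v0in; rewrite mem_filter => /andP[].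
have uv0 : pairing u v0 = 0 by move: v0in; rewrite mem_filter => /andP[v0e _]; apply: u0.
pose ws := [seq v - v0 | v <- ws0].
have vint v : v \in vs -> integral_points R _ v by apply: (gor_vs_int G).
have wsint w : w \in ws -> integral_points R _ w.
  by move=> /mapP[v]; rewrite mem_filter => /andP[_ vin] ->; apply: integralB; apply: vint.
have [d [B [C [Bint Cint BC spws]]]] := lattice_basis wsint.
(* [Pi] sends [e] to 0 and every other generator [v] to [v - v0], a direction of the base; [C] then
   reads off lattice coordinates. *)
pose Pi : 'M[R]_(n + 1) := 1%:M - h *m v0 - u *m (e - v0).
have PiE x : x *m Pi = x - pairing h x *: v0 - pairing u x *: (e - v0).
  by rewrite /Pi mulmxBr (mulmxBr x 1%:M) mulmx1 !mulmx_rank1.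
have Pie : e *m Pi = 0 by rewrite PiE (gor_height G) // ue !scale1r subrr.
have Piv v : v \in vs -> v != e -> v *m Pi = v - v0.
  by move=> vin ve; rewrite PiE (gor_height G) // u0 // scale1r scale0r subr0.
have PiU x : x \in <<vs>>%VS -> x *m Pi \in <<ws>>%VS.
  have sub : (<<vs>> <= linfun (mulmxr Pi : 'rV_(n + 1) -> 'rV_(n + 1)) @^-1: <<ws>>)%VS.
    apply/span_subvP => v vin; rewrite -memv_preim lfunE /=.
    have [->|ve] := eqVneq v e; first by rewrite Pie mem0v.
    by rewrite Piv // memv_span //; apply/mapP; exists v; rewrite // mem_filter ve.
  by move=> /(subvP sub); rewrite -memv_preim lfunE.
pose WQ := [seq (v - v0) *m C | v <- ws0].
have WQ0 : 0 \in WQ by apply/mapP; exists v0; rewrite // subrr mul0mx.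
pose W := [seq row_mx (row_mx q (0 : 'rV[R]_0)) (0 : 'rV[R]_1) | q <- WQ] ++
    [seq row_mx (row_mx (0 : 'rV[R]_d) y) (const_mx 1 : 'rV[R]_1) | y <- [:: (0 : 'rV[R]_0)]].
pose A : 'M[R]_(n + 1, d + 0 + 1) := row_mx (row_mx (Pi *m C) 0) u.
have AE x : x *m A = row_mx (row_mx (x *m Pi *m C) 0) (const_mx (pairing u x) : 'rV_1).
  by rewrite /A !mul_mx_row mulmxA mulmx0 mulmx_pairing.
have Ae : e *m A = row_mx (row_mx 0 0) (const_mx 1 : 'rV_1) by rewrite AE Pie mul0mx ue.
have Av v : v \in vs -> v != e -> v *m A = row_mx (row_mx ((v - v0) *m C) 0) (0 : 'rV_1).
  by move=> vin ve; rewrite AE Piv // u0.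
have chart : lattice_chart vs h W A.
  split.
  - move=> v vin; rewrite mem_cat; apply/orP; have [->|ve] := eqVneq v e.
      by right; rewrite Ae; apply/mapP; exists 0; rewrite // mem_head.
    left; rewrite Av //; apply/mapP; exists ((v - v0) *m C) => //.
    by apply/mapP; exists v; rewrite // mem_filter ve.
  - move=> w; rewrite mem_cat => /orP[/mapP[_ /mapP[v + ->] ->]|/mapP[y _ ->]].
      by rewrite mem_filter => /andP[ve vin]; exists v; rewrite // Av.
    by exists e; rewrite // Ae [y]thinmx0.
  - move=> x xU hx; rewrite AE => /eqP; rewrite !row_mx_eq0.
    move=> /andP[/andP[/eqP xC _] /eqP/matrixP/(_ 0 0)]; rewrite !mxE => ux.
    have := (spws _).1 (PiU x xU); rewrite xC mul0mx PiE hx ux !scale0r !subr0.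
    by [].
  - move=> x xU hx; rewrite AE !integral_row_mx integral_const.
    have z0 : integral_points R 0 (0 : 'rV[R]_0) by exact: integral0.
    split=> [[[xC _] ux]|xi].
      have -> : x = x *m Pi + pairing h x *: v0 + pairing u x *: (e - v0).
        by rewrite PiE addrAC subrK subrK.
      have xPE := (spws _).1 (PiU x xU); rewrite xPE.
      apply: integralD; first apply: integralD.
      - exact: integral_mulmx.
      - by apply: integralZ => //; apply: vint.
      - by apply: integralZ => //; apply: integralB; apply: vint.
    have ux : pairing u x \is a Num.int by apply: (gor_us_int G).
    split=> //; split=> //; apply: integral_mulmx => //; rewrite PiE.
    apply: integralB; first apply: integralB => //.
    - by apply: integralZ => //; apply: vint.
    - by apply: integralZ => //; apply: integralB; apply: vint.
exists d, (convex_hull [set` WQ]); split.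
- split; first by split; [exists 0; apply: mem_convex_hull | exists WQ].
  move=> v /vertex_hull_mem /mapP[z zin ->]; apply: integral_mulmx => //.
  by apply: wsint; apply/mapP; exists z.
- have WQn : WQ != [::] by case: (WQ) WQ0.
  apply: succn_inj; rewrite -(aff_dim_hull WQn).
  have -> : <<map hom WQ>>%VS = fullv; last by rewrite dimvf /dim /= mul1n addn1.
  apply/eqP; rewrite eqEsubv subvf /=; apply/subvP => z _.
  have [y ->] := at_heightP z; set t := pairing _ _.
  have h0 : hom 0 \in <<map hom WQ>>%VS by rewrite memv_span // map_f.
  have -> : at_height t y = lift0 R d y + t *: hom 0.
    by rewrite lift0E at_heightZ at_heightD scaler0 addr0 mulr1 add0r.
  rewrite memvD ?memvZ //.
  have yB : y *m B \in <<ws>>%VS by apply/spws; rewrite -[y *m B *m C]mulmxA BC mulmx1.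
  have -> : y = linfun (mulmxr C : 'rV_(n + 1) -> 'rV_d) (y *m B).
    by rewrite lfunE /= -mulmxA BC mulmx1.
  have sub : (<<ws>> <= (lift0 R d \o linfun (mulmxr C : 'rV_(n + 1) -> 'rV_d)) @^-1: <<map hom WQ>>)%VS.
    apply/span_subvP => _ /mapP[v vin ->]; rewrite -memv_preim comp_lfunE lift0E lfunE /=.
    have -> : at_height 0 ((v - v0) *m C) = hom ((v - v0) *m C) - hom 0.
      by rewrite at_heightB subrr subr0.
    by rewrite memvB // memv_span //; apply/map_f/mapP; exists v.
  by have := subvP sub _ yB; rewrite -memv_preim comp_lfunE.
- have -> : [set (0 : 'rV[R]_0)] = convex_hull [set` [:: (0 : 'rV[R]_0)]].
    apply/seteqP; split=> [x ->|x _]; last by rewrite [x]thinmx0.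
    by apply: mem_convex_hull; rewrite /= mem_head.
  by rewrite free_join_hull; apply: chart_isomorphic chart.
Qed.
End Pyramid.

(** * A free join of squares is not a lattice pyramid *)

Section JoinNotPyramid.
Variable R : realType.

(** In a polytope with all coordinates in [0, 1] this keeps [z] off the interior of every segment
    that starts at [w]. So [z] lies in the base when [w] is the apex of a pyramid. *)
Definition opposite_at n (w z : 'rV[R]_n) := exists i,
  w 0 i = 0 /\ z 0 i = 1 \/ w 0 i = 1 /\ z 0 i = 0.

Lemma opposite_row_mxl n1 n2 (w z : 'rV[R]_n1) (y y' : 'rV[R]_n2) :
  opposite_at w z -> opposite_at (row_mx w y) (row_mx z y').
Proof. by move=> [i H]; exists (lshift _ i); rewrite !row_mxEl. Qed.

Lemma opposite_row_mxr n1 n2 (w z : 'rV[R]_n2) (y y' : 'rV[R]_n1) :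
  opposite_at w z -> opposite_at (row_mx y w) (row_mx y' z).
Proof. by move=> [i H]; exists (rshift _ i); rewrite !row_mxEr. Qed.

Lemma square_vertices_parallelogram w : w \in square_vertices R ->
  exists z z' w', [/\ z \in square_vertices R, z' \in square_vertices R,
    w' \in square_vertices R, w + w' = z + z' & opposite_at w z /\ opposite_at w z'].
Proof.
have key a b : (a = 0 \/ a = 1) -> (b = 0 \/ b = 1) ->
    opposite_at (square_point a b) (square_point (1 - a) b) /\
    opposite_at (square_point a b) (square_point a (1 - b)) :> Prop.
  move=> ha hb; split; [exists 0|exists 1]; rewrite !mxE /=.
    by case: ha => ->; rewrite ?subr0 ?subrr; [left|right].
  by case: hb => ->; rewrite ?subr0 ?subrr; [left|right].
have mem a b : (a = 0 \/ a = 1) -> (b = 0 \/ b = 1) -> square_point a b \in square_vertices R.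
  by move=> [->|->] [->|->]; rewrite !inE eqxx ?orbT.
have c01 (a : R) : (a = 0 \/ a = 1) -> (1 - a = 0 \/ 1 - a = 1).
  by case=> ->; rewrite ?subr0 ?subrr; [right|left].
move=> win; have [a [b [-> ha hb]]] : exists a b,
    [/\ w = square_point a b, a = 0 \/ a = 1 & b = 0 \/ b = 1].
  move: win; rewrite !inE => /or4P[] /eqP ->;
  by do 2!eexists; split; first reflexivity; by [left|right].
exists (square_point (1 - a) b), (square_point a (1 - b)), (square_point (1 - a) (1 - b)).
split; rewrite ?mem ?c01 //; try exact: c01; last exact: key.
by apply/rowP => i; rewrite !mxE; case: ifP => _; ring.
Qed.

Lemma join_vertices_parallelogram k w : w \in join_vertices R k ->
  exists z z' w', [/\ z \in join_vertices R k, z' \in join_vertices R k,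
    w' \in join_vertices R k, w + w' = z + z' & opposite_at w z /\ opposite_at w z'].
Proof.
elim: k w => [|k IH] w; first exact: square_vertices_parallelogram.
have memL x : x \in join_vertices R k ->
    row_mx (row_mx x (0 : 'rV[R]_2)) (0 : 'rV[R]_1) \in join_vertices R k.+1.
  by move=> xin; rewrite mem_cat; apply/orP; left; apply/mapP; exists x.
have memR y : y \in square_vertices R ->
    row_mx (row_mx (0 : 'rV[R]_(free_join_dim 2 k)) y) (const_mx 1 : 'rV[R]_1)
      \in join_vertices R k.+1.
  by move=> yin; rewrite mem_cat; apply/orP; right; apply/mapP; exists y.
rewrite mem_cat => /orP[/mapP[x xin ->]|/mapP[y yin ->]].
  have [z [z' [w' [zin z'in w'in E [oz oz']]]]] := IH x xin.
  do 3!eexists; split; [exact: memL zin|exact: memL z'in|exact: memL w'in| |].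
    by rewrite !add_row_mx E.
  by split; do 2!apply: opposite_row_mxl.
have [z [z' [w' [zin z'in w'in E [oz oz']]]]] := square_vertices_parallelogram yin.
do 3!eexists; split; [exact: memR zin|exact: memR z'in|exact: memR w'in| |].
  by rewrite !add_row_mx E.
by split; apply: opposite_row_mxl; apply: opposite_row_mxr.
Qed.

Lemma join_vertices_01 k w i : w \in join_vertices R k -> 0 <= w 0 i <= 1.
Proof.
have sq y j : y \in square_vertices R -> 0 <= y 0 j <= 1.
  by rewrite !inE => /or4P[] /eqP ->; rewrite mxE; case: ifP => _; rewrite ?lexx ?ler01.
elim: k w i => [|k IH] w i; first exact: sq.
rewrite mem_cat => /orP[/mapP[x xin ->]|/mapP[y yin ->]];
rewrite mxE; case: splitP => j _; rewrite ?mxE ?lexx ?ler01 //;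
case: splitP => j' _; rewrite ?mxE ?lexx ?ler01 ?IH //; exact: sq.
Qed.

Lemma join_hull_01 k x i : convex_hull [set` join_vertices R k] x -> 0 <= x 0 i <= 1.
Proof.
move=> [j [p [a [ps a0 a1 ->]]]]; rewrite summxE; apply/andP; split.
  apply: sumr_ge0 => t _; rewrite mxE mulr_ge0 //.
  by have /andP[] := join_vertices_01 i (ps t).
rewrite -a1; apply: ler_sum => t _; rewrite mxE ler_piMr //.
by have /andP[] := join_vertices_01 i (ps t).
Qed.

Lemma convex_hull_split n (B : set 'rV[R]_n) k (p : 'I_k -> 'rV[R]_n) (a : 'I_k -> R)
    (D : pred 'I_k) : (forall i, B (p i)) -> (forall i, 0 <= a i) -> \sum_i a i = 1 ->
  \sum_(i | D i) a i < 1 ->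
  exists2 q, convex_hull B q & (1 - \sum_(i | D i) a i) *: q =
    \sum_i a i *: p i - \sum_(i | D i) a i *: p i.
Proof.
move=> pB a0 a1; set t := \sum_(i | D i) a i => t1.
have t1' : 1 - t != 0 by rewrite subr_eq0 eq_sym lt_eqF.
have aD : \sum_(i | ~~ D i) a i = 1 - t.
  by have := a1; rewrite (bigID D) /= -/t => <-; rewrite addrAC subrr add0r.
pose b i := if D i then 0 else a i / (1 - t).
exists (\sum_i b i *: p i).
  exists k, p, b; split=> // [i|].
    by rewrite /b; case: ifP => // _; rewrite divr_ge0 // subr_ge0 ltW.
  rewrite (bigID D) /= big1 ?add0r => [|i Di]; last by rewrite /b Di.
  rewrite (eq_bigr (fun i => a i / (1 - t))) => [|i nDi]; last by rewrite /b (negbTE nDi).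
  by rewrite -mulr_suml aD divff.
rewrite [in RHS](bigID D) /= [in RHS]addrAC subrr add0r scaler_sumr (bigID D) /= big1 ?add0r => [|i Di].
  by apply: eq_bigr => i nDi; rewrite /b (negbTE nDi) scalerA mulrC divfK.
by rewrite /b Di scale0r scaler0.
Qed.

Section Pyr.
Variables (m : nat) (Q : set 'rV[R]_m).
Let Pyr := free_join Q [set (0 : 'rV[R]_0)].
Let top : 'rV[R]_(m + 0 + 1) := row_mx (row_mx 0 0) (const_mx 1).
Let ell : 'cV[R]_(m + 0 + 1) := height (m + 0).

Lemma pyramid_top : Pyr top /\ pairing ell top = 1.
Proof.
split; first by apply: mem_convex_hull; right; exists 0.
exact: pairing_height.
Qed.

(** [ell] is the total weight placed on [top], as the other generators have height 0; the remaining
    weight is renormalized to give [q]. *)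
Lemma pyramid_decomposition y : Pyr y -> 0 <= pairing ell y <= 1 /\
  (pairing ell y = 1 -> y = top) /\
  (pairing ell y < 1 -> exists2 q, Pyr q &
     y = (1 - pairing ell y) *: q + pairing ell y *: top).
Proof.
move=> [k [p [a [pB a0 a1 yE]]]].
have pD i : pairing ell (p i) = 0 \/ p i = top.
  case: (pB i) => [[x _ <-]|[x _ <-]]; first by left; apply: (pairing_height 0).
  by right; rewrite [x]thinmx0.
pose D i := pairing ell (p i) != 0.
have Dtop i : D i -> p i = top by case: (pD i) => [/eqP E|//]; rewrite /D E.
have [topP topell] := pyramid_top.
have sD : \sum_(i | D i) a i *: p i = (\sum_(i | D i) a i) *: top.
  by rewrite scaler_suml; apply: eq_bigr => i /Dtop ->.
have ellE : pairing ell y = \sum_(i | D i) a i.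
  rewrite yE pairing_sumr (bigID D) /= [X in _ + X]big1 ?addr0 => [|i].
    by apply: eq_bigr => i /Dtop ->; rewrite pairingZr topell mulr1.
  by rewrite negbK pairingZr => /eqP ->; rewrite mulr0.
have aD : \sum_(i | ~~ D i) a i = 1 - pairing ell y.
  by have := a1; rewrite (bigID D) /= -ellE => <-; rewrite addrAC subrr add0r.
split; last split.
- by rewrite {1}ellE sumr_ge0 //= -subr_ge0 -aD sumr_ge0.
- move=> e1; move: aD; rewrite e1 subrr => /eqP; rewrite psumr_eq0 // => /allP H.
  rewrite yE (bigID D) /= sD -ellE e1 scale1r big1 ?addr0 // => i nDi.
  by have /implyP/(_ nDi)/eqP -> := H i (mem_index_enum _); rewrite scale0r.
- move=> lt; rewrite ellE in lt *.
  have [q qP qE] := convex_hull_split pB a0 a1 lt.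
  by exists q => //; rewrite qE sD -yE subrK.
Qed.
End Pyr.

Lemma affine_hull2 n (P : set 'rV[R]_n) x y t : P x -> P y ->
  affine_hull P ((1 - t) *: x + t *: y).
Proof.
move=> Px Py; exists 2%N, (fun i : 'I_2 => if i == 0 then x else y),
  (fun i : 'I_2 => if i == 0 then 1 - t else t).
rewrite !big_ord_recl !big_ord0 /= !addr0 subrK.
by split=> // i; case: ifP.
Qed.

(** The apex corresponds to a vertex of the join, which has neighbours [z], [z'] and an opposite
    vertex [w'] in a parallelogram. Both neighbours have [ell] equal to 0, so 1 + ell = 0 at [w'],
    against ell >= 0. *)
Lemma join_not_pyramid n (P : set 'rV[R]_n) m (Q : set 'rV[R]_m) k :
  isomorphic P (convex_hull [set` join_vertices R k]) ->
  isomorphic P (free_join Q [set (0 : 'rV[R]_0)]) -> False.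
Proof.
set J := convex_hull _; set Pyr := free_join _ _.
move=> [g [gaff [_ ginj _] gP _]] [f [faff [_ finj _] fP _]].
set ell : 'cV[R]_(m + 0 + 1) := height (m + 0).
set top : 'rV[R]_(m + 0 + 1) := row_mx (row_mx 0 0) (const_mx 1).
have [topP topell] := pyramid_top Q; rewrite -/ell -/top -/Pyr in topP topell.
have dec y : Pyr y -> 0 <= pairing ell y <= 1 /\ (pairing ell y = 1 -> y = top) /\
    (pairing ell y < 1 -> exists2 q, Pyr q & y = (1 - pairing ell y) *: q + pairing ell y *: top).
  exact: pyramid_decomposition.
have affP x : P x -> affine_hull P x by apply: mem_affine_hull.
have ginj' x y : affine_hull P x -> affine_hull P y -> g x = g y -> x = y.
  by move=> Hx Hy; apply: ginj; rewrite inE.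
have finj' x y : affine_hull P x -> affine_hull P y -> f x = f y -> x = y.
  by move=> Hx Hy; apply: finj; rewrite inE.
have fPy x : P x -> Pyr (f x) by move=> Px; rewrite -fP; exists x.
have gJ x : P x -> J (g x) by move=> Px; rewrite -gP; exists x.
have glift w : J w -> exists2 x, P x & g x = w by rewrite -gP => -[x Px <-]; exists x.
have [a aP fa] : exists2 x, P x & f x = top by move: topP; rewrite -fP => -[x Px <-]; exists x.
have gcomb x y z t : P x -> P y -> P z -> g z = (1 - t) *: g x + t *: g y ->
    z = (1 - t) *: x + t *: y.
  move=> Px Py Pz E; apply: ginj'; [exact: affP|exact: affine_hull2|].
  by rewrite E gaff //; apply: affP.
have fcomb x y z t : P x -> P y -> P z -> f z = (1 - t) *: f x + t *: f y ->
    z = (1 - t) *: x + t *: y.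
  move=> Px Py Pz E; apply: finj'; [exact: affP|exact: affine_hull2|].
  by rewrite E faff //; apply: affP.
(* [top] is the only point where [ell] reaches its maximum 1. A vertex of the join with positive
   weight in [g a] must therefore also correspond to [top], so it is [g a]. *)
have aw : g a \in join_vertices R k.
  have [j [p [c [pJ c0 c1 gaE]]]] := gJ a aP.
  have [i ci] : exists i, 0 < c i.
    apply: contrapT => /forallNP H; have : \sum_i c i = 0.
      apply: big1 => i _; apply: le_anti; rewrite c0 andbT leNgt; exact/negP/H.
    by rewrite c1 => /eqP; rewrite oner_eq0.
  have [ci1|ci1] := ltP (c i) 1; last first.
    have E : c i + \sum_(j | j != i) c j = 1 by rewrite -c1 [RHS](bigD1 i).
    have z0 : \sum_(j | j != i) c j = 0.
      apply: le_anti; rewrite sumr_ge0 ?andbT //; lra.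
    have ci1' : c i = 1 by lra.
    have -> : g a = p i; last exact: pJ.
    rewrite gaE (bigD1 i) //= ci1' scale1r big1 ?addr0 // => t ti.
    move: z0 => /eqP; rewrite psumr_eq0 // => /allP H.
    by have /implyP/(_ ti)/eqP -> := H t (mem_index_enum _); rewrite scale0r.
  have lt : \sum_(t | t == i) c t < 1 by rewrite big_pred1_eq.
  have [q qJ qE] := convex_hull_split pJ c0 c1 lt.
  rewrite !big_pred1_eq -gaE in qE.
  have [x xP gx] := glift q qJ.
  have [y yP gy] := glift (p i) (mem_convex_hull (pJ i)).
  have aE : a = (1 - c i) *: x + c i *: y.
    by apply: gcomb => //; rewrite gx gy qE subrK.
  have ell1 : pairing ell (f y) = 1.
    have := topell; rewrite -fa aE faff; [|exact: affP|exact: affP].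
    rewrite pairingDr !pairingZr => E.
    have [/andP[_ x1] _] := dec _ (fPy x xP); have [/andP[_ y1] _] := dec _ (fPy y yP).
    apply: le_anti; rewrite y1 /=.
    have : (1 - c i) * pairing ell (f x) <= (1 - c i) * 1.
      by rewrite ler_wpM2l // subr_ge0 ltW.
    by move=> H; rewrite -(ler_pM2l ci); lra.
  have [_ [+ _]] := dec _ (fPy y yP) => /(_ ell1); rewrite -fa => /finj' ya.
  by rewrite -(ya (affP _ yP) (affP _ aP)) gy; exact: pJ.
have [z [z' [w' [zin z'in w'in E [oz oz']]]]] := join_vertices_parallelogram aw.
have liftv v : v \in join_vertices R k -> exists2 x, P x & g x = v.
  by move=> vin; apply/glift/mem_convex_hull.
have [zP zPP gz] := liftv z zin; have [z'P z'PP gz'] := liftv z' z'in.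
have [wP wPP gw] := liftv w' w'in.
have ell0 x : P x -> opposite_at (g a) (g x) -> pairing ell (f x) = 0.
  move=> xP [i Hi]; have [/andP[t0 t1] [Htop Hq]] := dec _ (fPy x xP).
  set t := pairing ell (f x) in t0 t1 Htop Hq *.
  have tlt : t < 1.
    rewrite lt_neqAle t1 andbT; apply/eqP => /Htop; rewrite -fa => /finj' xa.
    move: Hi; rewrite (xa (affP _ xP) (affP _ aP)).
    by case=> -[->] => /eqP; rewrite ?oner_eq0 // eq_sym oner_eq0.
  have [q] := Hq tlt; rewrite -{1}fP => -[qP qPP <-] fx.
  have xE : x = (1 - t) *: qP + t *: a by apply: fcomb; rewrite // fa.
  have gx : g x = (1 - t) *: g qP + t *: g a by rewrite {1}xE gaff //; apply: affP.
  have /andP[q0 q1] := join_hull_01 i (gJ qP qPP).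
  have := congr1 (fun v : 'rV[R]_(free_join_dim 2 k) => v 0 i) gx.
  rewrite !mxE => gxi; apply: le_anti; rewrite t0 andbT.
  have p0 : 0 <= (1 - t) * g qP 0 i by rewrite mulr_ge0 // subr_ge0.
  have p1 : (1 - t) * g qP 0 i <= 1 - t by rewrite ler_piMr // subr_ge0.
  by case: Hi => -[e1 e2]; move: gxi; rewrite e1 e2 ?mulr0 ?mulr1; lra.
have half : (1 - 2^-1) = 2^-1 :> R by field.
(* Isomorphisms respect affine combinations only, so the parallelogram relation is used as an
   equality of midpoints. *)
have mid : (1 - 2^-1) *: a + 2^-1 *: wP = (1 - 2^-1) *: zP + 2^-1 *: z'P.
  apply: ginj'; [exact: affine_hull2|exact: affine_hull2|].
  rewrite !gaff; [|exact: affP..].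
  by rewrite gw gz gz' half -!scalerDr E.
have := congr1 (fun x => pairing ell (f x)) mid.
rewrite !faff; [|exact: affP..].
rewrite half -!scalerDr !pairingZr !pairingDr fa topell.
rewrite (ell0 zP) ?gz // (ell0 z'P) ?gz' //.
have [/andP[w0 _] _] := dec _ (fPy wP wPP).
move=> H; move: w0; rewrite leNgt => /negP; apply; lra.
Qed.
End JoinNotPyramid.

(** * Numerical data of the polytope and the equivalence *)

Section Main.
Variable R : realType.
Local Notation hom := (at_height 1).

(** The codegree is r: an interior lattice point of the dilate by q is at least 1 on every
    functional, so subtracting [m] stays in the cone, at height q - r >= 0. Degree s and dimension 3
    s - 1 then give r = 2 s. *)
Lemma gorenstein_data n (P : set 'rV[R]_n) s : gorenstein P -> (0 < s)%N ->
  aff_dim P = (3 * s - 1)%N -> degree P = s ->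
  exists s0 us m, [/\ P = convex_hull [set` s0], \dim <<map hom s0>> = (3 * s)%N,
    gor_cone (map hom s0) us (height n) m & pairing (height n) m = (2 * s)%:R].
Proof.
move=> [latP [r [r0 [_ [m [mrel mint Hfacet]]]]]] sp dimP degP.
have [s0 [PE sn sint]] := lattice_polytope_hull latP.
have dimU : \dim <<map hom s0>> = (3 * s)%N.
  by rewrite (aff_dim_hull sn) -PE dimP; lia.
rewrite PE in mrel Hfacet; have dim0 : (0 < aff_dim (convex_hull [set` s0]))%N.
  by rewrite -PE dimP; lia.
have [us G] := gorenstein_cone sn sint r0 dim0 mrel mint Hfacet.
have cod : codegree P = r.
  have Hr : interior_multiple P r by split=> //; exists m; split; rewrite // PE.
  have Hmin q : interior_multiple P q -> (r <= q)%N.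
    move=> [q0 [x [xrel xint]]]; rewrite PE in xrel.
    have I := relint_interior q0 xrel.
    have xc := dilate_cone (proj1 xrel).
    have x1 u : u \in us -> 1 <= pairing u (at_height q%:R x).
      move=> uin; apply: int_ge1.
        apply: (gor_us_int G) => //; first exact: cone_span xc.
        by apply/at_height_int; split=> //; exact: rpred_nat.
      rewrite ltNge; apply/negP => le0.
      have u0 := interior_of_eq0 I (fun v vin => gor_ge0 G uin vin) le0.
      have := pairing_span u0 (gor_m_span G); rewrite (gor_m1 G) // => /eqP.
      by rewrite oner_eq0.
    have : cone (map hom s0) (at_height q%:R x - at_height r%:R m).
      apply: (gor_mem G) => [|u uin].
        by rewrite memvB ?(gor_m_span G) // (cone_span xc).
      by rewrite pairingBr (gor_m1 G) // subr_ge0 x1.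
    by move=> /(gor_height_ge0 G); rewrite pairingBr !pairing_height subr_ge0 ler_nat.
  rewrite /codegree; apply: xget_unique => // q [Hq Hqmin].
  by apply/eqP; rewrite eqn_leq Hmin // Hqmin.
exists s0, us, (at_height r%:R m); split=> //.
(* The degree equation is 3 s - r = s in truncated subtraction; as s > 0, nothing is truncated. *)
by rewrite pairing_height; congr _%:R; move: degP; rewrite /degree cod dimP; lia.
Qed.
End Main.

Theorem corollary1p3 (R : realType) (n s : nat) (P : set 'rV[R]_n)
  (gorP : gorenstein P) (s_gt0 : (0 < s)%N)
  (dimP : aff_dim P = (3 * s - 1)%N) (degP : degree P = s) :
  ~ lattice_pyramid P <->
  isomorphic P (free_join_copiesS (unit_square R) s.-1).
Proof.
have [s0 [us [m [PE dimU G hm]]]] := gorenstein_data gorP s_gt0 dimP degP.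
rewrite free_join_copies_hull; split=> [npyr|iso [[p [_ Pp]]|[k [Q [_ _ iso']]]]].
- have na e : ~~ apex (map (at_height 1) s0) us e.
    apply/negP => ae; apply: npyr; rewrite PE; apply: (apex_lattice_pyramid G ae).
    by rewrite dimU; lia.
  have dimU' : \dim <<map (at_height 1) s0>> = (3 * s.-1.+1)%N by rewrite prednK.
  have E32 : 3 * pairing (height n) m = 2 * (\dim <<map (at_height 1) s0>>)%:R.
    by rewrite hm dimU !natrM; ring.
  have [A chart] := squares_chart G na dimU' E32.
  by rewrite PE; apply: chart_isomorphic chart.
(* A single point has dimension 0, but 3 s - 1 >= 2. *)
- have E : convex_hull [set` [:: p]] = P.
    rewrite Pp; apply/seteqP; split=> [x|_ ->]; last by apply: mem_convex_hull; rewrite /= mem_head.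
    move=> [j [q [a [qp _ a1 ->]]]].
    rewrite (eq_bigr (fun i => a i *: p)) => [|i _]; first by rewrite -scaler_suml a1 scale1r.
    by have /= := qp i; rewrite inE => /eqP ->.
  have := @aff_dim_hull R n [:: p] isT; rewrite E dimP /= span_seq1 dim_vline.
  by case: (_ != 0); lia.
- exact: join_not_pyramid iso iso'.
Qed.
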